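(* The weak $\omega$-categories generated by computads with invertible generators can be expressed as the following colimits in $\mathrm{Cat}_\omega$. 1. For $C$ the unique $(-1)$-computad, $K(\mathrm{sk}_{-1}C)$ is initial. 2. For every $0$-computad $C$ (a set $V_0^C$), $K(\mathrm{sk}_0C)$ is the copower $V_0^C\cdot F\mathbb D^0$. 3. For every $n\in\mathbb N$ and every $(n+1)$-computad $C$ with truncation $C_n$, there is a pushout square $$\begin{array}{ccc} V_{n+1}^C\cdot F\mathbb S^n\ \amalg\ U_{n+1}^C\cdot F\mathbb S^n & \longrightarrow & K(\mathrm{sk}_nC_n)\\ \downarrow & & \downarrow\\ V_{n+1}^C\cdot F\mathbb D^{n+1}\ \amalg\ U_{n+1}^C\cdot K(\mathbb E^{n+1}) & \longrightarrow & K(\mathrm{sk}_{n+1}C)\end{array}$$ in which the top map is induced by $\phi_{n+1}^C$ and $\psi_{n+1}^C$, the left map is $V_{n+1}^C\cdot F\iota_{n+1}\ \amalg\ U_{n+1}^C\cdot K(j_{n+1})$, the right map is $K$ of the canonical inclusion $\mathrm{sk}_nC_n\to\mathrm{sk}_{n+1}C$, and the bottom map is induced by the ordinary generators $\mathrm{gen}(v)$, $v\in V_{n+1}^C$, and the invertible generators $\mathrm{igen}(u)$, $u\in U_{n+1}^C$. 4. For every computad with invertible generators $C$ with truncations $C_n$, $K(C)$ is the colimit of the sequence of its skeleta $K(\mathrm{sk}_{-1}C_{-1})\to K(\mathrm{sk}_0C_0)\to K(\mathrm{sk}_1C_1)\to\cdots$, with colimit cocone given by $K$ of the canonical inclusions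 $\mathrm{sk}_nC_n\to C$.
   Context: GLOBULAR SETS. For $n\in\mathbb N\cup\{-1,\omega\}$, an $n$-globular set $X$ consists of sets $X_k$ (of $k$-cells) for natural numbers $k\le n$ and functions $s_k,t_k\colon X_{k+1}\to X_k$ with $s_ks_{k+1}=s_kt_{k+1}$ and $t_ks_{k+1}=t_kt_{k+1}$. They form a presheaf category $\mathrm{gSet}_n$ (terminal for $n=-1$); $\mathrm{gSet}=\mathrm{gSet}_\omega$; $\mathrm{tr}_m$ denotes truncation. An $n$-globular set is regarded as a globular set without cells above dimension $n$. $\mathrm{Par}_n(X)$ is the set of pairs $(a,b)$ of parallel $n$-cells ($n=0$, or $a,b$ have the same source and the same target); $(a,b)^{\mathrm{op}}=(b,a)$. $\mathbb D^n$ is the representable globular set on $n$ and $\iota_n\colon\mathbb S^{n-1}\hookrightarrow\mathbb D^n$ is the globular subset obtained by removing its unique $n$-cell; thus maps $\mathbb S^n\to X$ correspond to elements of $\mathrm{Par}_n(X)$. PASTING DIAGRAMS. The suspension $\Sigma X$ has $(\Sigma X)_0=\{\sigma,\tau\}$, $(\Sigma X)_{n+1}=X_n$, every $1$-cell having source $\sigma$ and target $\tau$; its chosen $0$-cells are $\sigma,\tau$. For globular sets with two chosen $0$-cells (first and last), the wedge sum $X\vee Y$ glues the last $0$-cell of $X$ to the first of $Y$; the empty wedge is $\mathbb D^0$. Batanin trees are defined inductively: $\mathrm{br}[B_1,\dots,B_n]$ is a tree for every finite list of trees. $\dim\mathrm{br}[B_1,\dots,B_n]=\max_i(\dim B_i+1)$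 ($0$ for the empty list); $\partial_0B=\mathrm{br}[\,]$, $\partial_{k+1}\mathrm{br}[B_1,\dots,B_n]=\mathrm{br}[\partial_kB_1,\dots,\partial_kB_n]$. $\mathrm{Pos}(\mathrm{br}[B_1,\dots,B_n])=\Sigma\mathrm{Pos}(B_1)\vee\dots\vee\Sigma\mathrm{Pos}(B_n)$. The maps $\sigma_k^B,\tau_k^B\colon\mathrm{Pos}(\partial_kB)\to\mathrm{Pos}(B)$ are: $\sigma_0^B,\tau_0^B$ pick the first and last chosen $0$-cell, and $\sigma_{k+1}^{\mathrm{br}[B_1,\dots,B_n]}=\Sigma\sigma_k^{B_1}\vee\dots\vee\Sigma\sigma_k^{B_n}$, similarly for $\tau$. Let $D_0=\mathrm{br}[\,]$, $D_{n+1}=\mathrm{br}[D_n]$, so $\mathrm{Pos}(D_n)\cong\mathbb D^n$ with top cell $d_n$; let $Q_1=\mathrm{br}[D_0,D_0]$, $Q_{n+1}=\mathrm{br}[Q_n]$, so $\mathrm{Pos}(Q_n)$ consists of two $n$-cells $p_n,q_n$ with $t_{n-1}p_n=s_{n-1}q_n$ and represents pairs of $n$-cells composable along an $(n-1)$-cell. COMPUTADS WITH INVERTIBLE GENERATORS. By recursion on $n$ one defines: a category $\mathrm{iComp}_n$ with truncation functors; functors $\mathrm{Cell}_n\colon\mathrm{iComp}_n\to\mathrm{gSet}_n$ and $\mathrm{Cptd}_n\colon\mathrm{gSet}_n\to\mathrm{iComp}_n$ with an adjunction $\mathrm{Cptd}_n\dashv\mathrm{Cell}_n$, compatible with truncation;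 for each tree $B$ a set $\mathrm{Full}_n(B)\subseteq\mathrm{Par}_n(\mathrm{Cell}_n\mathrm{Cptd}_n(\mathrm{tr}_n\mathrm{Pos}(B)))$ of full spheres; a functor $I_n\colon\mathrm{iComp}_n\to\mathrm{Set}$ (invertibility set); and natural functions $\mathrm{fwd}_n,\mathrm{linv}_n,\mathrm{rinv}_n\colon I_n(C)\to\mathrm{Cell}_n(C)_n$. Base: $\mathrm{iComp}_{-1}$ is terminal; $\mathrm{iComp}_0=\mathrm{Set}$, $\mathrm{Cell}_0$ and $\mathrm{Cptd}_0$ are identities, $\mathrm{gen}_0$ is the identity (a $0$-computad is its set $V_0$ of generators), $\mathrm{Full}_0(B)=\{(\sigma_0^B,\tau_0^B)\}$, $I_0(C)=\emptyset$. Successor: an $(n+1)$-computad is a tuple $C=(C_n,V_{n+1}^C,U_{n+1}^C,\phi_{n+1}^C,\psi_{n+1}^C)$ with $C_n\in\mathrm{iComp}_n$ (its truncation), sets $V_{n+1}^C$ (ordinary generators) and $U_{n+1}^C$ (invertible generators), and attaching functions $\phi_{n+1}^C\colon V_{n+1}^C\to\mathrm{Par}_n(\mathrm{Cell}_n(C_n))$, $\psi_{n+1}^C\colon U_{n+1}^C\to\mathrm{Par}_n(\mathrm{Cell}_n(C_n))$. The set $I_{n+1}(C)$ is the disjoint union of elements $\mathrm{igen}(u)$ ($u\in U_{n+1}^C$), $\mathrm{lunit}(i)$ and $\mathrm{runit}(i)$ ($i\in I_n(C_n)$). The function $\mathrm{ibdry}\colon I_{n+1}(C)\to\mathrm{Par}_n(\mathrm{Cell}_n(C_n))$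 is $\mathrm{ibdry}(\mathrm{igen}(u))=\psi_{n+1}^C(u)$, $\mathrm{ibdry}(\mathrm{lunit}(i))=(\mathrm{linv}_n(i)*\mathrm{fwd}_n(i),\ \mathrm{id}_n(t_{n-1}\mathrm{fwd}_n(i)))$, $\mathrm{ibdry}(\mathrm{runit}(i))=(\mathrm{fwd}_n(i)*\mathrm{rinv}_n(i),\ \mathrm{id}_n(s_{n-1}\mathrm{fwd}_n(i)))$, with $*$ and $\mathrm{id}$ defined below. For $X\in\mathrm{gSet}_{n+1}$, $\mathrm{Cptd}_{n+1}(X)$ has truncation $\mathrm{Cptd}_n(\mathrm{tr}_nX)$, $V_{n+1}=X_{n+1}$, $U_{n+1}=\emptyset$, and $\phi_{n+1}(x)$ is the image of $(s_nx,t_nx)$ under the unit $\mathrm{tr}_nX\to\mathrm{Cell}_n\mathrm{Cptd}_n(\mathrm{tr}_nX)$. $\mathrm{Cell}_{n+1}(C)$ agrees with $\mathrm{Cell}_n(C_n)$ in dimensions $\le n$. Its set of $(n+1)$-cells with boundary function $\mathrm{bdry}=(s_n,t_n)$, and morphisms of $(n+1)$-computads into $C$, are defined mutually inductively (induction-recursion). The $(n+1)$-cells are freely: $\mathrm{gen}(v)$ for $v\in V_{n+1}^C$, with boundary $\phi_{n+1}^C(v)$; for each $i\in I_{n+1}(C)$, $\mathrm{fwd}_{n+1}(i)$ with boundary $\mathrm{ibdry}(i)$, and $\mathrm{linv}_{n+1}(i)$, $\mathrm{rinv}_{n+1}(i)$ with boundary $\mathrm{ibdry}(i)^{\mathrm{op}}$;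 and $\mathrm{coh}_{B,A}[f]$ for every tree $B$ with $\dim B\le n+1$, $A\in\mathrm{Full}_n(B)$ and morphism $f\colon\mathrm{Cptd}_{n+1}(\mathrm{Pos}(B))\to C$, with boundary $\mathrm{Par}_n(\mathrm{Cell}_n(f_n))(A)$. A morphism $f\colon D\to C$ is a triple of a morphism $f_n\colon D_n\to C_n$ and functions $f_V\colon V_{n+1}^D\to\mathrm{Cell}_{n+1}(C)_{n+1}$, $f_U\colon U_{n+1}^D\to I_{n+1}(C)$ with $\mathrm{bdry}\circ f_V=\mathrm{Par}_n(\mathrm{Cell}_n(f_n))\circ\phi_{n+1}^D$ and $\mathrm{ibdry}\circ f_U=\mathrm{Par}_n(\mathrm{Cell}_n(f_n))\circ\psi_{n+1}^D$. Action of $f$: $I_{n+1}(f)$ sends $\mathrm{igen}(u)\mapsto f_U(u)$, $\mathrm{lunit}(i)\mapsto\mathrm{lunit}(I_n(f_n)(i))$, $\mathrm{runit}(i)\mapsto\mathrm{runit}(I_n(f_n)(i))$; $\mathrm{Cell}_{n+1}(f)$ is $\mathrm{Cell}_n(f_n)$ below dimension $n+1$ and sends $\mathrm{gen}(v)\mapsto f_V(v)$, $\mathrm{fwd}(i)\mapsto\mathrm{fwd}(I_{n+1}(f)(i))$ and likewise for $\mathrm{linv},\mathrm{rinv}$, $\mathrm{coh}_{B,A}[g]\mapsto\mathrm{coh}_{B,A}[f\circ g]$. Composition: $(f\circ g)_n=f_n\circ g_n$, $(f\circ g)_V=\mathrm{Cell}_{n+1}(f)\circ g_V$, $(f\circ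 g)_U=I_{n+1}(f)\circ g_U$; identity $(\mathrm{id},\mathrm{gen},\mathrm{igen})$. For $h\colon X\to Y$ in $\mathrm{gSet}_{n+1}$, $\mathrm{Cptd}_{n+1}(h)=(\mathrm{Cptd}_n(\mathrm{tr}_nh),\mathrm{gen}\circ h_{n+1},!)$. The unit of $\mathrm{Cptd}_{n+1}\dashv\mathrm{Cell}_{n+1}$ sends cells to the corresponding generators; the counit $\mathrm{Cptd}_{n+1}\mathrm{Cell}_{n+1}(C)\to C$ sends each generator to the cell it is. Support of an $(n+1)$-cell (a set of $(n+1)$-dimensional generators): $\mathrm{supp}(\mathrm{gen}(v))=\{v\}$; $\mathrm{supp}$ of $\mathrm{fwd}(i),\mathrm{linv}(i),\mathrm{rinv}(i)$ is $\{u\}$ if $i=\mathrm{igen}(u)$ and $\emptyset$ otherwise; $\mathrm{supp}(\mathrm{coh}_{B,A}[f])=\bigcup_{p\in\mathrm{Pos}(B)_{n+1}}\mathrm{supp}(f_V(p))$. A pair $(a,b)\in\mathrm{Par}_{n+1}(\mathrm{Cell}_{n+1}\mathrm{Cptd}_{n+1}(\mathrm{tr}_{n+1}\mathrm{Pos}(B)))$ is in $\mathrm{Full}_{n+1}(B)$ iff $\mathrm{supp}(a)$ and $\mathrm{supp}(b)$ are the images of $\mathrm{Pos}(\partial_{n+1}B)_{n+1}$ under $\sigma_{n+1}^B$ and $\tau_{n+1}^B$ respectively, and $\mathrm{bdry}(a)=\mathrm{bdry}(b)\in\mathrm{Full}_n(B)$. Identities and composites: for an $n$-cell $c$ of $C$,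 $\mathrm{id}_{n+1}(c)=\mathrm{coh}_{D_n,(\mathrm{gen}(d_n),\mathrm{gen}(d_n))}[\hat c]$, where $\hat c\colon\mathrm{Cptd}_{n+1}(\mathrm{Pos}(D_n))\to C$ corresponds to $c$; for $(n+1)$-cells $a,b$ with $t_na=s_nb$, $a*b=\mathrm{coh}_{Q_{n+1},(\mathrm{gen}(s_np_{n+1}),\mathrm{gen}(t_nq_{n+1}))}[\widehat{(a,b)}]$, where $\widehat{(a,b)}\colon\mathrm{Cptd}_{n+1}(\mathrm{Pos}(Q_{n+1}))\to C$ sends $p_{n+1}\mapsto a$, $q_{n+1}\mapsto b$. Limit: $\mathrm{iComp}=\mathrm{iComp}_\omega=\lim_n\mathrm{iComp}_n$ along truncations, so a computad $C$ is a compatible sequence $(C_n)_n$, and $\mathrm{Cptd}\dashv\mathrm{Cell}$ between $\mathrm{gSet}$ and $\mathrm{iComp}$ is induced levelwise. SKELETA. $\mathrm{sk}_n\colon\mathrm{iComp}_n\to\mathrm{iComp}$ adds no (ordinary or invertible) generators above dimension $n$; it is left adjoint to truncation, and the canonical inclusions $\mathrm{sk}_nC_n\to\mathrm{sk}_{n+1}C$ (for an $(n+1)$-computad $C$) and $\mathrm{sk}_nC_n\to C$ (for a computad $C$) are given by the counit: the identity in dimensions $\le n$ and the unique maps out of the empty sets of generators above. WALKING EQUIVALENCE. $\mathbb E^{n+1}=(\mathrm{Cptd}_n(\mathbb S^n),\emptyset,\{c_{n+1}\},!,\psi)$, viewed as a computad via $\mathrm{sk}_{n+1}$, with $\psi(c_{n+1})=(\mathrm{gen}(\sigma_n),\mathrm{gen}(\tau_n))$,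 where $\sigma_n,\tau_n$ are the two $n$-cells of $\mathbb S^n\subset\mathbb D^{n+1}$, source and target of the top cell. $j_{n+1}\colon\mathrm{Cptd}(\mathbb S^n)\to\mathbb E^{n+1}$ is the morphism which is the identity on the $n$-truncation. Morphisms $\mathbb E^{n+1}\to C$ correspond to elements of $I_{n+1}(C)$ (the image of $c_{n+1}$). WEAK $\omega$-CATEGORIES. $T=\mathrm{Cell}\circ\mathrm{Cptd}$ is the monad on $\mathrm{gSet}$ induced by $\mathrm{Cptd}\dashv\mathrm{Cell}$ and $\mathrm{Cat}_\omega$ is its category of algebras (weak $\omega$-categories). $F\colon\mathrm{gSet}\to\mathrm{Cat}_\omega$ is the free algebra functor. $K\colon\mathrm{iComp}\to\mathrm{Cat}_\omega$ is the comparison functor, $K(C)=(\mathrm{Cell}(C),\mathrm{Cell}(\varepsilon_C))$ with $\varepsilon$ the counit; $K\circ\mathrm{Cptd}=F$. For a set $S$ and $X\in\mathrm{Cat}_\omega$, $S\cdot X$ is the coproduct of $S$ copies of $X$. In item 3, the top map restricted to the copy of $F\mathbb S^n$ indexed by $v$ (resp. $u$) classifies the parallel pair $\phi_{n+1}^C(v)$ (resp. $\psi_{n+1}^C(u)$); the bottom map restricted to the copy of $F\mathbb D^{n+1}$ indexed by $v$ classifies the cell $\mathrm{gen}(v)$, and restricted to the copy of $K(\mathbb E^{n+1})$ indexed by $u$ is $K$ of the morphism $\mathbb E^{n+1}\to\mathrm{sk}_{n+1}C$ corresponding to $\mathrm{igen}(u)$. *)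

(* Defs.v *)
From Stdlib Require Import List FunctionalExtensionality ProofIrrelevance.
From Stdlib Require Import IndefiniteDescription.

Set Implicit Arguments.
Unset Strict Implicit.
Set Primitive Projections.

Record Cat := MkCat {
  ob :> Type;
  hom : ob -> ob -> Type;
  idc : forall X, hom X X;
  cmp : forall X Y Z, hom Y Z -> hom X Y -> hom X Z;
  cmp_idl : forall X Y (f : hom X Y), cmp (idc Y) f = f;
  cmp_idr : forall X Y (f : hom X Y), cmp f (idc X) = f;
  cmp_assoc : forall X Y Z W (h : hom Z W) (g : hom Y Z) (f : hom X Y),
    cmp h (cmp g f) = cmp (cmp h g) f }.

Arguments hom {c} X Y.
Arguments idc {c} X.
Arguments cmp {c X Y Z} g f : rename.
Arguments cmp_idl {c X Y} f.
Arguments cmp_idr {c X Y} f.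
Arguments cmp_assoc {c X Y Z W} h g f.

Declare Scope cat_scope.
Delimit Scope cat_scope with cat.
Infix "@@" := cmp (at level 40, left associativity) : cat_scope.
Local Open Scope cat_scope.

Record Functor (A B : Cat) := MkFunctor {
  fob :> A -> B;
  fmap : forall X Y, hom X Y -> hom (fob X) (fob Y);
  fmap_id : forall X, fmap (idc X) = idc (fob X);
  fmap_cmp : forall X Y Z (g : hom Y Z) (f : hom X Y),
    fmap (g @@ f) = fmap g @@ fmap f }.

Arguments fmap {A B} F {X Y} f : rename.
Arguments fmap_id {A B} F X : rename.
Arguments fmap_cmp {A B} F {X Y Z} g f : rename.

Definition SetC : Cat := {|
  ob := Type;
  hom X Y := X -> Y;
  idc X := fun x => x;
  cmp X Y Z g f := fun x => g (f x);
  cmp_idl X Y f := eq_refl;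
  cmp_idr X Y f := eq_refl;
  cmp_assoc X Y Z W h g f := eq_refl |}.

Definition idF (A : Cat) : Functor A A := {|
  fob X := X;
  fmap X Y f := f;
  fmap_id X := eq_refl;
  fmap_cmp X Y Z g f := eq_refl |}.

Definition id_of_eq (A : Cat) (X Y : A) (e : X = Y) : hom X Y :=
  match e with eq_refl => idc X end.

Definition hom_cast (A : Cat) (X X' Y Y' : A) (e : X = X') (d : Y = Y') :
    hom X Y -> hom X' Y' :=
  match e, d with eq_refl, eq_refl => fun f => f end.

(** Adjunctions are presented by universal arrows.  The left adjoint acts on
    morphisms by [lmap h = transpose (unit @@ h)]. *)

Record Adjunction (A B : Cat) := MkAdj {
  radj : Functor B A;
  ladj : A -> B;
  unit : forall X, hom X (radj (ladj X));
  transpose : forall X Y, hom X (radj Y) -> hom (ladj X) Y;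
  transpose_unit : forall X Y (g : hom X (radj Y)),
    fmap radj (transpose g) @@ unit X = g;
  transpose_uniq : forall X Y (f : hom (ladj X) Y),
    transpose (fmap radj f @@ unit X) = f }.

Arguments unit {A B} a X : rename.
Arguments transpose {A B} a {X Y} g : rename.
Arguments transpose_unit {A B} a {X Y} g : rename.
Arguments transpose_uniq {A B} a {X Y} f : rename.

Section AdjunctionTheory.
Variables (A B : Cat) (J : Adjunction A B).

Definition lmap (X Y : A) (h : hom X Y) : hom (ladj J X) (ladj J Y) :=
  transpose J (unit J Y @@ h).

Definition counit (Y : B) : hom (ladj J (radj J Y)) Y :=
  transpose J (idc (radj J Y)).

Lemma transpose_post X Y Z (f : hom Y Z) (g : hom X (radj J Y)) :
  f @@ transpose J g = transpose J (fmap (radj J) f @@ g).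
Proof.
rewrite <- (transpose_uniq J (f @@ transpose J g)), fmap_cmp.
now rewrite <- cmp_assoc, transpose_unit.
Qed.

Lemma transpose_pre X Y Z (g : hom Y (radj J Z)) (h : hom X Y) :
  transpose J g @@ lmap h = transpose J (g @@ h).
Proof.
unfold lmap; rewrite transpose_post, cmp_assoc, transpose_unit; reflexivity.
Qed.

Lemma unit_nat X Y (h : hom X Y) :
  fmap (radj J) (lmap h) @@ unit J X = unit J Y @@ h.
Proof. apply transpose_unit. Qed.

Lemma lmap_id X : lmap (idc X) = idc (ladj J X).
Proof.
unfold lmap; rewrite <- (transpose_uniq J (idc (ladj J X))), fmap_id.
now rewrite cmp_idl, cmp_idr.
Qed.

Lemma lmap_cmp X Y Z (g : hom Y Z) (f : hom X Y) :
  lmap (g @@ f) = lmap g @@ lmap f.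
Proof. unfold lmap at 2; rewrite transpose_pre; unfold lmap; now rewrite cmp_assoc. Qed.

Definition ladjF : Functor A B := {|
  fob := ladj J;
  fmap := lmap;
  fmap_id := lmap_id;
  fmap_cmp := lmap_cmp |}.

Lemma counit_nat Y Z (f : hom Y Z) :
  f @@ counit Y = counit Z @@ lmap (fmap (radj J) f).
Proof.
unfold counit; rewrite transpose_post, transpose_pre.
now rewrite cmp_idl, cmp_idr.
Qed.

Local Notation monT X := (radj J (ladj J X)).
Definition monT_map (X Y : A) (h : hom X Y) : hom (monT X) (monT Y) :=
  fmap (radj J) (lmap h).
Definition mult (X : A) : hom (monT (monT X)) (monT X) :=
  fmap (radj J) (counit (ladj J X)).

Lemma monT_map_cmp X Y Z (g : hom Y Z) (f : hom X Y) :
  monT_map (g @@ f) = monT_map g @@ monT_map f.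
Proof. unfold monT_map; now rewrite lmap_cmp, fmap_cmp. Qed.

Record Algebra := MkAlg {
  car :> A;
  act : hom (monT car) car;
  act_unit : act @@ unit J car = idc car;
  act_mult : act @@ monT_map act = act @@ mult car }.

Record AlgHom (X Y : Algebra) := MkAlgHom {
  amap :> hom (car X) (car Y);
  amap_act : amap @@ act X = act Y @@ monT_map amap }.

Lemma AlgHom_eq X Y (f g : AlgHom X Y) : amap f = amap g -> f = g.
Proof.
destruct f as [f Hf], g as [g Hg]; simpl; intros e; subst g.
now rewrite (proof_irrelevance _ Hf Hg).
Qed.

Lemma alg_id_act X : idc (car X) @@ act X = act X @@ monT_map (idc (car X)).
Proof. unfold monT_map; now rewrite lmap_id, fmap_id, cmp_idl, cmp_idr. Qed.

Lemma alg_cmp_act X Y Z (g : AlgHom Y Z) (f : AlgHom X Y) :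
  (amap g @@ amap f) @@ act X = act Z @@ monT_map (amap g @@ amap f).
Proof.
rewrite monT_map_cmp, <- cmp_assoc, amap_act.
now rewrite cmp_assoc, amap_act, <- cmp_assoc.
Qed.

Definition AlgC : Cat.
Proof.
refine {|
  ob := Algebra;
  hom := AlgHom;
  idc X := MkAlgHom (alg_id_act X);
  cmp X Y Z g f := MkAlgHom (alg_cmp_act g f) |};
  intros; apply AlgHom_eq; simpl.
- apply cmp_idl.
- apply cmp_idr.
- apply cmp_assoc.
Defined.

Lemma comparison_unit (Y : B) :
  fmap (radj J) (counit Y) @@ unit J (radj J Y) = idc (radj J Y).
Proof. apply transpose_unit. Qed.

Lemma comparison_mult (Y : B) :
  fmap (radj J) (counit Y) @@ monT_map (fmap (radj J) (counit Y))
  = fmap (radj J) (counit Y) @@ mult (radj J Y).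
Proof.
unfold monT_map, mult; rewrite <- !fmap_cmp; f_equal.
symmetry; apply counit_nat.
Qed.

Lemma comparison_act Y Z (f : hom Y Z) :
  fmap (radj J) f @@ fmap (radj J) (counit Y)
  = fmap (radj J) (counit Z) @@ monT_map (fmap (radj J) f).
Proof. unfold monT_map; rewrite <- !fmap_cmp; f_equal; apply counit_nat. Qed.

Definition comparison_alg (Y : B) : Algebra :=
  @MkAlg (radj J Y) (fmap (radj J) (counit Y)) (comparison_unit Y) (comparison_mult Y).

Definition comparison : Functor B AlgC.
Proof.
refine {|
  fob := comparison_alg : B -> AlgC;
  fmap Y Z f := @MkAlgHom (comparison_alg Y) (comparison_alg Z) _ (comparison_act f) |};
  intros; apply AlgHom_eq; simpl.
- apply fmap_id.
- apply fmap_cmp.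
Defined.

Definition freealg (X : A) : Algebra :=
  @MkAlg (monT X) (mult X) (comparison_unit (ladj J X)) (comparison_mult (ladj J X)).

Lemma freealg_ext_act X (Y : Algebra) (g : hom X (car Y)) :
  (act Y @@ monT_map g) @@ mult X = act Y @@ monT_map (act Y @@ monT_map g).
Proof.
rewrite !monT_map_cmp, cmp_assoc, act_mult, <- !cmp_assoc; f_equal.
unfold monT_map, mult; rewrite <- !fmap_cmp; f_equal; apply counit_nat.
Qed.

(** The algebra morphism out of a free algebra given by its restriction to
    generators. *)
Definition freealg_ext X (Y : Algebra) (g : hom X (car Y)) :
  hom (freealg X : AlgC) Y := @MkAlgHom (freealg X) Y _ (freealg_ext_act g).

Definition freealg_map X Y (h : hom X Y) : hom (freealg X : AlgC) (freealg Y) :=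
  freealg_ext (Y := freealg Y) (unit J Y @@ h).

End AdjunctionTheory.

Section Colimits.
Variable A : Cat.

Definition is_initial (Z : A) : Prop := forall Y : A, exists! f : hom Z Y, True.

Definition is_coproduct (I : Type) (X : I -> A) (Z : A) (inj : forall i, hom (X i) Z) :
    Prop :=
  forall (Y : A) (f : forall i, hom (X i) Y), exists! g : hom Z Y, forall i, g @@ inj i = f i.

Record Coproduct (I : Type) (X : I -> A) := MkCoproduct {
  cp_ob :> A;
  cp_in : forall i, hom (X i) cp_ob;
  cp_is : is_coproduct cp_in }.

Definition copair (I : Type) (X : I -> A) (P : Coproduct X) (Y : A)
    (f : forall i, hom (X i) Y) : hom (cp_ob P) Y :=
  proj1_sig (constructive_indefinite_description _ (@cp_is _ _ P Y f)).

Lemma copair_in (I : Type) (X : I -> A) (P : Coproduct X) (Y : A)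
    (f : forall i, hom (X i) Y) (i : I) : copair P f @@ cp_in P i = f i.
Proof.
unfold copair; destruct constructive_indefinite_description as [g Hg]; simpl.
apply Hg.
Qed.

Definition Copower (S : Type) (X : A) := Coproduct (fun _ : S => X).

Definition copower_map (S : Type) (X Y : A) (P : Copower S X) (Q : Copower S Y)
    (f : hom X Y) : hom (cp_ob P) (cp_ob Q) :=
  copair P (fun i => cp_in Q i @@ f).

Definition Coproduct2 (X Y : A) := Coproduct (fun b : bool => if b then X else Y).

Definition copair2 (X Y : A) (P : Coproduct2 X Y) (Z : A) (f : hom X Z) (g : hom Y Z) :
    hom (cp_ob P) Z :=
  copair P (fun b => match b return hom (if b then X else Y) Z with
                     | true => f | false => g end).

Definition coproduct2_map (X Y X' Y' : A) (P : Coproduct2 X Y) (Q : Coproduct2 X' Y')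
    (f : hom X X') (g : hom Y Y') : hom (cp_ob P) (cp_ob Q) :=
  copair2 P (cp_in Q true @@ f) (cp_in Q false @@ g).

(** The square with [top : P -> X], [left : P -> Q], [right : X -> Z] and
    [bottom : Q -> Z]. *)
Definition is_pushout (P Q X Z : A) (top : hom P X) (left : hom P Q)
    (right : hom X Z) (bottom : hom Q Z) : Prop :=
  right @@ top = bottom @@ left /\
  forall (Y : A) (x : hom X Y) (q : hom Q Y), x @@ top = q @@ left ->
    exists! z : hom Z Y, z @@ right = x /\ z @@ bottom = q.

Definition is_seq_colimit (X : nat -> A) (step : forall k, hom (X k) (X (S k)))
    (Z : A) (inj : forall k, hom (X k) Z) : Prop :=
  (forall k, inj (S k) @@ step k = inj k) /\
  forall (Y : A) (f : forall k, hom (X k) Y), (forall k, f (S k) @@ step k = f k) ->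
    exists! g : hom Z Y, forall k, g @@ inj k = f k.

End Colimits.

Record gset := MkGset {
  gc :> nat -> Type;
  src : forall k, gc (S k) -> gc k;
  tgt : forall k, gc (S k) -> gc k;
  glob_src : forall k (x : gc (S (S k))), src (src x) = src (tgt x);
  glob_tgt : forall k (x : gc (S (S k))), tgt (src x) = tgt (tgt x) }.

Arguments src {g k} x : rename.
Arguments tgt {g k} x : rename.

Record gmap (X Y : gset) := MkGmap {
  gm :> forall k, X k -> Y k;
  gm_src : forall k (x : X (S k)), src (gm x) = gm (src x);
  gm_tgt : forall k (x : X (S k)), tgt (gm x) = gm (tgt x) }.

Lemma gmap_eq X Y (f g : gmap X Y) : (forall k x, f k x = g k x) -> f = g.
Proof.
destruct f as [f Hf Hf'], g as [g Hg Hg']; simpl; intros e.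
assert (e' : f = g) by (extensionality k; extensionality x; apply e).
subst g; now rewrite (proof_irrelevance _ Hf Hg), (proof_irrelevance _ Hf' Hg').
Qed.

Definition gmap_id (X : gset) : gmap X X :=
  {| gm k x := x; gm_src k x := eq_refl; gm_tgt k x := eq_refl |}.

Definition gmap_cmp (X Y Z : gset) (g : gmap Y Z) (f : gmap X Y) : gmap X Z.
Proof.
refine {| gm k x := g k (f k x) |}; intros k x.
- now rewrite !gm_src.
- now rewrite !gm_tgt.
Defined.

Definition gSet : Cat.
Proof.
refine {| ob := gset; hom := gmap; idc := gmap_id; cmp := gmap_cmp |};
  intros; now apply gmap_eq.
Defined.

Definition zpar (X : gset) (n : nat) : X n -> X n -> Prop :=
  match n return X n -> X n -> Prop with
  | 0 => fun _ _ => True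
  | S m => fun x y => src x = src y /\ tgt x = tgt y
  end.

(** An (n+1)-globular set is an n-globular set with a set of (n+1)-cells and a
    boundary function [(s_n, t_n)] into parallel pairs of n-cells.  [gtop] is the
    functor of cells of the top dimension. *)

Record GLev := MkGLev {
  gcat :> Cat;
  gtop : Functor gcat SetC;
  gpar : forall X : gcat, gtop X -> gtop X -> Prop;
  gpar_map : forall (X Y : gcat) (f : hom X Y) x y,
    gpar x y -> gpar (fmap gtop f x) (fmap gtop f y) }.

Arguments gpar {g X} x y : rename.

Record Par (G : GLev) (X : G) := MkPar {
  psrc : gtop G X;
  ptgt : gtop G X;
  ppar : gpar psrc ptgt }.

Arguments MkPar {G X psrc ptgt} ppar.

Lemma Par_eq (G : GLev) (X : G) (p q : Par X) :
  psrc p = psrc q -> ptgt p = ptgt q -> p = q.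
Proof.
destruct p as [a b h], q as [a' b' h']; simpl; intros -> ->.
now rewrite (proof_irrelevance _ h h').
Qed.

Definition Par_map (G : GLev) (X Y : G) (f : hom X Y) (p : Par X) : Par Y :=
  MkPar (gpar_map f (ppar p)).

Lemma Par_map_id (G : GLev) (X : G) (p : Par X) : Par_map (idc X) p = p.
Proof. apply Par_eq; simpl; now rewrite fmap_id. Qed.

Lemma Par_map_cmp (G : GLev) (X Y Z : G) (g : hom Y Z) (f : hom X Y) (p : Par X) :
  Par_map (g @@ f) p = Par_map g (Par_map f p).
Proof. apply Par_eq; simpl; now rewrite fmap_cmp. Qed.

Definition GLev0 : GLev := {|
  gcat := SetC;
  gtop := idF SetC;
  gpar := fun _ _ _ => True;
  gpar_map := fun _ _ _ _ _ _ => I |}.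

Record gobS (G : GLev) := MkGobS {
  gbase : G;
  gnew : Type;
  gbd : gnew -> Par gbase }.

Arguments gbd {G} g x : rename.

Record ghomS (G : GLev) (X Y : gobS G) := MkGhomS {
  ghbase : hom (gbase X) (gbase Y);
  ghnew : gnew X -> gnew Y;
  ghbd : forall x, gbd Y (ghnew x) = Par_map ghbase (gbd X x) }.

Lemma ghomS_eq (G : GLev) (X Y : gobS G) (f g : ghomS X Y) :
  ghbase f = ghbase g -> (forall x, ghnew f x = ghnew g x) -> f = g.
Proof.
destruct f as [f f' Hf], g as [g g' Hg]; simpl; intros -> e.
assert (e' : f' = g') by (extensionality x; apply e).
subst g'; now rewrite (proof_irrelevance _ Hf Hg).
Qed.

Definition ghomS_id (G : GLev) (X : gobS G) : ghomS X X.
Proof.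
refine {| ghbase := idc (gbase X); ghnew x := x |}.
intros x; now rewrite Par_map_id.
Defined.

Definition ghomS_cmp (G : GLev) (X Y Z : gobS G) (g : ghomS Y Z) (f : ghomS X Y) :
  ghomS X Z.
Proof.
refine {| ghbase := ghbase g @@ ghbase f; ghnew x := ghnew g (ghnew f x) |}.
intros x; now rewrite Par_map_cmp, !ghbd.
Defined.

Definition gcatS (G : GLev) : Cat.
Proof.
refine {| ob := gobS G; hom X Y := ghomS X Y; idc := @ghomS_id G; cmp := @ghomS_cmp G |};
  intros; apply ghomS_eq; simpl; trivial;
  first [apply cmp_idl | apply cmp_idr | apply cmp_assoc].
Defined.

Definition gtopS (G : GLev) : Functor (gcatS G) SetC := {|
  fob := (@gnew G : gcatS G -> SetC);
  fmap X Y f := ghnew f;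
  fmap_id X := eq_refl;
  fmap_cmp X Y Z g f := eq_refl |}.

Lemma gparS_map (G : GLev) (X Y : gcatS G) (f : hom X Y) (x y : gnew X) :
  gbd X x = gbd X y -> gbd Y (ghnew f x) = gbd Y (ghnew f y).
Proof. intros e; now rewrite !ghbd, e. Qed.

Definition GLevS (G : GLev) : GLev := {|
  gcat := gcatS G;
  gtop := gtopS G;
  gpar := fun X x y => gbd X x = gbd X y;
  gpar_map := @gparS_map G |}.

Fixpoint gSetn (n : nat) : GLev :=
  match n with 0 => GLev0 | S m => GLevS (gSetn m) end.

Lemma gpar_sym n (X : gSetn n) (x y : gtop _ X) : gpar x y -> gpar y x.
Proof. destruct n; simpl; [trivial | apply eq_sym]. Qed.

Lemma gpar_trans n (X : gSetn n) (x y z : gtop _ X) : gpar x y -> gpar y z -> gpar x z.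
Proof. destruct n; simpl; [trivial | apply eq_trans]. Qed.

Lemma gpar_refl n (X : gSetn n) (x : gtop _ X) : gpar x x.
Proof. destruct n; simpl; trivial. Qed.

Definition Par_op n (X : gSetn n) (p : Par X) : Par X := MkPar (gpar_sym (ppar p)).

(** [tr_in] identifies the n-cells of [X] with the top cells of its n-truncation
    (it is the identity function, up to case analysis on [n]). *)

Record Trunc (X : gset) (n : nat) := MkTrunc {
  trunc_ob : gSetn n;
  trunc_in : X n -> gtop _ trunc_ob;
  trunc_par : forall x : X (S n), gpar (trunc_in (src x)) (trunc_in (tgt x)) }.

Definition TruncS (X : gset) (n : nat) (T : Trunc X n) : Trunc X (S n).
Proof.
refine (@MkTrunc X (S n)
  (@MkGobS (gSetn n) (trunc_ob T) (X (S n)) (fun x => MkPar (trunc_par T x)))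
  (fun x => x) _).
intros x; apply Par_eq; simpl; f_equal; [apply glob_src | apply glob_tgt].
Defined.

Fixpoint Trunc_of (X : gset) (n : nat) : Trunc X n :=
  match n with
  | 0 => @MkTrunc X 0 (X 0 : SetC) (fun x => x) (fun x => I)
  | S m => TruncS (Trunc_of X m)
  end.

Definition tr (n : nat) (X : gset) : gSetn n := trunc_ob (Trunc_of X n).
Definition tr_in (n : nat) (X : gset) : X n -> gtop _ (tr n X) := trunc_in (Trunc_of X n).
Arguments tr_in n {X} x.

Definition tr_bd (n : nat) (X : gset) (x : X (S n)) : Par (tr n X) :=
  MkPar (trunc_par (Trunc_of X n) x).

Lemma tr_par n (X : gset) (x y : X n) : zpar x y -> gpar (tr_in n x) (tr_in n y).
Proof.
destruct n as [|n]; simpl; [trivial|].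
intros [e e']; apply Par_eq; simpl; now f_equal.
Qed.

Record TrMap (X Y : gset) (h : gmap X Y) (n : nat) := MkTrMap {
  trmap_hom : hom (tr n X) (tr n Y);
  trmap_in : forall x : X n, fmap (gtop _) trmap_hom (tr_in n x) = tr_in n (h n x) }.

Definition TrMapS (X Y : gset) (h : gmap X Y) (n : nat) (T : TrMap h n) : TrMap h (S n).
Proof.
unshelve refine (@MkTrMap X Y h (S n)
  (@MkGhomS (gSetn n) (tr (S n) X) (tr (S n) Y) (trmap_hom T) (h (S n)) _) _).
- intros x; apply Par_eq; simpl.
  + change (tr_in n (src (h (S n) x)) = fmap (gtop _) (trmap_hom T) (tr_in n (src x))).
    now rewrite trmap_in, gm_src.
  + change (tr_in n (tgt (h (S n) x)) = fmap (gtop _) (trmap_hom T) (tr_in n (tgt x))).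
    now rewrite trmap_in, gm_tgt.
- reflexivity.
Defined.

Fixpoint TrMap_of (X Y : gset) (h : gmap X Y) (n : nat) : TrMap h n :=
  match n with
  | 0 => @MkTrMap X Y h 0 (h 0) (fun x => eq_refl)
  | S m => TrMapS (TrMap_of h m)
  end.

Definition tr_map (n : nat) (X Y : gset) (h : gmap X Y) : hom (tr n X) (tr n Y) :=
  trmap_hom (TrMap_of h n).

Lemma tr_map_in n (X Y : gset) (h : gmap X Y) (x : X n) :
  fmap (gtop _) (tr_map n h) (tr_in n x) = tr_in n (h n x).
Proof. apply trmap_in. Qed.

Definition trF (n : nat) : Functor gSet (gSetn n).
Proof.
refine {| fob := tr n : gSet -> gSetn n; fmap X Y h := tr_map n (h : gmap X Y) |}.
- intros X; induction n as [|n IH]; [reflexivity|].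
  apply ghomS_eq; [exact IH | reflexivity].
- intros X Y Z g f; induction n as [|n IH]; [reflexivity|].
  apply ghomS_eq; [exact IH | reflexivity].
Defined.

(** A k-cell of the representable globular set [disk n] is an iterated source
    ([true]) or target ([false]) of its n-cell; for [k = n] it is the identity. *)

Lemma disk_bd k n (b : bool) : S k < n \/ S k = n /\ b = true -> k < n.
Proof.
intros [H | [<- _]]; [|apply le_n].
exact (PeanoNat.Nat.lt_trans _ _ _ (le_n _) H).
Qed.

Definition disk (n : nat) : gset := {|
  gc k := {b : bool | k < n \/ k = n /\ b = true};
  src k x := exist _ true (or_introl (disk_bd (proj2_sig x)));
  tgt k x := exist _ false (or_introl (disk_bd (proj2_sig x)));
  glob_src k x := f_equal (exist _ true) (proof_irrelevance _ _ _);
  glob_tgt k x := f_equal (exist _ false) (proof_irrelevance _ _ _) |}.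

(** [sphere n] is the n-sphere, i.e. [disk (S n)] without its top cell. *)
Definition sphere (n : nat) : gset := {|
  gc k := {b : bool | k < S n};
  src k x := exist _ true (PeanoNat.Nat.lt_trans _ _ _ (le_n _) (proj2_sig x));
  tgt k x := exist _ false (PeanoNat.Nat.lt_trans _ _ _ (le_n _) (proj2_sig x));
  glob_src k x := f_equal (exist _ true) (proof_irrelevance _ _ _);
  glob_tgt k x := f_equal (exist _ false) (proof_irrelevance _ _ _) |}.

Definition disk_top (n : nat) : disk n n := exist _ true (or_intror (conj eq_refl eq_refl)).
Definition sphere_src (n : nat) : sphere n n := exist _ true (le_n (S n)).
Definition sphere_tgt (n : nat) : sphere n n := exist _ false (le_n (S n)).

Lemma sphere_zpar n : zpar (sphere_src n) (sphere_tgt n).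
Proof. destruct n; simpl; auto. Qed.

Definition sphere_incl (n : nat) : gmap (sphere n) (disk (S n)) := {|
  gm k := fun x : sphere n k => exist _ (proj1_sig x) (or_introl (proj2_sig x)) : disk (S n) k;
  gm_src k x := f_equal (exist _ true) (proof_irrelevance _ _ _);
  gm_tgt k x := f_equal (exist _ false) (proof_irrelevance _ _ _) |}.

(** A variant of [le] in [Set]. *)
Inductive leT (k : nat) : nat -> Set :=
| leT_n : leT k k
| leT_S n : leT k n -> leT k (S n).
Arguments leT_n {k}.
Arguments leT_S {k n} h.

Lemma leT_le k n : leT k n -> k <= n.
Proof. induction 1; auto. Qed.

Lemma leT_inv k n (h : leT k n) :
  (exists e : k = n, h = eq_rect k (leT k) leT_n n e)
  \/ (exists m (h' : leT k m) (e : S m = n), h = eq_rect (S m) (leT k) (leT_S h') n e).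
Proof.
destruct h as [|n h]; [left; now exists eq_refl | right; now exists n, h, eq_refl].
Qed.

Lemma leT_irr k n (h h' : leT k n) : h = h'.
Proof.
induction h as [|n h IH]; destruct (leT_inv h') as [[e ->] | (m & h2 & e & ->)].
- now rewrite (proof_irrelevance _ e eq_refl).
- exfalso; subst k; exact (PeanoNat.Nat.nle_succ_diag_l _ (leT_le h2)).
- exfalso; subst k; exact (PeanoNat.Nat.nle_succ_diag_l _ (leT_le h)).
- injection e as e'; subst m; rewrite (proof_irrelevance _ e eq_refl); simpl.
  f_equal; apply IH.
Qed.

Fixpoint leT_0 (n : nat) : leT 0 n :=
  match n with 0 => leT_n | S m => leT_S (leT_0 m) end.

Fixpoint leT_SS k n (h : leT k n) : leT (S k) (S n) :=
  match h with leT_n => leT_n | leT_S h' => leT_S (leT_SS h') end.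

Fixpoint leT_total (k n : nat) : leT k n + leT n k :=
  match k, n with
  | 0, n => inl (leT_0 n)
  | S k', 0 => inr (leT_0 (S k'))
  | S k', S n' => match leT_total k' n' with
                  | inl h => inl (leT_SS h)
                  | inr h => inr (leT_SS h)
                  end
  end.

Definition leT_of_le (k n : nat) (H : k <= n) : leT k n :=
  match leT_total k n with
  | inl h => h
  | inr h => eq_rect k (leT k) leT_n n (PeanoNat.Nat.le_antisymm _ _ H (leT_le h))
  end.

(** The iterated source ([b = true]) or target ([b = false]) in dimension [k]. *)
Fixpoint iter_bd (X : gset) (b : bool) k n (h : leT k n) : X n -> X k :=
  match h in leT _ n return X n -> X k with
  | leT_n => fun x => x
  | leT_S h' => fun x => iter_bd b h' (if b then src x else tgt x)
  end.

Lemma iter_bd_tgt (X : gset) (b : bool) k n (h : leT k n) (x : X (S n)) :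
  k < n -> iter_bd b h (src x) = iter_bd b h (tgt x).
Proof.
intros H; destruct h as [|n h]; simpl.
- destruct (PeanoNat.Nat.lt_irrefl _ H).
- destruct b; [now rewrite glob_src | now rewrite glob_tgt].
Qed.

Lemma iter_bd_S (X : gset) (b : bool) k n (h : leT (S k) n) (h' : leT k n) (x : X n) :
  src (iter_bd b h x) = iter_bd true h' x /\ tgt (iter_bd b h x) = iter_bd false h' x.
Proof.
induction h as [|n h IH].
- rewrite (leT_irr h' (leT_S leT_n)); now split.
- assert (h2 : leT k n) by (apply leT_of_le, PeanoNat.Nat.lt_le_incl, (leT_le h)).
  rewrite (leT_irr h' (leT_S h2)).
  destruct (IH h2 (if b then src x else tgt x)) as [E1 E2]; simpl; rewrite E1, E2.
  pose proof (iter_bd_tgt true h2 x (leT_le h)) as F1.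
  pose proof (iter_bd_tgt false h2 x (leT_le h)) as F2.
  destruct b; split; congruence.
Qed.

Lemma sphere_le k n : k < S n -> k <= n.
Proof. apply le_S_n. Qed.

Lemma disk_le (b : bool) k n : k < n \/ k = n /\ b = true -> k <= n.
Proof. intros [H | [-> H]]; [now apply PeanoNat.Nat.lt_le_incl | apply le_n]. Qed.

(** The map [disk n -> X] classifying an n-cell, and the map [sphere n -> X]
    classifying a parallel pair of n-cells. *)
Definition disk_map (X : gset) (n : nat) (x : X n) : gmap (disk n) X.
Proof.
refine {| gm k := fun c : disk n k =>
    iter_bd (proj1_sig c) (leT_of_le (disk_le (proj2_sig c))) x |};
  intros k c; apply iter_bd_S.
Defined.

Definition sphere_map (X : gset) (n : nat) (x y : X n) (H : zpar x y) :
  gmap (sphere n) X.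
Proof.
assert (E : forall k (b : bool) (h : leT (S k) n) (h' : leT k n),
   iter_bd b h' x = iter_bd b h' y).
{ intros k b h h'; destruct h' as [|n h'].
  - destruct (PeanoNat.Nat.lt_irrefl _ (leT_le h)).
  - destruct H as [H1 H2]; simpl; destruct b; congruence. }
refine {| gm k := fun c : sphere n k =>
    iter_bd (proj1_sig c) (leT_of_le (sphere_le (proj2_sig c)))
      (if proj1_sig c then x else y) |};
  intros k [b c]; simpl.
- transitivity (iter_bd true (leT_of_le (sphere_le (PeanoNat.Nat.lt_trans _ _ _ (le_n _) c)))
     (if b then x else y)); [apply iter_bd_S|].
  destruct b; [reflexivity|]; symmetry; eapply E, leT_of_le, sphere_le, c.
- transitivity (iter_bd false (leT_of_le (sphere_le (PeanoNat.Nat.lt_trans _ _ _ (le_n _) c)))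
     (if b then x else y)); [apply iter_bd_S|].
  destruct b; [|reflexivity]; eapply E, leT_of_le, sphere_le, c.
Defined.

Lemma disk_map_top (X : gset) n (x : X n) : disk_map x n (disk_top n) = x.
Proof. simpl; now rewrite (leT_irr (leT_of_le _) leT_n). Qed.

Lemma sphere_map_src (X : gset) n (x y : X n) (H : zpar x y) :
  sphere_map H n (sphere_src n) = x.
Proof. simpl; now rewrite (leT_irr (leT_of_le _) leT_n). Qed.

Lemma sphere_map_tgt (X : gset) n (x y : X n) (H : zpar x y) :
  sphere_map H n (sphere_tgt n) = y.
Proof. simpl; now rewrite (leT_irr (leT_of_le _) leT_n). Qed.

Inductive tree := br (l : list tree).

Fixpoint dim (B : tree) : nat :=
  match B with br l => fold_right (fun B' m => Nat.max (S (dim B')) m) 0 l end.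

Fixpoint tree_bd (k : nat) (B : tree) : tree :=
  match k with
  | 0 => br nil
  | S k' => match B with br l => br (map (tree_bd k') l) end
  end.

Record pgset := MkPgset { pg :> gset; pfirst : pg 0; plast : pg 0 }.

Definition point : pgset.
Proof.
refine (@MkPgset {| gc k := match k with 0 => Datatypes.unit | S _ => Empty_set end;
                    src k := fun x : Empty_set => match x with end;
                    tgt k := fun x : Empty_set => match x with end |} tt tt);
  intros k [].
Defined.

(** The wedge sum [ΣX ∨ Y] of the suspension of [X] with [Y].  The 0-cell [τ] of
    [ΣX] is the first 0-cell of [Y], so the 0-cells are those of [Y] and one more
    ([None]), which is [σ]. *)
Definition sw_cell (X : gset) (Y : pgset) (k : nat) : Type :=
  match k with 0 => option (Y 0) | S k' => (X k' + Y (S k'))%type end.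

Definition sw_src (X : gset) (Y : pgset) (k : nat) :
    sw_cell X Y (S k) -> sw_cell X Y k :=
  match k return sw_cell X Y (S k) -> sw_cell X Y k with
  | 0 => fun x => match x with inl _ => None | inr y => Some (src y) end
  | S k' => fun x => match x with inl x' => inl (src x') | inr y => inr (src y) end
  end.

Definition sw_tgt (X : gset) (Y : pgset) (k : nat) :
    sw_cell X Y (S k) -> sw_cell X Y k :=
  match k return sw_cell X Y (S k) -> sw_cell X Y k with
  | 0 => fun x => match x with inl _ => Some (pfirst Y) | inr y => Some (tgt y) end
  | S k' => fun x => match x with inl x' => inl (tgt x') | inr y => inr (tgt y) end
  end.

Definition susp_wedge (X : gset) (Y : pgset) : pgset.
Proof.
refine (@MkPgset {| gc := sw_cell X Y; src := @sw_src X Y; tgt := @sw_tgt X Y |}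
          None (Some (plast Y)));
  intros [|k] [x|y]; simpl; f_equal; first [apply glob_src | apply glob_tgt].
Defined.

Fixpoint Pos (B : tree) : pgset :=
  match B with br l => fold_right (fun B' Y => susp_wedge (Pos B') Y) point l end.

Record pgmap (X Y : pgset) := MkPgmap {
  pgm :> gmap X Y;
  pgm_first : pgm 0 (pfirst X) = pfirst Y }.

Definition pgmap_id (X : pgset) : pgmap X X := @MkPgmap X X (gmap_id X) eq_refl.

Definition susp_wedge_map (X X' : gset) (Y Y' : pgset) (f : gmap X X') (g : pgmap Y Y') :
  pgmap (susp_wedge X Y) (susp_wedge X' Y').
Proof.
unshelve refine (@MkPgmap (susp_wedge X Y) (susp_wedge X' Y')
  (@MkGmap (susp_wedge X Y) (susp_wedge X' Y')
    (fun k => match k return sw_cell X Y k -> sw_cell X' Y' k with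
     | 0 => option_map (g 0)
     | S k' => fun x => match x with inl x' => inl (f k' x') | inr y => inr (g (S k') y) end
     end) _ _) _).
- intros [|k] [x|y]; simpl; f_equal; apply gm_src.
- intros [|k] [x|y]; simpl; f_equal; first [symmetry; apply pgm_first | apply gm_tgt].
- reflexivity.
Defined.

Definition point_map (X : gset) (x : X 0) : gmap (Pos (br nil)) X.
Proof.
refine (@MkGmap (Pos (br nil)) X (fun k => match k return point k -> X k with
  | 0 => fun _ => x | S _ => fun z : Empty_set => match z with end end) _ _);
  intros k [].
Defined.

Fixpoint Pos_list_map (F : tree -> tree) (f : forall B, gmap (Pos (F B)) (Pos B))
    (l : list tree) : pgmap (Pos (br (map F l))) (Pos (br l)) :=
  match l with
  | nil => pgmap_id point
  | B :: l' => susp_wedge_map (f B) (Pos_list_map f l')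
  end.

(** [Pos_bd true k B] is [σ_k^B] and [Pos_bd false k B] is [τ_k^B]. *)
Fixpoint Pos_bd (b : bool) (k : nat) : forall B, gmap (Pos (tree_bd k B)) (Pos B) :=
  match k return forall B, gmap (Pos (tree_bd k B)) (Pos B) with
  | 0 => fun B => point_map (if b then pfirst (Pos B) else plast (Pos B))
  | S k' => fun B => match B return gmap (Pos (tree_bd (S k') B)) (Pos B) with
                     | br l => Pos_list_map (Pos_bd b k') l
                     end
  end.

(** [Dtree n] is [D_n], and [Qtree n] is [Q_{n+1}]. *)
Fixpoint Dtree (n : nat) : tree :=
  match n with 0 => br nil | S m => br (Dtree m :: nil) end.

Fixpoint Qtree (n : nat) : tree :=
  match n with 0 => br (Dtree 0 :: Dtree 0 :: nil) | S m => br (Qtree m :: nil) end.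

Fixpoint Dtop (n : nat) : Pos (Dtree n) n :=
  match n with 0 => tt | S m => inl (Dtop m) end.

(** The cells [p_{n+1}] and [q_{n+1}] of [Pos (Qtree n)]. *)
Fixpoint Qp (n : nat) : Pos (Qtree n) (S n) :=
  match n with 0 => inl tt | S m => inl (Qp m) end.
Fixpoint Qq (n : nat) : Pos (Qtree n) (S n) :=
  match n with 0 => inr (inl tt) | S m => inl (Qq m) end.

Lemma Q_glue n : tgt (Qp n) = src (Qq n).
Proof. induction n as [|n IH]; simpl; [reflexivity | now f_equal]. Qed.

Lemma Q_zpar n : zpar (src (Qp n)) (tgt (Qq n)).
Proof.
destruct n as [|n]; [exact I|]; split.
- now rewrite glob_src, Q_glue, glob_src.
- now rewrite glob_tgt, Q_glue, glob_tgt.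
Qed.

Lemma D_zpar n : zpar (Dtop n) (Dtop n).
Proof. destruct n; simpl; auto. Qed.

Lemma dim_Dtree n : dim (Dtree n) = n.
Proof. induction n as [|n IH]; simpl; [reflexivity | now rewrite IH]. Qed.

Lemma dim_Qtree n : dim (Qtree n) = S n.
Proof. induction n as [|n IH]; [reflexivity|]; simpl; now rewrite IH. Qed.

(** The pair [(x, y)] of positions is the full boundary of [B] in dimension [n]:
    in each dimension [k <= n], its k-dimensional source (resp. target) is the only
    k-cell in the image of [σ_k^B] (resp. [τ_k^B]). *)
Fixpoint full_pos (n : nat) (B : tree) : Pos B n -> Pos B n -> Prop :=
  match n return Pos B n -> Pos B n -> Prop with
  | 0 => fun x y => x = pfirst (Pos B) /\ y = plast (Pos B)
  | S m => fun x y =>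
      (forall z, z = x <-> exists w, z = Pos_bd true (S m) B (S m) w) /\
      (forall z, z = y <-> exists w, z = Pos_bd false (S m) B (S m) w) /\
      full_pos (src x) (tgt x)
  end.

Lemma full_pos_S n B (x y : Pos B n) :
  full_pos x y -> @full_pos (S n) (br (B :: nil)) (inl x) (inl y).
Proof.
revert x y; induction n as [|n IH]; intros x y H.
- destruct H as [-> ->]; simpl; repeat split.
  + intros ->; now exists (inl tt).
  + intros [[[]|[]] ->]; reflexivity.
  + intros ->; now exists (inl tt).
  + intros [[[]|[]] ->]; reflexivity.
- destruct H as (H1 & H2 & H3); split; [|split].
  + intros z; split.
    * intros ->; destruct (proj1 (H1 x) eq_refl) as [w ->]; now exists (inl w).
    * intros [[w|[]] ->]; simpl; f_equal; apply H1; now exists w.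
  + intros z; split.
    * intros ->; destruct (proj1 (H2 y) eq_refl) as [w ->]; now exists (inl w).
    * intros [[w|[]] ->]; simpl; f_equal; apply H2; now exists w.
  + exact (IH _ _ H3).
Qed.

Lemma full_D n : full_pos (Dtop n) (Dtop n).
Proof. induction n as [|n IH]; [now split | exact (full_pos_S IH)]. Qed.

Lemma full_Q n : full_pos (src (Qp n)) (tgt (Qq n)).
Proof. induction n as [|n IH]; [now split | exact (full_pos_S IH)]. Qed.

Record BdMap (Z : gset) (m n : nat) (X : gSetn n) (p : Par X) := MkBdMap {
  bdmap : hom (tr n Z) X;
  bdmap_bd : n < m -> forall z : Z (S n), Par_map bdmap (tr_bd z) = p }.

Section BdMap.
Variables (Z : gset) (m : nat) (side : forall k, Z k -> bool).
Hypothesis side_src : forall k (z : Z (S k)), k < m -> side (src z) = true.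
Hypothesis side_tgt : forall k (z : Z (S k)), k < m -> side (tgt z) = false.

Definition BdMap0 (X : gSetn 0) (p : Par X) : BdMap Z m p.
Proof.
refine (@MkBdMap Z m 0 X p (fun z : Z 0 => if side z then psrc p else ptgt p) _).
intros H z; apply Par_eq; simpl.
- now rewrite side_src.
- now rewrite side_tgt.
Defined.

Definition BdMapS (n : nat) (H : n < m) (X : gSetn (S n)) (p : Par X)
  (f : BdMap Z m (gbd X (psrc p))) : BdMap Z m p.
Proof.
unshelve refine (@MkBdMap Z m (S n) X p
  (@MkGhomS (gSetn n) (tr (S n) Z) X (bdmap f)
     (fun z : Z (S n) => if side z then psrc p else ptgt p) _) _).
- intros z; change (gbd (tr (S n) Z) z) with (tr_bd (n := n) z).
  rewrite (bdmap_bd f H); destruct (side z); [reflexivity|].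
  symmetry; exact (ppar p).
- intros H' z; apply Par_eq; simpl.
  + now rewrite side_src.
  + now rewrite side_tgt.
Defined.

Fixpoint BdMap_of (n : nat) : n <= m -> forall (X : gSetn n) (p : Par X), BdMap Z m p :=
  match n return n <= m -> forall (X : gSetn n) (p : Par X), BdMap Z m p with
  | 0 => fun _ => BdMap0
  | S n' => fun H X p =>
      BdMapS H (BdMap_of (PeanoNat.Nat.lt_le_incl _ _ H) (gbd X (psrc p)))
  end.

(** The map sending cells that are iterated sources (resp. targets) to the
    corresponding source (resp. target) of the parallel pair [p]. *)
Definition pair_map (n : nat) (H : n <= m) (X : gSetn n) (p : Par X) : hom (tr n Z) X :=
  bdmap (BdMap_of H p).

Lemma pair_map_bd n (H : n <= m) (X : gSetn n) (p : Par X) (z : Z (S n)) :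
  n < m -> Par_map (pair_map H p) (tr_bd z) = p.
Proof. intros H'; now apply bdmap_bd. Qed.

Lemma pair_map_in n (H : n <= m) (X : gSetn n) (p : Par X) (z : Z n) :
  fmap (gtop _) (pair_map H p) (tr_in n z) = if side z then psrc p else ptgt p.
Proof. destruct n; reflexivity. Qed.

Lemma pair_map_nat n (H : n <= m) (X Y : gSetn n) (f : hom X Y) (p : Par X) :
  f @@ pair_map H p = pair_map H (Par_map f p).
Proof.
induction n as [|n IH].
- extensionality z.
  change (f (if side z then psrc p else ptgt p) = if side z then f (psrc p) else f (ptgt p)).
  now destruct (side z).
- apply ghomS_eq.
  + change (ghbase f @@ pair_map (PeanoNat.Nat.lt_le_incl _ _ H) (gbd X (psrc p))
      = pair_map (PeanoNat.Nat.lt_le_incl _ _ H) (gbd Y (ghnew f (psrc p)))).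
    rewrite ghbd; apply IH.
  + intros z.
    change (ghnew f (if side z then psrc p else ptgt p)
      = if side z then ghnew f (psrc p) else ghnew f (ptgt p)).
    now destruct (side z).
Qed.

End BdMap.

Definition sphere_side (n k : nat) (z : sphere n k) : bool := proj1_sig z.

(** The map from the n-sphere classifying a parallel pair in an n-globular set. *)
Definition sphere_map_n (n : nat) (X : gSetn n) (p : Par X) : hom (tr n (sphere n)) X :=
  @pair_map (sphere n) n (@sphere_side n) (fun _ _ _ => eq_refl) (fun _ _ _ => eq_refl)
    n (le_n n) X p.

Fixpoint Dside (n k : nat) : Pos (Dtree n) k -> bool :=
  match n return Pos (Dtree n) k -> bool with
  | 0 => fun _ => true
  | S m => match k return Pos (Dtree (S m)) k -> bool with
           | 0 => fun z => match z with None => true | Some _ => false end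
           | S k' => fun z => match z with inl z' => Dside z' | inr _ => true end
           end
  end.

Lemma Dside_src n k (z : Pos (Dtree n) (S k)) : Dside (src z) = true.
Proof.
revert k z; induction n as [|n IH]; intros k z; [destruct z|].
destruct k as [|k], z as [z|[]]; [reflexivity | apply IH].
Qed.

Lemma Dside_tgt n k (z : Pos (Dtree n) (S k)) : Dside (tgt z) = false.
Proof.
revert k z; induction n as [|n IH]; intros k z; [destruct z|].
destruct k as [|k], z as [z|[]]; [reflexivity | apply IH].
Qed.

(** The map from [Pos D_n] classifying a top cell of an n-globular set. *)
Definition cell_map (n : nat) : forall X : gSetn n, gtop _ X -> hom (tr n (Pos (Dtree n))) X.
Proof.
destruct n as [|n]; intros X x.
- exact (fun _ => x).
- unshelve refine (@MkGhomS (gSetn n) (tr (S n) (Pos (Dtree (S n)))) X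
    (@pair_map (Pos (Dtree (S n))) (S n) (@Dside (S n))
       (fun k z _ => Dside_src z) (fun k z _ => Dside_tgt z)
       n (PeanoNat.Nat.le_succ_diag_r n) _ (gbd X x))
    (fun _ => x) _).
  intros z; symmetry; apply pair_map_bd, le_n.
Defined.

Lemma cell_map_in n (X : gSetn n) (x : gtop _ X) (z : Pos (Dtree n) n) :
  fmap (gtop _) (cell_map x) (tr_in n z) = x.
Proof. destruct n; reflexivity. Qed.

Lemma cell_map_nat n (X Y : gSetn n) (f : hom X Y) (x : gtop _ X) :
  f @@ cell_map x = cell_map (fmap (gtop _) f x).
Proof.
destruct n as [|n]; [reflexivity|].
apply ghomS_eq; simpl; [|reflexivity].
rewrite ghbd; apply pair_map_nat.
Qed.

Lemma Dtree_no_cell n : Pos (Dtree n) (S n) -> False.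
Proof. induction n as [|n IH]; [intros [] | intros [z|[]]; exact (IH z)]. Qed.

Fixpoint Qside (n k : nat) : Pos (Qtree n) k -> bool :=
  match n return Pos (Qtree n) k -> bool with
  | 0 => fun _ => true
  | S m => match k return Pos (Qtree (S m)) k -> bool with
           | 0 => fun z => match z with None => true | Some _ => false end
           | S k' => fun z => match z with inl z' => Qside z' | inr _ => true end
           end
  end.

Lemma Qside_src n k (z : Pos (Qtree n) (S k)) : k < n -> Qside (src z) = true.
Proof.
revert k z; induction n as [|n IH]; intros k z H.
- destruct (PeanoNat.Nat.nlt_0_r _ H).
- destruct k as [|k], z as [z|[]]; [reflexivity | apply IH, le_S_n, H].
Qed.

Lemma Qside_tgt n k (z : Pos (Qtree n) (S k)) : k < n -> Qside (tgt z) = false.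
Proof.
revert k z; induction n as [|n IH]; intros k z H.
- destruct (PeanoNat.Nat.nlt_0_r _ H).
- destruct k as [|k], z as [z|[]]; [reflexivity | apply IH, le_S_n, H].
Qed.

(** Case analysis on the three n-cells and the two (n+1)-cells of [Pos Q_{n+1}]. *)
Fixpoint Qmid (A : Type) (a b c : A) (n : nat) : Pos (Qtree n) n -> A :=
  match n return Pos (Qtree n) n -> A with
  | 0 => fun z => match z with
                  | None => a | Some None => b | Some (Some _) => c end
  | S m => fun z => match z with inl z' => Qmid a b c z' | inr _ => a end
  end.

Fixpoint Qcase (A : Type) (a b : A) (n : nat) : Pos (Qtree n) (S n) -> A :=
  match n return Pos (Qtree n) (S n) -> A with
  | 0 => fun z => match z with inl _ => a | inr _ => b end
  | S m => fun z => match z with inl z' => Qcase a b z' | inr _ => a end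
  end.

Lemma Qcase_map (A A' : Type) (f : A -> A') (a b : A) n (z : Pos (Qtree n) (S n)) :
  f (Qcase a b z) = Qcase (f a) (f b) z.
Proof. induction n as [|n IH]; destruct z; simpl; auto. Qed.

Lemma Qcase_ind (n : nat) (P : Pos (Qtree n) (S n) -> Prop) :
  P (Qp n) -> P (Qq n) -> forall z, P z.
Proof.
induction n as [|n IH]; intros Hp Hq z.
- destruct z as [[]|[[]|[]]]; assumption.
- destruct z as [z|[]]; revert z; now apply IH.
Qed.

Lemma Qcase_p (A : Type) (a b : A) n : Qcase a b (Qp n) = a.
Proof. induction n; simpl; auto. Qed.
Lemma Qcase_q (A : Type) (a b : A) n : Qcase a b (Qq n) = b.
Proof. induction n; simpl; auto. Qed.

Lemma Qmid_map (A A' : Type) (f : A -> A') (a b c : A) n (z : Pos (Qtree n) n) :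
  f (Qmid a b c z) = Qmid (f a) (f b) (f c) z.
Proof. induction n as [|n IH]; [destruct z as [[]|] | destruct z]; simpl; auto. Qed.

Lemma Qmid_const (A : Type) (a : A) n (z : Pos (Qtree n) n) : Qmid a a a z = a.
Proof. induction n as [|n IH]; [destruct z as [[]|] | destruct z]; simpl; auto. Qed.

Lemma Qmid_src (A : Type) (a b c : A) n : Qmid a b c (src (Qp n)) = a.
Proof. induction n; simpl; auto. Qed.
Lemma Qmid_mid (A : Type) (a b c : A) n : Qmid a b c (tgt (Qp n)) = b.
Proof. induction n; simpl; auto. Qed.
Lemma Qmid_tgt (A : Type) (a b c : A) n : Qmid a b c (tgt (Qq n)) = c.
Proof. induction n; simpl; auto. Qed.

(** The map from the n-cells of [Pos Q_{n+1}] sending the source of [p_{n+1}], the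
    common cell, and the target of [q_{n+1}] to the parallel cells [a], [b], [c]. *)
Definition triple_map (n : nat) : forall (X : gSetn n) (a b c : gtop _ X),
  gpar a b -> gpar b c -> hom (tr n (Pos (Qtree n))) X.
Proof.
destruct n as [|n]; intros X a b c Hab Hbc.
- exact (fun z : Pos (Qtree 0) 0 => Qmid (n := 0) a b c z).
- unshelve refine (@MkGhomS (gSetn n) (tr (S n) (Pos (Qtree (S n)))) X
    (@pair_map (Pos (Qtree (S n))) (S n) (@Qside (S n))
       (fun k z H => Qside_src z H) (fun k z H => Qside_tgt z H)
       n (PeanoNat.Nat.le_succ_diag_r n) _ (gbd X a))
    (fun z : Pos (Qtree (S n)) (S n) => Qmid (n := S n) a b c z) _).
  intros z; transitivity (gbd X a).
  + rewrite (Qmid_map (gbd X)); simpl in Hab, Hbc.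
    rewrite <- Hbc, <- Hab; exact (Qmid_const (gbd X a) (n := S n) z).
  + symmetry; apply (pair_map_bd (Z := Pos (Qtree (S n)))), le_n.
Defined.

Lemma triple_map_in n (X : gSetn n) (a b c : gtop _ X) (Hab : gpar a b) (Hbc : gpar b c)
    (z : Pos (Qtree n) n) :
  fmap (gtop _) (triple_map Hab Hbc) (tr_in n z) = Qmid a b c z.
Proof. destruct n; reflexivity. Qed.

Lemma triple_map_nat n (X Y : gSetn n) (f : hom X Y) (a b c : gtop _ X)
    (Hab : gpar a b) (Hbc : gpar b c) :
  f @@ triple_map Hab Hbc = triple_map (gpar_map f Hab) (gpar_map f Hbc).
Proof.
destruct n as [|n].
- extensionality z; exact (Qmid_map f a b c (n := 0) z).
- apply ghomS_eq; simpl.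
  + rewrite ghbd; apply pair_map_nat.
  + intros z; exact (Qmid_map (ghnew f) a b c (n := S n) z).
Qed.

(** The data produced at stage [n] of the recursion: the category [iComp_n], the
    adjunction [Cptd_n ⊣ Cell_n], the full spheres, the invertibility sets [I_n] and
    the natural functions [fwd_n], [linv_n], [rinv_n] on them.  The fields [lev_lun]
    and [lev_run] are the values of [ibdry] on [lunit i] and [runit i] for [i] in
    [I_n(C)], which stage [n + 1] needs; [lev_full_gen] provides the full spheres
    of generators that are used in identities and composites. *)
Record Lev (n : nat) := MkLev {
  lev_cat : Cat;
  lev_adj : Adjunction (gSetn n) lev_cat;
  lev_full : forall B : tree,
    Par (radj lev_adj (ladj lev_adj (tr n (Pos B)))) -> Prop;
  lev_I : Functor lev_cat SetC;
  lev_fwd : forall C : lev_cat, lev_I C -> gtop _ (radj lev_adj C);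
  lev_linv : forall C : lev_cat, lev_I C -> gtop _ (radj lev_adj C);
  lev_rinv : forall C : lev_cat, lev_I C -> gtop _ (radj lev_adj C);
  lev_lun : forall C : lev_cat, lev_I C -> Par (radj lev_adj C);
  lev_run : forall C : lev_cat, lev_I C -> Par (radj lev_adj C);
  lev_fwd_nat : forall (C D : lev_cat) (f : hom C D) (i : lev_I C),
    fmap (gtop _) (fmap (radj lev_adj) f) (lev_fwd i) = lev_fwd (fmap lev_I f i);
  lev_linv_nat : forall (C D : lev_cat) (f : hom C D) (i : lev_I C),
    fmap (gtop _) (fmap (radj lev_adj) f) (lev_linv i) = lev_linv (fmap lev_I f i);
  lev_rinv_nat : forall (C D : lev_cat) (f : hom C D) (i : lev_I C),
    fmap (gtop _) (fmap (radj lev_adj) f) (lev_rinv i) = lev_rinv (fmap lev_I f i);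
  lev_lun_nat : forall (C D : lev_cat) (f : hom C D) (i : lev_I C),
    Par_map (fmap (radj lev_adj) f) (lev_lun i) = lev_lun (fmap lev_I f i);
  lev_run_nat : forall (C D : lev_cat) (f : hom C D) (i : lev_I C),
    Par_map (fmap (radj lev_adj) f) (lev_run i) = lev_run (fmap lev_I f i);
  lev_full_gen : forall (B : tree) (x y : Pos B n) (H : zpar x y), full_pos x y ->
    lev_full (Par_map (unit lev_adj (tr n (Pos B))) (MkPar (tr_par H))) }.

Definition adj0 : Adjunction SetC SetC := {|
  radj := idF SetC;
  ladj X := X;
  unit X := idc X;
  transpose X Y g := g;
  transpose_unit X Y g := eq_refl;
  transpose_uniq X Y f := eq_refl |}.

Definition emptyF (A : Cat) : Functor A SetC.
Proof.
refine {| fob := (fun _ => Empty_set) : A -> SetC; fmap X Y f := fun x => x |};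
  reflexivity.
Defined.

Definition Lev0 : Lev 0.
Proof.
refine {|
  lev_cat := SetC;
  lev_adj := adj0 : Adjunction (gSetn 0) SetC;
  lev_full B A := psrc A = Pos_bd true 0 B 0 tt /\ ptgt A = Pos_bd false 0 B 0 tt;
  lev_I := emptyF SetC;
  lev_fwd C i := match i : Empty_set with end;
  lev_linv C i := match i : Empty_set with end;
  lev_rinv C i := match i : Empty_set with end;
  lev_lun C i := match i : Empty_set with end;
  lev_run C i := match i : Empty_set with end |};
  [intros C D f [] .. | intros B x y H Hf; exact Hf].
Defined.

Section Step.
Variables (n : nat) (L : Lev n).

Local Notation Cell := (radj (lev_adj L)).
Local Notation Cptd := (ladj (lev_adj L)).
Local Notation η := (unit (lev_adj L)).

Record comp := MkComp {
  base : lev_cat L;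
  V : Type;
  U : Type;
  phi : V -> Par (Cell base);
  psi : U -> Par (Cell base) }.

Arguments phi : clear implicits.
Arguments psi : clear implicits.

Inductive inv (C : comp) : Type :=
| igen (u : U C)
| lunit (i : lev_I L (base C))
| runit (i : lev_I L (base C)).

Arguments igen {C} u.
Arguments lunit {C} i.
Arguments runit {C} i.

Definition ibdry (C : comp) (j : inv C) : Par (Cell (base C)) :=
  match j with
  | igen u => psi C u
  | lunit i => lev_lun i
  | runit i => lev_run i
  end.

Definition cptdS (X : gobS (gSetn n)) : comp := {|
  base := Cptd (gbase X);
  V := gnew X;
  U := Empty_set;
  phi x := Par_map (η (gbase X)) (gbd X x);
  psi u := match u with end |}.

(** The (n+1)-cells, indexed by their boundary: the indexing replaces the recursive
    part of the inductive-recursive definition.  A morphism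
    [Cptd_{n+1}(Pos B) -> C] is here given by its components [f] and [fV] (there
    are no invertible generators), [fV] being indexed by the boundaries that are
    required of a morphism; see [coh] below. *)
Inductive icell (C : comp) : Par (Cell (base C)) -> Type :=
| icell_gen (v : V C) : icell (phi C v)
| icell_fwd (i : inv C) : icell (ibdry i)
| icell_linv (i : inv C) : icell (Par_op (ibdry i))
| icell_rinv (i : inv C) : icell (Par_op (ibdry i))
| icell_coh (B : tree) (HB : dim B <= S n)
    (A : Par (Cell (Cptd (tr n (Pos B))))) (HA : lev_full A)
    (f : hom (Cptd (tr n (Pos B))) (base C))
    (fV : forall p : Pos B (S n),
       icell (Par_map (fmap Cell f) (phi (cptdS (tr (S n) (Pos B))) p))) :
    icell (Par_map (fmap Cell f) A).

Definition cellS (C : comp) : Type := {b : Par (Cell (base C)) & icell b}.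
Definition bdry (C : comp) (c : cellS C) : Par (Cell (base C)) := projT1 c.

Definition gen (C : comp) (v : V C) : cellS C := existT _ _ (icell_gen v).
Definition fwd (C : comp) (i : inv C) : cellS C := existT _ _ (icell_fwd i).
Definition linv (C : comp) (i : inv C) : cellS C := existT _ _ (icell_linv i).
Definition rinv (C : comp) (i : inv C) : cellS C := existT _ _ (icell_rinv i).

Record chom (D C : comp) := MkChom {
  hbase : hom (base D) (base C);
  hV : V D -> cellS C;
  hU : U D -> inv C;
  hV_bdry : forall v, bdry (hV v) = Par_map (fmap Cell hbase) (phi D v);
  hU_bdry : forall u, ibdry (hU u) = Par_map (fmap Cell hbase) (psi D u) }.

Definition coh (C : comp) (B : tree) (HB : dim B <= S n)
    (A : Par (Cell (Cptd (tr n (Pos B))))) (HA : lev_full A)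
    (f : chom (cptdS (tr (S n) (Pos B))) C) : cellS C :=
  existT _ (Par_map (fmap Cell (hbase f)) A)
    (icell_coh HB HA (fun p => eq_rect _ (@icell C) (projT2 (hV f p)) _ (hV_bdry f p))).

Lemma chom_eq (D C : comp) (f g : chom D C) :
  hbase f = hbase g -> (forall v, hV f v = hV g v) -> (forall u, hU f u = hU g u) -> f = g.
Proof.
destruct f as [f fV fU Hf Hf'], g as [g gV gU Hg Hg']; simpl; intros -> e e'.
assert (eV : fV = gV) by (extensionality v; apply e).
assert (eU : fU = gU) by (extensionality u; apply e').
subst gV gU; now rewrite (proof_irrelevance _ Hf Hg), (proof_irrelevance _ Hf' Hg').
Qed.

Lemma cell_ind (C : comp) (P : cellS C -> Prop) :
  (forall v, P (gen v)) -> (forall i, P (fwd i)) -> (forall i, P (linv i)) ->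
  (forall i, P (rinv i)) ->
  (forall B HB A HA (f : chom (cptdS (tr (S n) (Pos B))) C),
     (forall p, P (hV f p)) -> P (@coh C B HB A HA f)) ->
  forall c, P c.
Proof.
intros Hgen Hfwd Hlinv Hrinv Hcoh [b c].
induction c as [v|i|i|i|B HB A HA f fV IH];
  [apply Hgen | apply Hfwd | apply Hlinv | apply Hrinv |].
set (g := @MkChom (cptdS (tr (S n) (Pos B))) C f (fun p => existT _ _ (fV p))
  (fun u : Empty_set => match u with end) (fun p => eq_refl)
  (fun u : Empty_set => match u with end)).
exact (Hcoh B HB A HA g IH).
Qed.

Definition imap (D C : comp) (f : chom D C) (j : inv D) : inv C :=
  match j with
  | igen u => hU f u
  | lunit i => lunit (fmap (lev_I L) (hbase f) i)
  | runit i => runit (fmap (lev_I L) (hbase f) i)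
  end.

Lemma imap_bdry (D C : comp) (f : chom D C) (j : inv D) :
  ibdry (imap f j) = Par_map (fmap Cell (hbase f)) (ibdry j).
Proof.
destruct j as [u|i|i]; simpl.
- apply hU_bdry.
- symmetry; apply lev_lun_nat.
- symmetry; apply lev_run_nat.
Qed.

Lemma imap_bdry_op (D C : comp) (f : chom D C) (j : inv D) :
  Par_op (ibdry (imap f j)) = Par_map (fmap Cell (hbase f)) (Par_op (ibdry j)).
Proof. rewrite imap_bdry; now apply Par_eq. Qed.

Lemma Par_cell_cmp (X Y Z : lev_cat L) (g : hom Y Z) (f : hom X Y) (p : Par (Cell X)) :
  Par_map (fmap Cell (g @@ f)) p = Par_map (fmap Cell g) (Par_map (fmap Cell f) p).
Proof. now rewrite fmap_cmp, Par_map_cmp. Qed.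

Fixpoint act_icell (D C : comp) (f : chom D C) (b : Par (Cell (base D))) (c : icell b) :
    {d : cellS C | bdry d = Par_map (fmap Cell (hbase f)) b} :=
  match c in icell b return {d : cellS C | bdry d = Par_map (fmap Cell (hbase f)) b} with
  | icell_gen v => exist _ (hV f v) (hV_bdry f v)
  | icell_fwd i => exist _ (fwd (imap f i)) (imap_bdry f i)
  | icell_linv i => exist _ (linv (imap f i)) (imap_bdry_op f i)
  | icell_rinv i => exist _ (rinv (imap f i)) (imap_bdry_op f i)
  | @icell_coh _ B HB A HA g gV =>
      exist _
        (coh HB HA
          (@MkChom (cptdS (tr (S n) (Pos B))) C (hbase f @@ g)
            (fun p => proj1_sig (act_icell f (gV p)))
            (fun u : Empty_set => match u with end)
            (fun p => eq_trans (proj2_sig (act_icell f (gV p)))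
                               (eq_sym (Par_cell_cmp _ _ _)))
            (fun u : Empty_set => match u with end)))
        (Par_cell_cmp _ _ _)
  end.

Definition cellS_map (D C : comp) (f : chom D C) (c : cellS D) : cellS C :=
  proj1_sig (act_icell f (projT2 c)).

Lemma cellS_map_bdry (D C : comp) (f : chom D C) (c : cellS D) :
  bdry (cellS_map f c) = Par_map (fmap Cell (hbase f)) (bdry c).
Proof. exact (proj2_sig (act_icell f (projT2 c))). Qed.

Definition chom_id (C : comp) : chom C C.
Proof.
refine {| hbase := idc (base C); hV := @gen C; hU := @igen C |};
  intros; now rewrite fmap_id, Par_map_id.
Defined.

Definition chom_cmp (C D E : comp) (g : chom D E) (f : chom C D) : chom C E.
Proof.
refine {| hbase := hbase g @@ hbase f;
          hV v := cellS_map g (hV f v);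
          hU u := imap g (hU f u) |}; intros.
- now rewrite cellS_map_bdry, hV_bdry, Par_cell_cmp.
- now rewrite imap_bdry, hU_bdry, Par_cell_cmp.
Defined.

Lemma act_icell_cast (D C : comp) (f : chom D C) b b' (e : b = b') (c : icell b) :
  proj1_sig (act_icell f (eq_rect b (@icell D) c b' e)) = proj1_sig (act_icell f c).
Proof. now destruct e. Qed.

Lemma cellS_map_coh (D C : comp) (f : chom D C) B HB A HA
    (g : chom (cptdS (tr (S n) (Pos B))) D) :
  cellS_map f (@coh D B HB A HA g) = coh HB HA (chom_cmp f g).
Proof.
unfold cellS_map; simpl; f_equal; apply chom_eq; simpl.
- reflexivity.
- intros p; apply act_icell_cast.
- intros [].
Qed.

Lemma imap_id (C : comp) (j : inv C) : imap (chom_id C) j = j.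
Proof. destruct j; simpl; now rewrite ?fmap_id. Qed.

Lemma imap_cmp (C D E : comp) (g : chom D E) (f : chom C D) (j : inv C) :
  imap (chom_cmp g f) j = imap g (imap f j).
Proof. destruct j; simpl; now rewrite ?fmap_cmp. Qed.

Lemma cellS_map_id (C : comp) (c : cellS C) : cellS_map (chom_id C) c = c.
Proof.
induction c as [v|i|i|i|B HB A HA f IH] using cell_ind.
- reflexivity.
- exact (f_equal (@fwd C) (imap_id i)).
- exact (f_equal (@linv C) (imap_id i)).
- exact (f_equal (@rinv C) (imap_id i)).
- rewrite cellS_map_coh; f_equal; apply chom_eq; simpl.
  + apply cmp_idl.
  + exact IH.
  + intros [].
Qed.

Lemma cellS_map_cmp (C D E : comp) (g : chom D E) (f : chom C D) (c : cellS C) :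
  cellS_map (chom_cmp g f) c = cellS_map g (cellS_map f c).
Proof.
induction c as [v|i|i|i|B HB A HA h IH] using cell_ind.
- reflexivity.
- exact (f_equal (@fwd E) (imap_cmp g f i)).
- exact (f_equal (@linv E) (imap_cmp g f i)).
- exact (f_equal (@rinv E) (imap_cmp g f i)).
- rewrite !cellS_map_coh; f_equal; apply chom_eq; simpl.
  + symmetry; apply cmp_assoc.
  + exact IH.
  + intros [].
Qed.

Definition compC : Cat.
Proof.
refine {| ob := comp; hom := chom; idc := chom_id; cmp := chom_cmp |};
  intros; apply chom_eq; simpl; intros.
- apply cmp_idl.
- apply cellS_map_id.
- apply imap_id.
- apply cmp_idr.
- reflexivity.
- reflexivity.
- apply cmp_assoc.
- symmetry; apply cellS_map_cmp.
- symmetry; apply imap_cmp.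
Defined.

Definition IFS : Functor compC SetC.
Proof.
refine {| fob := inv : compC -> SetC; fmap C D f := imap (f : chom C D) |}.
- intros C; extensionality j; apply imap_id.
- intros C D E g f; extensionality j; apply imap_cmp.
Defined.

Definition CellS_ob (C : comp) : gobS (gSetn n) :=
  {| gbase := Cell (base C); gnew := cellS C; gbd := @bdry C |}.

Definition CellS_map (D C : comp) (f : chom D C) : ghomS (CellS_ob D) (CellS_ob C) :=
  @MkGhomS (gSetn n) (CellS_ob D) (CellS_ob C)
    (fmap Cell (hbase f)) (cellS_map f) (cellS_map_bdry f).

Definition CellF : Functor compC (gSetn (S n)).
Proof.
refine {| fob := CellS_ob : compC -> gSetn (S n); fmap := CellS_map |}.
- intros C; apply ghomS_eq; simpl; [apply fmap_id | apply cellS_map_id].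
- intros C D E g f; apply ghomS_eq; simpl; [apply fmap_cmp | apply cellS_map_cmp].
Defined.

Definition unitS (X : gobS (gSetn n)) : ghomS X (CellS_ob (cptdS X)) :=
  @MkGhomS (gSetn n) X (CellS_ob (cptdS X)) (η (gbase X)) (@gen (cptdS X))
    (fun x => eq_refl).

Definition transposeS (X : gobS (gSetn n)) (C : comp) (g : ghomS X (CellS_ob C)) :
  chom (cptdS X) C.
Proof.
refine (@MkChom (cptdS X) C (transpose (lev_adj L) (ghbase g)) (ghnew g)
          (fun u : Empty_set => match u with end) _ _).
- intros v; simpl; rewrite <- Par_map_cmp, transpose_unit; apply (ghbd g).
- intros [].
Defined.

Definition adjS : Adjunction (gSetn (S n)) compC.
Proof.
refine (@MkAdj (gSetn (S n)) compC CellF cptdS unitS transposeS _ _).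
- intros X C g; apply ghomS_eq; simpl; [apply transpose_unit | reflexivity].
- intros X C f; apply chom_eq; simpl;
    [apply transpose_uniq | reflexivity | intros []].
Defined.

Fixpoint supp_icell (C : comp) (b : Par (Cell (base C))) (c : icell b) :
    V C + U C -> Prop :=
  match c with
  | icell_gen v => fun g => g = inl v
  | icell_fwd i | icell_linv i | icell_rinv i =>
      fun g => match i with igen u => g = inr u | _ => False end
  | icell_coh _ _ fV => fun g => exists p, supp_icell (fV p) g
  end.

Definition supp (C : comp) (c : cellS C) : V C + U C -> Prop := supp_icell (projT2 c).

Definition fullS (B : tree) (A : Par (CellF (cptdS (tr (S n) (Pos B))))) : Prop :=
  (forall g, supp (psrc A) g <-> exists w, g = inl (Pos_bd true (S n) B (S n) w)) /\
  (forall g, supp (ptgt A) g <-> exists w, g = inl (Pos_bd false (S n) B (S n) w)) /\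
  lev_full (bdry (psrc A)).

Lemma fullS_gen (B : tree) (x y : Pos B (S n)) (H : zpar x y) : full_pos x y ->
  fullS (Par_map (unit adjS (tr (S n) (Pos B))) (MkPar (tr_par H))).
Proof.
intros (H1 & H2 & H3); split; [|split].
- intros g; transitivity (g = inl x); [reflexivity|]; split.
  + intros ->; destruct (proj1 (H1 x) eq_refl) as [w e]; exists w; now f_equal.
  + intros [w ->]; f_equal; apply H1; now exists w.
- intros g; transitivity (g = inl y); [reflexivity|]; split.
  + intros ->; destruct (proj1 (H2 y) eq_refl) as [w e]; exists w; now f_equal.
  + intros [w ->]; f_equal; apply H2; now exists w.
- assert (Hx : zpar (src x) (tgt x)).
  { clear; destruct n; simpl; auto using glob_src, glob_tgt. }
  pose proof (lev_full_gen L Hx H3) as F.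
  match goal with |- lev_full ?p => match type of F with lev_full ?q =>
    replace p with q; [exact F | now apply Par_eq] end end.
Qed.

Lemma Par_transpose (X : gSetn n) (Y : lev_cat L) (g : hom X (Cell Y)) (p : Par X) :
  Par_map (fmap Cell (transpose (lev_adj L) g)) (Par_map (η X) p) = Par_map g p.
Proof. now rewrite <- Par_map_cmp, transpose_unit. Qed.

(** [id_{n+1}(c)], for an n-cell [c]. *)
Definition id_mor (C : comp) (c : gtop _ (Cell (base C))) :
    chom (cptdS (tr (S n) (Pos (Dtree n)))) C :=
  @MkChom (cptdS (tr (S n) (Pos (Dtree n)))) C
    (transpose (lev_adj L) (cell_map c))
    (fun z => match Dtree_no_cell z with end)
    (fun u : Empty_set => match u with end)
    (fun z => match Dtree_no_cell z with end)
    (fun u : Empty_set => match u with end).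

Lemma dim_Dtree_le : dim (Dtree n) <= S n.
Proof. rewrite dim_Dtree; apply le_S, le_n. Qed.

Definition cell_id (C : comp) (c : gtop _ (Cell (base C))) : cellS C :=
  coh dim_Dtree_le (lev_full_gen L (D_zpar n) (full_D n)) (id_mor c).

Lemma cell_id_bdry (C : comp) (c : gtop _ (Cell (base C))) :
  psrc (bdry (cell_id c)) = c /\ ptgt (bdry (cell_id c)) = c.
Proof.
assert (E : bdry (cell_id c) = Par_map (cell_map c) (MkPar (tr_par (D_zpar n))))
  by apply Par_transpose.
rewrite E; split; apply cell_map_in.
Qed.

Lemma cell_id_nat (C D : comp) (f : chom C D) (c : gtop _ (Cell (base C))) :
  cellS_map f (cell_id c) = @cell_id D (fmap (gtop _) (fmap Cell (hbase f)) c).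
Proof.
unfold cell_id; rewrite cellS_map_coh; f_equal; apply chom_eq; simpl.
- now rewrite transpose_post, cell_map_nat.
- intros z; destruct (Dtree_no_cell z).
- intros [].
Qed.

(** [a * b], for (n+1)-cells [a] and [b] with [t_n a = s_n b]. *)
Lemma glue_par (C : comp) (a b : cellS C) (H : ptgt (bdry a) = psrc (bdry b)) :
  gpar (ptgt (bdry a)) (ptgt (bdry b)).
Proof. rewrite H; apply ppar. Qed.

Lemma glue_bdry (C : comp) (a b : cellS C) (H : ptgt (bdry a) = psrc (bdry b))
    (z : Pos (Qtree n) (S n)) :
  bdry (Qcase a b z) = Par_map (fmap Cell (transpose (lev_adj L)
      (triple_map (ppar (bdry a)) (glue_par H))))
    (Par_map (η (tr n (Pos (Qtree n)))) (tr_bd z)).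
Proof.
rewrite Par_transpose; revert z; apply Qcase_ind.
- rewrite Qcase_p; apply Par_eq; symmetry; simpl.
  + etransitivity; [apply triple_map_in | apply Qmid_src].
  + etransitivity; [apply triple_map_in | apply Qmid_mid].
- rewrite Qcase_q; apply Par_eq; symmetry; simpl.
  + etransitivity; [apply triple_map_in |].
    rewrite <- Q_glue, Qmid_mid; exact H.
  + etransitivity; [apply triple_map_in | apply Qmid_tgt].
Qed.

Definition glue_mor (C : comp) (a b : cellS C) (H : ptgt (bdry a) = psrc (bdry b)) :
    chom (cptdS (tr (S n) (Pos (Qtree n)))) C :=
  @MkChom (cptdS (tr (S n) (Pos (Qtree n)))) C
    (transpose (lev_adj L) (triple_map (ppar (bdry a)) (glue_par H)))
    (fun z => Qcase a b z)
    (fun u : Empty_set => match u with end)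
    (glue_bdry H)
    (fun u : Empty_set => match u with end).

Lemma dim_Qtree_le : dim (Qtree n) <= S n.
Proof. rewrite dim_Qtree; apply le_n. Qed.

Definition cell_comp (C : comp) (a b : cellS C) (H : ptgt (bdry a) = psrc (bdry b)) :
    cellS C :=
  coh dim_Qtree_le (lev_full_gen L (Q_zpar n) (full_Q n)) (glue_mor H).

Lemma cell_comp_bdry (C : comp) (a b : cellS C) (H : ptgt (bdry a) = psrc (bdry b)) :
  psrc (bdry (cell_comp H)) = psrc (bdry a) /\
  ptgt (bdry (cell_comp H)) = ptgt (bdry b).
Proof.
assert (E : bdry (cell_comp H) = Par_map (triple_map (ppar (bdry a)) (glue_par H))
  (MkPar (tr_par (Q_zpar n)))) by apply Par_transpose.
rewrite E; split; simpl.
- etransitivity; [apply triple_map_in | apply Qmid_src].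
- etransitivity; [apply triple_map_in | apply Qmid_tgt].
Qed.

Lemma triple_map_eq (X : gSetn n) (a b c a' b' c' : gtop _ X)
    (H1 : gpar a b) (H2 : gpar b c) (H1' : gpar a' b') (H2' : gpar b' c') :
  a = a' -> b = b' -> c = c' -> triple_map H1 H2 = triple_map H1' H2'.
Proof.
intros; subst.
now rewrite (proof_irrelevance _ H1 H1'), (proof_irrelevance _ H2 H2').
Qed.

Lemma cell_comp_nat (C D : comp) (f : chom C D) (a b : cellS C)
    (H : ptgt (bdry a) = psrc (bdry b))
    (H' : ptgt (bdry (cellS_map f a)) = psrc (bdry (cellS_map f b))) :
  cellS_map f (cell_comp H) = cell_comp H'.
Proof.
unfold cell_comp; rewrite cellS_map_coh; f_equal; apply chom_eq; simpl.
- rewrite transpose_post, triple_map_nat; f_equal.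
  apply triple_map_eq; now rewrite cellS_map_bdry.
- intros z; apply Qcase_map.
- intros [].
Qed.

Lemma lunS_par (C : comp) (i : inv C) :
  bdry (@cell_comp C (linv i) (fwd i) eq_refl) = bdry (@cell_id C (ptgt (bdry (fwd i)))).
Proof.
apply Par_eq.
- transitivity (ptgt (ibdry i));
    [apply (@cell_comp_bdry C (linv i) (fwd i)) | symmetry; apply cell_id_bdry].
- transitivity (ptgt (ibdry i));
    [apply (@cell_comp_bdry C (linv i) (fwd i)) | symmetry; apply cell_id_bdry].
Qed.

Definition lunS (C : comp) (i : inv C) : Par (CellF C) :=
  @MkPar (gSetn (S n)) (CellF C)
    (@cell_comp C (linv i) (fwd i) eq_refl) (@cell_id C (ptgt (bdry (fwd i)))) (lunS_par i).

Lemma runS_par (C : comp) (i : inv C) :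
  bdry (@cell_comp C (fwd i) (rinv i) eq_refl) = bdry (@cell_id C (psrc (bdry (fwd i)))).
Proof.
apply Par_eq.
- transitivity (psrc (ibdry i));
    [apply (@cell_comp_bdry C (fwd i) (rinv i)) | symmetry; apply cell_id_bdry].
- transitivity (psrc (ibdry i));
    [apply (@cell_comp_bdry C (fwd i) (rinv i)) | symmetry; apply cell_id_bdry].
Qed.

Definition runS (C : comp) (i : inv C) : Par (CellF C) :=
  @MkPar (gSetn (S n)) (CellF C)
    (@cell_comp C (fwd i) (rinv i) eq_refl) (@cell_id C (psrc (bdry (fwd i)))) (runS_par i).

Lemma lunS_nat (C D : comp) (f : chom C D) (i : inv C) :
  Par_map (fmap CellF f) (lunS i) = lunS (imap f i).
Proof.
apply Par_eq; simpl.
- apply (@cell_comp_nat C D f (linv i) (fwd i) eq_refl eq_refl).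
- etransitivity; [apply cell_id_nat|]; f_equal; simpl; now rewrite imap_bdry.
Qed.

Lemma runS_nat (C D : comp) (f : chom C D) (i : inv C) :
  Par_map (fmap CellF f) (runS i) = runS (imap f i).
Proof.
apply Par_eq; simpl.
- apply (@cell_comp_nat C D f (fwd i) (rinv i) eq_refl eq_refl).
- etransitivity; [apply cell_id_nat|]; f_equal; simpl; now rewrite imap_bdry.
Qed.

Definition LevS : Lev (S n) := {|
  lev_cat := compC;
  lev_adj := adjS;
  lev_full := fullS;
  lev_I := IFS;
  lev_fwd := fwd;
  lev_linv := linv;
  lev_rinv := rinv;
  lev_lun := lunS;
  lev_run := runS;
  lev_fwd_nat := fun C D f i => eq_refl;
  lev_linv_nat := fun C D f i => eq_refl;
  lev_rinv_nat := fun C D f i => eq_refl;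
  lev_lun_nat := lunS_nat;
  lev_run_nat := runS_nat;
  lev_full_gen := fullS_gen |}.

End Step.

Fixpoint lev (n : nat) : Lev n :=
  match n with 0 => Lev0 | S m => LevS (lev m) end.

Definition iCompn (n : nat) : Cat := lev_cat (lev n).
Definition adjn (n : nat) : Adjunction (gSetn n) (iCompn n) := lev_adj (lev n).
Definition Celln (n : nat) : Functor (iCompn n) (gSetn n) := radj (adjn n).
Definition Cptdn (n : nat) (X : gSetn n) : iCompn n := ladj (adjn n) X.
Definition Invn (n : nat) : Functor (iCompn n) SetC := lev_I (lev n).

(** The set [Cell_n(C)_n] of top-dimensional cells. *)
Definition top (n : nat) (C : iCompn n) : Type := gtop _ (Celln n C).
Definition top_map (n : nat) (C D : iCompn n) (f : hom C D) : top C -> top D :=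
  fmap (gtop _) (fmap (Celln n) f).

Definition trc (n : nat) (C : iCompn (S n)) : iCompn n := base (L := lev n) C.
Definition trc_map (n : nat) (C D : iCompn (S n)) (f : hom C D) : hom (trc C) (trc D) :=
  hbase (L := lev n) f.
Definition Vgen (n : nat) (C : iCompn (S n)) : Type := V (L := lev n) C.
Definition Ugen (n : nat) (C : iCompn (S n)) : Type := U (L := lev n) C.

(** A computad is a sequence of n-computads, each of which is equal to the truncation
    of the next; morphisms are compatible up to transport along these equalities. *)
Record icomp := MkIcomp {
  lv :> forall n, iCompn n;
  lv_tr : forall n, trc (lv (S n)) = lv n }.

Record icomp_hom (C D : icomp) := MkIcompHom {
  hl :> forall n, hom (C n) (D n);
  hl_tr : forall n, hom_cast (lv_tr C n) (lv_tr D n) (trc_map (hl (S n))) = hl n }.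

Lemma icomp_hom_eq (C D : icomp) (f g : icomp_hom C D) : (forall n, f n = g n) -> f = g.
Proof.
destruct f as [f Hf], g as [g Hg]; simpl; intros e.
assert (e' : f = g) by (extensionality n; apply e).
subst g; now rewrite (proof_irrelevance _ Hf Hg).
Qed.

Lemma hom_cast_id (A : Cat) (X X' : A) (e : X = X') : hom_cast e e (idc X) = idc X'.
Proof. now destruct e. Qed.

Lemma hom_cast_cmp (A : Cat) (X X' Y Y' Z Z' : A) (e : X = X') (d : Y = Y') (c : Z = Z')
    (g : hom Y Z) (f : hom X Y) :
  hom_cast e c (g @@ f) = hom_cast d c g @@ hom_cast e d f.
Proof. now destruct e, d, c. Qed.

Definition icomp_id (C : icomp) : icomp_hom C C.
Proof. refine {| hl n := idc (C n) |}; intros n; apply hom_cast_id. Defined.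

Definition icomp_cmp (C D E : icomp) (g : icomp_hom D E) (f : icomp_hom C D) :
  icomp_hom C E.
Proof.
refine {| hl n := g n @@ f n |}; intros n.
etransitivity; [exact (hom_cast_cmp _ (lv_tr D n) _ _ _)|].
f_equal; apply hl_tr.
Defined.

Definition iComp : Cat.
Proof.
refine {| ob := icomp; hom := icomp_hom; idc := icomp_id; cmp := icomp_cmp |};
  intros; apply icomp_hom_eq; intros k; simpl.
- apply cmp_idl.
- apply cmp_idr.
- apply cmp_assoc.
Defined.

Definition top_cast (n : nat) (C D : iCompn n) (e : C = D) : top C -> top D :=
  match e with eq_refl => fun x => x end.

Lemma top_cast_nat (n : nat) (C C' D D' : iCompn n) (e : C = C') (d : D = D')
    (f : hom C D) (x : top C) :
  top_map (hom_cast e d f) (top_cast e x) = top_cast d (top_map f x).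
Proof. now destruct e, d. Qed.

Definition bdryn (n : nat) (C : iCompn (S n)) (x : top C) : Par (Celln n (trc C)) :=
  gbd (Celln (S n) C) x.

Lemma top_cast_par (n : nat) (C D : iCompn n) (e : C = D) (x y : top C) :
  gpar (X := Celln n C) x y -> gpar (X := Celln n D) (top_cast e x) (top_cast e y).
Proof. now destruct e. Qed.

Definition cell_src (C : icomp) (n : nat) (x : top (C (S n))) : top (C n) :=
  top_cast (lv_tr C n) (psrc (bdryn x)).
Definition cell_tgt (C : icomp) (n : nat) (x : top (C (S n))) : top (C n) :=
  top_cast (lv_tr C n) (ptgt (bdryn x)).

Lemma cell_bd_par (C : icomp) (n : nat) (x : top (C (S (S n)))) :
  bdryn (cell_src x) = bdryn (cell_tgt x).
Proof. exact (top_cast_par (lv_tr C (S n)) (ppar (bdryn x))). Qed.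

Definition Cell_ob (C : icomp) : gset.
Proof.
refine {| gc n := top (C n); src := @cell_src C; tgt := @cell_tgt C |}; intros n x.
- unfold cell_src at 1 3; now rewrite cell_bd_par.
- unfold cell_tgt at 1 2; now rewrite cell_bd_par.
Defined.

Definition Cell_map (C D : icomp) (f : icomp_hom C D) : gmap (Cell_ob C) (Cell_ob D).
Proof.
refine (@MkGmap (Cell_ob C) (Cell_ob D) (fun n => top_map (f n)) _ _); intros n x.
- change (cell_src (top_map (f (S n)) x) = top_map (f n) (cell_src x)).
  unfold cell_src; rewrite <- (hl_tr f n), top_cast_nat; f_equal.
  exact (f_equal (@psrc _ _) (ghbd (fmap (Celln (S n)) (f (S n))) x)).
- change (cell_tgt (top_map (f (S n)) x) = top_map (f n) (cell_tgt x)).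
  unfold cell_tgt; rewrite <- (hl_tr f n), top_cast_nat; f_equal.
  exact (f_equal (@ptgt _ _) (ghbd (fmap (Celln (S n)) (f (S n))) x)).
Defined.

Definition Cell : Functor iComp gSet.
Proof.
refine {| fob := Cell_ob : iComp -> gSet; fmap := Cell_map |}.
- intros C; apply gmap_eq; intros n x; simpl; unfold top_map; now rewrite !fmap_id.
- intros C D E g f; apply gmap_eq; intros n x; simpl; unfold top_map; now rewrite !fmap_cmp.
Defined.

(** [Cell_tr] compares the n-truncation of [Cell C] with [Cell_n(C_n)]; it is the
    identity on cells. *)

Record CellTr (C : icomp) (n : nat) := MkCellTr {
  celltr : hom (tr n (Cell C)) (Celln n (C n));
  celltr_in : forall x : top (C n), fmap (gtop _) celltr (tr_in (X := Cell C) n x) = x }.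

Lemma top_cast_sym (n : nat) (C D : iCompn n) (e : C = D) (x : top C) :
  top_map (id_of_eq (eq_sym e)) (top_cast e x) = x.
Proof. destruct e; simpl; unfold top_map; now rewrite !fmap_id. Qed.

Definition CellTrS (C : icomp) (n : nat) (T : CellTr C n) : CellTr C (S n).
Proof.
unshelve refine (@MkCellTr C (S n)
  (@MkGhomS (gSetn n) (tr (S n) (Cell C)) (Celln (S n) (C (S n)))
    (fmap (Celln n) (id_of_eq (eq_sym (lv_tr C n))) @@ celltr T)
    (fun x : top (C (S n)) => x) _) _).
- intros x; rewrite Par_map_cmp; apply Par_eq; simpl; symmetry.
  + etransitivity; [apply f_equal, (celltr_in T)|].
    exact (top_cast_sym (lv_tr C n) (psrc (bdryn x))).
  + etransitivity; [apply f_equal, (celltr_in T)|].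
    exact (top_cast_sym (lv_tr C n) (ptgt (bdryn x))).
- reflexivity.
Defined.

Fixpoint CellTr_of (C : icomp) (n : nat) : CellTr C n :=
  match n with
  | 0 => @MkCellTr C 0 (fun x => x) (fun x => eq_refl)
  | S m => CellTrS (CellTr_of C m)
  end.

Definition Cell_tr (n : nat) (C : icomp) : hom (tr n (Cell C)) (Celln n (C n)) :=
  celltr (CellTr_of C n).

Lemma Cell_tr_in n (C : icomp) (x : top (C n)) :
  fmap (gtop _) (Cell_tr n C) (tr_in (X := Cell C) n x) = x.
Proof. apply celltr_in. Qed.

(** Maps into [Cell_n(C_n)] from an n-truncation are determined by their compatible
    components. *)
Lemma tr_hom_ext (X : gset) (C : icomp)
    (f g : forall n, hom (tr n X) (Celln n (C n))) :
  (forall n x, fmap (gtop _) (f n) (tr_in n x) = fmap (gtop _) (g n) (tr_in n x)) ->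
  (forall n, fmap (Celln n) (id_of_eq (lv_tr C n)) @@ ghbase (f (S n)) = f n) ->
  (forall n, fmap (Celln n) (id_of_eq (lv_tr C n)) @@ ghbase (g (S n)) = g n) ->
  forall n, f n = g n.
Proof.
intros H Hf Hg n; induction n as [|n IH].
- extensionality x; exact (H 0 x).
- apply ghomS_eq; [|exact (H (S n))].
  rewrite <- Hf, <- Hg in IH.
  apply (f_equal (fun h => fmap (Celln n) (id_of_eq (eq_sym (lv_tr C n))) @@ h)) in IH.
  rewrite !cmp_assoc, <- !fmap_cmp in IH.
  assert (E : id_of_eq (eq_sym (lv_tr C n)) @@ id_of_eq (lv_tr C n) = idc _)
    by (destruct (lv_tr C n); apply cmp_idl).
  now rewrite E, fmap_id, !cmp_idl in IH.
Qed.

Definition Cptd_ob (X : gset) : icomp :=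
  {| lv n := Cptdn (tr n X); lv_tr n := eq_refl |}.

Definition Cptd_unit (X : gset) : gmap X (Cell (Cptd_ob X)).
Proof.
refine (@MkGmap X (Cell (Cptd_ob X))
  (fun n x => fmap (gtop _) (unit (adjn n) (tr n X)) (tr_in n x)) _ _);
  reflexivity.
Defined.

Lemma hom_cast_r (A : Cat) (X Y Y' : A) (e : Y = Y') (f : hom X Y) :
  hom_cast eq_refl e f = id_of_eq e @@ f.
Proof. destruct e; simpl; now rewrite cmp_idl. Qed.

Definition Cptd_transpose (X : gset) (C : icomp) (g : gmap X (Cell C)) :
  icomp_hom (Cptd_ob X) C.
Proof.
refine (@MkIcompHom (Cptd_ob X) C
  (fun n => transpose (adjn n) (Cell_tr n C @@ tr_map n g)) _).
intros n; simpl lv_tr; rewrite hom_cast_r.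
change (id_of_eq (lv_tr C n) @@ transpose (adjn n)
   ((fmap (Celln n) (id_of_eq (eq_sym (lv_tr C n))) @@ Cell_tr n C) @@ tr_map n g)
  = transpose (adjn n) (Cell_tr n C @@ tr_map n g)).
rewrite transpose_post; f_equal.
change (radj (adjn n)) with (Celln n).
rewrite !cmp_assoc, <- fmap_cmp.
assert (E : id_of_eq (lv_tr C n) @@ id_of_eq (eq_sym (lv_tr C n)) = idc _)
  by (destruct (lv_tr C n); apply cmp_idl).
now rewrite E, fmap_id, cmp_idl.
Defined.

Definition CptdAdj : Adjunction gSet iComp.
Proof.
refine (@MkAdj gSet iComp Cell (Cptd_ob : gSet -> iComp) Cptd_unit Cptd_transpose _ _).
- intros X C g; apply gmap_eq; intros n x; simpl.
  unfold top_map.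
  transitivity (fmap (gtop _)
    (fmap (Celln n) (transpose (adjn n) (Cell_tr n C @@ tr_map n g)) @@ unit (adjn n) (tr n X))
    (tr_in n x)); [now rewrite fmap_cmp|].
  etransitivity;
    [exact (f_equal (fun h => fmap (gtop _) h (tr_in n x)) (transpose_unit (adjn n) _))|].
  rewrite fmap_cmp; simpl; rewrite tr_map_in; apply Cell_tr_in.
- intros X C f; apply icomp_hom_eq; intros n.
  rewrite <- (transpose_uniq (adjn n) (f n)).
  unfold Cptd_transpose; simpl hl; f_equal; revert n.
  refine (tr_hom_ext (X := X) (C := C)
    (f := fun n => Cell_tr n C @@ tr_map n (gmap_cmp (Cell_map f) (Cptd_unit X)))
    (g := fun n => fmap (Celln n) (f n) @@ unit (adjn n) (tr n X)) _ _ _).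
  + intros n x; rewrite !fmap_cmp; simpl; rewrite tr_map_in; apply Cell_tr_in.
  + intros n.
    change (fmap (Celln n) (id_of_eq (lv_tr C n)) @@
      ((fmap (Celln n) (id_of_eq (eq_sym (lv_tr C n))) @@ Cell_tr n C) @@
         tr_map n (gmap_cmp (Cell_map f) (Cptd_unit X)))
      = Cell_tr n C @@ tr_map n (gmap_cmp (Cell_map f) (Cptd_unit X))).
    rewrite !cmp_assoc, <- fmap_cmp.
    assert (E : id_of_eq (lv_tr C n) @@ id_of_eq (eq_sym (lv_tr C n)) = idc _)
      by (destruct (lv_tr C n); apply cmp_idl).
    now rewrite E, fmap_id, cmp_idl.
  + intros n.
    change (fmap (Celln n) (id_of_eq (lv_tr C n)) @@
      (fmap (Celln n) (trc_map (f (S n))) @@ unit (adjn n) (tr n X))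
      = fmap (Celln n) (f n) @@ unit (adjn n) (tr n X)).
    rewrite cmp_assoc, <- fmap_cmp; f_equal; f_equal.
    rewrite <- (hl_tr f n); simpl lv_tr; now rewrite hom_cast_r.
Defined.

Definition add_none (n : nat) (C : iCompn n) : iCompn (S n) :=
  @MkComp n (lev n) C Empty_set Empty_set (Empty_set_rect _) (Empty_set_rect _).

Fixpoint trc_le (m n : nat) (h : leT m n) : iCompn n -> iCompn m :=
  match h in leT _ n return iCompn n -> iCompn m with
  | leT_n => fun C => C
  | leT_S h' => fun C => trc_le h' (trc C)
  end.

Fixpoint add_none_le (n m : nat) (h : leT n m) : iCompn n -> iCompn m :=
  match h in leT _ m return iCompn n -> iCompn m with
  | leT_n => fun C => C
  | leT_S h' => fun C => add_none (add_none_le h' C)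
  end.

Definition sk_lev (n : nat) (C : iCompn n) (m : nat) : iCompn m :=
  match leT_total m n with
  | inl h => trc_le h C
  | inr h => add_none_le h C
  end.

Lemma trc_le_S m n (h : leT (S m) n) (h' : leT m n) (C : iCompn n) :
  trc (trc_le h C) = trc_le h' C.
Proof.
induction h as [|n h IH].
- now rewrite (leT_irr h' (leT_S leT_n)).
- assert (h2 : leT m n) by (apply leT_of_le, PeanoNat.Nat.lt_le_incl, (leT_le h)).
  rewrite (leT_irr h' (leT_S h2)); apply IH.
Qed.

Lemma sk_lev_le n (C : iCompn n) m (h : leT m n) : sk_lev C m = trc_le h C.
Proof.
unfold sk_lev; destruct (leT_total m n) as [h'|h'].
- now rewrite (leT_irr h' h).
- assert (m = n) by (apply PeanoNat.Nat.le_antisymm; now apply leT_le).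
  subst m; now rewrite (leT_irr h' leT_n), (leT_irr h leT_n).
Qed.

Lemma sk_lev_ge n (C : iCompn n) m (h : leT n m) : sk_lev C m = add_none_le h C.
Proof.
unfold sk_lev; destruct (leT_total m n) as [h'|h'].
- assert (m = n) by (apply PeanoNat.Nat.le_antisymm; now apply leT_le).
  subst m; now rewrite (leT_irr h' leT_n), (leT_irr h leT_n).
- now rewrite (leT_irr h' h).
Qed.

Lemma sk_lev_tr n (C : iCompn n) m : trc (sk_lev C (S m)) = sk_lev C m.
Proof.
destruct (leT_total (S m) n) as [h|h].
- assert (h' : leT m n) by (apply leT_of_le, PeanoNat.Nat.lt_le_incl, (leT_le h)).
  rewrite (sk_lev_le C h), (sk_lev_le C h'); apply trc_le_S.
- destruct (leT_total m n) as [h'|h'].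
  + destruct (PeanoNat.Nat.eq_dec n (S m)) as [e|e].
    * subst n; rewrite (sk_lev_le C leT_n), (sk_lev_le C (leT_S leT_n)); reflexivity.
    * assert (e' : m = n).
      { apply PeanoNat.Nat.le_antisymm; [now apply leT_le|].
        apply le_S_n, PeanoNat.Nat.le_neq; split; [now apply leT_le | exact e]. }
      subst n; rewrite (sk_lev_ge C (leT_S leT_n)), (sk_lev_ge C leT_n); reflexivity.
  + rewrite (sk_lev_ge C (leT_S h')), (sk_lev_ge C h'); reflexivity.
Qed.

Definition sk (n : nat) (C : iCompn n) : icomp := {| lv := sk_lev C; lv_tr := sk_lev_tr C |}.

Lemma sk_lv n (C : iCompn n) : sk C n = C.
Proof. exact (sk_lev_le C leT_n). Qed.

Lemma sk_lv_trc n (C : iCompn (S n)) : sk C n = trc C.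
Proof. exact (sk_lev_le C (leT_S leT_n)). Qed.

Definition skeletal (n : nat) (C : icomp) : Prop :=
  forall m, n <= m -> (Vgen (C (S m)) -> False) /\ (Ugen (C (S m)) -> False).

Lemma sk_skeletal n (C : iCompn n) : skeletal n (sk C).
Proof.
intros m H; simpl; rewrite (sk_lev_ge C (leT_S (leT_of_le H))).
split; intros [].
Qed.

(** The morphism [C -> D] given by a morphism [f : C_n -> D_n] when [C] has no
    generators above dimension [n]: it is [f] and its truncations in dimensions
    [<= n], and the functions out of the empty sets of generators above. *)

Definition down1 (C D : icomp) (m : nat) (f : hom (C (S m)) (D (S m))) : hom (C m) (D m) :=
  hom_cast (lv_tr C m) (lv_tr D m) (trc_map f).

Definition up1 (C D : icomp) (m : nat)
  (H : (Vgen (C (S m)) -> False) /\ (Ugen (C (S m)) -> False))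
  (f : hom (C m) (D m)) : hom (C (S m)) (D (S m)) :=
  @MkChom m (lev m) (C (S m)) (D (S m))
    (hom_cast (eq_sym (lv_tr C m)) (eq_sym (lv_tr D m)) f)
    (fun v => match proj1 H v with end) (fun u => match proj2 H u with end)
    (fun v => match proj1 H v with end) (fun u => match proj2 H u with end).

Lemma hom_cast_sym (A : Cat) (X X' Y Y' : A) (e : X = X') (d : Y = Y') (f : hom X' Y') :
  hom_cast e d (hom_cast (eq_sym e) (eq_sym d) f) = f.
Proof. now destruct e, d. Qed.

Lemma down1_up1 (C D : icomp) (m : nat)
    (H : (Vgen (C (S m)) -> False) /\ (Ugen (C (S m)) -> False)) (f : hom (C m) (D m)) :
  down1 (up1 H f) = f.
Proof. apply hom_cast_sym. Qed.

Fixpoint down (C D : icomp) (m n : nat) (h : leT m n) : hom (C n) (D n) -> hom (C m) (D m) :=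
  match h in leT _ n return hom (C n) (D n) -> hom (C m) (D m) with
  | leT_n => fun f => f
  | leT_S h' => fun f => down h' (down1 f)
  end.

Fixpoint up (C D : icomp) (n : nat) (HC : skeletal n C) (m : nat) (h : leT n m) :
    hom (C n) (D n) -> hom (C m) (D m) :=
  match h in leT _ m return hom (C n) (D n) -> hom (C m) (D m) with
  | leT_n => fun f => f
  | leT_S h' => fun f => up1 (HC _ (leT_le h')) (up HC h' f)
  end.

Definition skel_ext_lev (C D : icomp) (n : nat) (HC : skeletal n C)
    (f : hom (C n) (D n)) (m : nat) : hom (C m) (D m) :=
  match leT_total m n with
  | inl h => down h f
  | inr h => up HC h f
  end.

Lemma down_S (C D : icomp) m n (h : leT (S m) n) (h' : leT m n) (f : hom (C n) (D n)) :
  down1 (down h f) = down h' f.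
Proof.
induction h as [|n h IH].
- now rewrite (leT_irr h' (leT_S leT_n)).
- assert (h2 : leT m n) by (apply leT_of_le, PeanoNat.Nat.lt_le_incl, (leT_le h)).
  rewrite (leT_irr h' (leT_S h2)); apply IH.
Qed.

Lemma skel_ext_le (C D : icomp) n (HC : skeletal n C) (f : hom (C n) (D n)) m (h : leT m n) :
  skel_ext_lev HC f m = down h f.
Proof.
unfold skel_ext_lev; destruct (leT_total m n) as [h'|h'].
- now rewrite (leT_irr h' h).
- assert (m = n) by (apply PeanoNat.Nat.le_antisymm; now apply leT_le).
  subst m; now rewrite (leT_irr h' leT_n), (leT_irr h leT_n).
Qed.

Lemma skel_ext_ge (C D : icomp) n (HC : skeletal n C) (f : hom (C n) (D n)) m (h : leT n m) :
  skel_ext_lev HC f m = up HC h f.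
Proof.
unfold skel_ext_lev; destruct (leT_total m n) as [h'|h'].
- assert (m = n) by (apply PeanoNat.Nat.le_antisymm; now apply leT_le).
  subst m; now rewrite (leT_irr h' leT_n), (leT_irr h leT_n).
- now rewrite (leT_irr h' h).
Qed.

Lemma skel_ext_tr (C D : icomp) n (HC : skeletal n C) (f : hom (C n) (D n)) m :
  down1 (skel_ext_lev HC f (S m)) = skel_ext_lev HC f m.
Proof.
destruct (leT_total (S m) n) as [h|h].
- assert (h' : leT m n) by (apply leT_of_le, PeanoNat.Nat.lt_le_incl, (leT_le h)).
  rewrite (skel_ext_le HC f h), (skel_ext_le HC f h'); apply down_S.
- destruct (leT_total m n) as [h'|h'].
  + destruct (PeanoNat.Nat.eq_dec n (S m)) as [e|e].
    * subst n; rewrite (skel_ext_le HC f leT_n), (skel_ext_le HC f (leT_S leT_n)); reflexivity.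
    * assert (e' : m = n).
      { apply PeanoNat.Nat.le_antisymm; [now apply leT_le|].
        apply le_S_n, PeanoNat.Nat.le_neq; split; [now apply leT_le | exact e]. }
      subst n; rewrite (skel_ext_ge HC f (leT_S leT_n)), (skel_ext_ge HC f leT_n).
      apply down1_up1.
  + rewrite (skel_ext_ge HC f (leT_S h')), (skel_ext_ge HC f h'); apply down1_up1.
Qed.

Definition skel_ext (C D : icomp) (n : nat) (HC : skeletal n C) (f : hom (C n) (D n)) :
    hom (C : iComp) D :=
  @MkIcompHom C D (skel_ext_lev HC f) (skel_ext_tr HC f).

Lemma skel_ext_lv (C D : icomp) (n : nat) (HC : skeletal n C) (f : hom (C n) (D n)) :
  skel_ext HC f n = f.
Proof. exact (skel_ext_le HC f leT_n). Qed.

Definition sk_map (n : nat) (C D : iCompn n) (f : hom C D) : hom (sk C : iComp) (sk D) :=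
  skel_ext (D := sk D) (sk_skeletal C) (hom_cast (eq_sym (sk_lv C)) (eq_sym (sk_lv D)) f).

(** The canonical inclusions [sk_n C_n -> sk_{n+1} C] and [sk_n C_n -> C]. *)
Definition sk_step (n : nat) (C : iCompn (S n)) : hom (sk (trc C) : iComp) (sk C) :=
  skel_ext (D := sk C) (sk_skeletal (trc C))
    (id_of_eq (eq_trans (sk_lv (trc C)) (eq_sym (sk_lv_trc C)))).

Definition sk_incl (n : nat) (C : icomp) : hom (sk (C n) : iComp) C :=
  skel_ext (D := C) (sk_skeletal (C n)) (id_of_eq (sk_lv (C n))).

(** Dimension -1: [sk_{-1}] of the unique (-1)-computad has no generators at all. *)
Definition iComp_m1 : Type := Datatypes.unit.

Definition sk_m1 (C : iComp_m1) : icomp := sk (n := 0) (Empty_set : SetC).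

Definition sk_m1_map (C : iComp_m1) (D : icomp) : hom (sk_m1 C : iComp) D :=
  skel_ext (D := D) (sk_skeletal (n := 0) (Empty_set : SetC))
    (hom_cast (A := iCompn 0) (eq_sym (sk_lv (n := 0) (Empty_set : SetC))) eq_refl
       (Empty_set_rect (fun _ => D 0 : SetC))).

(** The sequence of skeleta of a computad; index [k] stands for dimension [k - 1]. *)
Definition skeleton (C : icomp) (k : nat) : iComp :=
  match k with 0 => sk_m1 tt | S n => sk (C n) end.

Definition skeleton_step (C : icomp) (k : nat) : hom (skeleton C k) (skeleton C (S k)) :=
  match k return hom (skeleton C k) (skeleton C (S k)) with
  | 0 => sk_m1_map tt (sk (C 0))
  | S n => skel_ext (D := sk (C (S n))) (sk_skeletal (C n))
      (id_of_eq (eq_trans (sk_lv (C n))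
        (eq_trans (eq_sym (lv_tr C n)) (eq_sym (sk_lv_trc (C (S n)))))))
  end.

Definition skeleton_incl (C : icomp) (k : nat) : hom (skeleton C k) (C : iComp) :=
  match k return hom (skeleton C k) (C : iComp) with
  | 0 => sk_m1_map tt C
  | S n => sk_incl n C
  end.

(** [walk n] is [E^{n+1}] as an (n+1)-computad. *)
Definition walk (n : nat) : iCompn (S n) :=
  @MkComp n (lev n) (Cptdn (tr n (sphere n))) Empty_set Datatypes.unit
    (Empty_set_rect _)
    (fun _ => Par_map (unit (adjn n) (tr n (sphere n))) (MkPar (tr_par (sphere_zpar n)))).

Definition walking (n : nat) : icomp := sk (walk n).

Lemma sphere_skeletal n : skeletal n (Cptd_ob (sphere n)).
Proof.
intros m H; split; [|intros []].
intros [b Hb]; exact (PeanoNat.Nat.nle_succ_diag_l _ (PeanoNat.Nat.le_trans _ _ _ (le_S_n _ _ Hb) H)).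
Qed.

Definition walking_bd (n : nat) : hom (Cptd_ob (sphere n) : iComp) (walking n) :=
  skel_ext (D := walking n) (@sphere_skeletal n) (id_of_eq (eq_sym (sk_lv_trc (walk n)))).

Definition Inv_bd (n : nat) (C : iCompn (S n)) (i : Invn (S n) C) : Par (Celln n (trc C)) :=
  ibdry (L := lev n) i.

Lemma walk_map_bd (n : nat) (C : iCompn (S n)) (i : Invn (S n) C) :
  Inv_bd i = Par_map (fmap (Celln n) (transpose (adjn n) (sphere_map_n (Inv_bd i))))
    (Par_map (unit (adjn n) (tr n (sphere n))) (MkPar (tr_par (sphere_zpar n)))).
Proof.
etransitivity; [|symmetry; apply (Par_transpose (L := lev n))].
apply Par_eq; symmetry; apply (pair_map_in (Z := sphere n)).
Qed.

(** The morphism [E^{n+1} -> C] corresponding to an element of [I_{n+1}(C)]. *)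
Definition walk_map (n : nat) (C : iCompn (S n)) (i : Invn (S n) C) : hom (walk n) C :=
  @MkChom n (lev n) (walk n) C
    (transpose (adjn n) (sphere_map_n (Inv_bd i)))
    (Empty_set_rect _) (fun _ => i)
    (fun v => match v : Empty_set with end) (fun _ => walk_map_bd i).

Definition wCat : Cat := AlgC CptdAdj.
Definition F (X : gset) : wCat := freealg CptdAdj X.
Definition F_map (X Y : gset) (h : gmap X Y) : hom (F X) (F Y) :=
  freealg_map CptdAdj (X := X) (Y := Y) h.
Definition K : Functor iComp wCat := comparison CptdAdj.

(** The morphisms from [F D^n] and [F S^n] classifying a cell and a parallel pair. *)
Definition cell_cls (X : Algebra CptdAdj) (n : nat) (x : gc (car X) n) : hom (F (disk n)) X :=
  freealg_ext (J := CptdAdj) (X := disk n) (Y := X) (disk_map x).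

Definition pair_cls (X : Algebra CptdAdj) (n : nat) (x y : gc (car X) n) (H : zpar x y) :
    hom (F (sphere n)) X :=
  freealg_ext (J := CptdAdj) (X := sphere n) (Y := X) (sphere_map H).

Lemma Cell_zpar (C : icomp) (n : nat) (x y : top (C n)) :
  gpar (X := Celln n (C n)) x y -> zpar (X := Cell C) x y.
Proof.
destruct n as [|n]; [trivial|]; intros H; change (bdryn x = bdryn y) in H.
split; simpl; unfold cell_src, cell_tgt; now rewrite H.
Qed.

Definition sk_cell (n : nat) (C : iCompn n) (x : top C) : Cell (sk C) n :=
  top_cast (eq_sym (sk_lv C)) x.

Lemma sk_cell_zpar (n : nat) (C : iCompn n) (p : Par (Celln n C)) :
  zpar (sk_cell (psrc p)) (sk_cell (ptgt p)).
Proof. apply Cell_zpar, top_cast_par, ppar. Qed.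

Definition sk_pair_cls (n : nat) (C : iCompn n) (p : Par (Celln n C)) :
    hom (F (sphere n)) (K (sk C)) :=
  pair_cls (X := K (sk C)) (sk_cell_zpar p).

Definition sk_cell_cls (n : nat) (C : iCompn n) (x : top C) :
    hom (F (disk n)) (K (sk C)) :=
  cell_cls (X := K (sk C)) (sk_cell x).

Definition gen0 (C : iCompn 0) (v : (C : SetC)) : top C := v.
Definition genn (n : nat) (C : iCompn (S n)) (v : Vgen C) : top C := gen (L := lev n) v.
Definition igenn (n : nat) (C : iCompn (S n)) (u : Ugen C) : Invn (S n) C :=
  igen (L := lev n) u.
Definition phin (n : nat) (C : iCompn (S n)) (v : Vgen C) : Par (Celln n (trc C)) :=
  phi (L := lev n) v.
Definition psin (n : nat) (C : iCompn (S n)) (u : Ugen C) : Par (Celln n (trc C)) :=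
  psi (L := lev n) u.

Record Cellular (n : nat) (C : iCompn (S n)) := MkCellular {
  VS : Copower (Vgen C) (F (sphere n));
  US : Copower (Ugen C) (F (sphere n));
  VD : Copower (Vgen C) (F (disk (S n)));
  UE : Copower (Ugen C) (K (walking n));
  VSUS : Coproduct2 (cp_ob VS) (cp_ob US);
  VDUE : Coproduct2 (cp_ob VD) (cp_ob UE) }.

Definition sq_top (n : nat) (C : iCompn (S n)) (P : Cellular C) :
    hom (cp_ob (VSUS P)) (K (sk (trc C))) :=
  copair2 (VSUS P) (copair (VS P) (fun v => sk_pair_cls (phin v)))
                   (copair (US P) (fun u => sk_pair_cls (psin u))).

Definition sq_left (n : nat) (C : iCompn (S n)) (P : Cellular C) :
    hom (cp_ob (VSUS P)) (cp_ob (VDUE P)) :=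
  coproduct2_map (VSUS P) (VDUE P)
    (copower_map (VS P) (VD P) (F_map (sphere_incl n)))
    (copower_map (US P) (UE P) (fmap K (walking_bd n))).

Definition sq_right (n : nat) (C : iCompn (S n)) : hom (K (sk (trc C))) (K (sk C)) :=
  fmap K (sk_step C).

Definition sq_bottom (n : nat) (C : iCompn (S n)) (P : Cellular C) :
    hom (cp_ob (VDUE P)) (K (sk C)) :=
  copair2 (VDUE P) (copair (VD P) (fun v => sk_cell_cls (genn v)))
                   (copair (UE P) (fun u => fmap K (sk_map (walk_map (igenn u))))).

(* Main.v *)
(** As an algebra, [K C] is freely generated by the cells of [C] that are not
    coherences: the generators [gen v] and the cells [fwd i], [linv i], [rinv i] for [i]
    in the invertibility sets.  A morphism [K C -> X] is built dimension by dimension: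
    given its truncation below dimension [n + 1], its values on these cells can be any
    (n+1)-cells of [X] with the prescribed boundary, and the value on [coh f] is then
    forced, by the action of [X] on the (n+1)-cells of [T (Pos B)].

    Hence a family of morphisms [h_i : E_i -> D] that covers the generators and the
    invertibility sets of [D] is jointly epic after applying [K], and a family
    [f_i : K E_i -> X] that agrees on overlaps extends along it.  As
    [I_{m+1}(C) = U_{m+1} + I_m(C_m) + I_m(C_m)], coverings and overlaps of
    invertibility sets are decided by the invertible generators alone.  All four
    colimits are instances: the empty family, the discs of the points of [C], the
    family of [sk_n C_n], discs and walking equivalences, and the family of skeleta.
    Coproducts of algebras of the form [K E_i] are another instance, for the coproduct
    computad. *)

From Stdlib Require Import FunctionalExtensionality ProofIrrelevance IndefiniteDescription Lia.
Require Import Defs.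

Set Implicit Arguments.
Unset Strict Implicit.
Local Open Scope cat_scope.

(** * Morphisms of algebras out of a computad, one dimension at a time *)

Section LevelStep.
Variables (n : nat) (L : Lev n).
Hypothesis no_inv : forall X : gSetn n, lev_I L (ladj (lev_adj L) X) -> False.

Local Notation J := (lev_adj L).
Local Notation J' := (adjS L).
Local Notation Cell := (radj J).
Local Notation Cptd := (ladj J).

(** Passes [no_inv] on to the next level. It makes the [fwd], [linv] and [rinv] cases vacuous in
    computads on globular sets, whose cells are thus generators and coherences only. *)
Lemma inv_cptdS (X : gobS (gSetn n)) : inv (cptdS L X) -> False.
Proof. intros [[]|i|i]; exact (no_inv i). Qed.

Variables (A : Algebra J') (C : comp L).

Section Extension.
Variables (z : hom (Cell (base C)) (gbase (car A)))
  (z_act : z @@ fmap Cell (counit J (base C)) = ghbase (act A) @@ monT_map J z)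
  (gV : V C -> gnew (car A)) (gF gL gR : inv C -> gnew (car A))
  (HV : forall v, gbd (car A) (gV v) = Par_map z (phi v))
  (HF : forall i, gbd (car A) (gF i) = Par_map z (ibdry i))
  (HL : forall i, gbd (car A) (gL i) = Par_map z (Par_op (ibdry i)))
  (HR : forall i, gbd (car A) (gR i) = Par_map z (Par_op (ibdry i))).

(** [f] is the counit after the free morphism on its transpose, and [z] commutes with the actions
    along the counit. This trades an arbitrary [f] for a labelling of [X] by cells of [A]. *)
Lemma level_act_transpose (X : gSetn n) (f : hom (Cptd X) (base C)) :
  z @@ fmap Cell f = ghbase (act A) @@ fmap Cell (lmap J (z @@ fmap Cell f @@ unit J X)).
Proof.
rewrite <- cmp_assoc, lmap_cmp, fmap_cmp, cmp_assoc.
change (fmap Cell (lmap J z)) with (monT_map J z).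
rewrite <- z_act, <- cmp_assoc, <- fmap_cmp.
unfold counit; rewrite transpose_pre, cmp_idl; do 2 apply f_equal.
symmetry; apply transpose_uniq.
Qed.

Definition ext_label (X : gobS (gSetn n)) (f : hom (Cptd (gbase X)) (base C))
    (w : gnew X -> gnew (car A))
    (Hw : forall p, gbd (car A) (w p) = Par_map z (Par_map (fmap Cell f) (phi (c := cptdS L X) p))) :
  ghomS X (car A).
Proof.
refine (@MkGhomS (gSetn n) X (car A) (z @@ fmap Cell f @@ unit J (gbase X)) w _).
intros p; rewrite Hw, !Par_map_cmp; reflexivity.
Defined.

(** The boundary of a coherence only sees its labels below the top dimension, so [k] is constrained
    on its base alone; in [ext_icell] that constraint is [eq_refl]. *)
Lemma ext_coh_bd (B : tree) (HB : dim B <= S n) (P : Par (Cell (Cptd (tr n (Pos B)))))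
    (HP : lev_full P) (f : hom (Cptd (tr n (Pos B))) (base C))
    (k : ghomS (tr (S n) (Pos B)) (car A)) :
  ghbase k = z @@ fmap Cell f @@ unit J (tr n (Pos B)) ->
  gbd (car A) (ghnew (act A) (coh HB HP (lmap J' (X := tr (S n) (Pos B)) k)))
  = Par_map z (Par_map (fmap Cell f) P).
Proof.
intros E; rewrite ghbd, <- Par_map_cmp, level_act_transpose, <- E, Par_map_cmp.
reflexivity.
Qed.

(** Values are carried together with their boundary equations, since the labels of a coherence form
    a globular map [k] only when these hold. The value at a coherence is the action of [A] on the
    same coherence labelled by [k]. *)
Fixpoint ext_icell b (c : icell b) : {x : gnew (car A) | gbd (car A) x = Par_map z b} :=
  match c in icell b return {x : gnew (car A) | gbd (car A) x = Par_map z b} with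
  | icell_gen v => exist _ (gV v) (HV v)
  | icell_fwd i => exist _ (gF i) (HF i)
  | icell_linv i => exist _ (gL i) (HL i)
  | icell_rinv i => exist _ (gR i) (HR i)
  | @icell_coh _ _ _ B HB P HP f fV =>
      let k := ext_label (X := tr (S n) (Pos B)) (f := f)
          (w := fun p => proj1_sig (ext_icell (fV p)))
          (fun p => proj2_sig (ext_icell (fV p))) in
      exist _ (ghnew (act A) (coh HB HP (lmap J' (X := tr (S n) (Pos B)) k)))
        (ext_coh_bd HB HP (f := f) (k := k) eq_refl)
  end.

Definition ext_cell (c : cellS C) : gnew (car A) := proj1_sig (ext_icell (projT2 c)).

Definition ext_map : ghomS (CellS_ob C) (car A) :=
  @MkGhomS (gSetn n) (CellS_ob C) (car A) z ext_cell
    (fun c => proj2_sig (ext_icell (projT2 c))).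

Lemma ext_icell_cast b b' (e : b = b') (c : icell b) :
  proj1_sig (ext_icell (eq_rect b (@icell n L C) c b' e)) = proj1_sig (ext_icell c).
Proof. now destruct e. Qed.

(** The recursive equation in terms of morphisms: [coh] stores its labels up to a cast of
    boundaries, which [ext_icell_cast] removes. *)
Lemma ext_cell_coh (B : tree) (HB : dim B <= S n) (P : Par (Cell (Cptd (tr n (Pos B)))))
    (HP : lev_full P) (f : chom (cptdS L (tr (S n) (Pos B))) C) :
  ext_cell (coh HB HP f) = ghnew (act A) (coh HB HP (lmap J' (X := tr (S n) (Pos B))
    (ghomS_cmp ext_map (ghomS_cmp (CellS_map f) (unitS L (tr (S n) (Pos B))))))).
Proof.
apply (f_equal (fun k => ghnew (act A) (coh HB HP (lmap J' (X := tr (S n) (Pos B)) k)))).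
apply ghomS_eq.
- symmetry; apply cmp_assoc.
- intros p; simpl; apply ext_icell_cast.
Qed.

(** Associativity of the action reduces [act (coh f)], for an arbitrary [f], to the
    case where [f] sends generators to generators. *)
Lemma act_coh (B : tree) (HB : dim B <= S n) (P : Par (Cell (Cptd (tr n (Pos B)))))
    (HP : lev_full P) (f : chom (cptdS L (tr (S n) (Pos B))) (cptdS L (car A))) :
  ghnew (act A) (coh HB HP f) = ghnew (act A) (coh HB HP (lmap J' (X := tr (S n) (Pos B))
    (ghomS_cmp (act A) (ghomS_cmp (CellS_map f) (unitS L (tr (S n) (Pos B))))))).
Proof.
set (k := ghomS_cmp (CellS_map f) (unitS L (tr (S n) (Pos B)))).
transitivity (ghnew (act A @@ monT_map J' (act A))
  (coh HB HP (lmap J' (X := tr (S n) (Pos B)) (Y := CellS_ob (cptdS L (car A))) k))).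
- rewrite act_mult; simpl; f_equal.
  etransitivity; [|symmetry; apply cellS_map_coh]; f_equal.
  change (f = counit J' (cptdS L (car A)) @@ lmap J' (X := tr (S n) (Pos B)) k).
  unfold counit; rewrite transpose_pre, cmp_idl; symmetry; apply (transpose_uniq J').
- change (ghnew (act A) (cellS_map (lmap J' (act A)) (coh HB HP
    (lmap J' (X := tr (S n) (Pos B)) (Y := CellS_ob (cptdS L (car A))) k)))
   = ghnew (act A) (coh HB HP (lmap J' (X := tr (S n) (Pos B)) (ghomS_cmp (act A) k)))).
  rewrite cellS_map_coh; apply (f_equal (fun h => ghnew (act A) (coh HB HP h))); symmetry.
  exact (lmap_cmp J' (X := tr (S n) (Pos B)) (act A) k).
Qed.

(** Induction on the cells of the free computad on the cells of [C]. At a coherence, [ext_cell_coh]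
    rewrites one side and [act_coh] the other as actions on coherences, whose labels agree by the
    induction hypothesis. *)
Lemma ext_map_act :
  (ext_map : hom (CellF L C) (car A)) @@ fmap (radj J') (counit J' C)
  = act A @@ monT_map J' (ext_map : hom (radj J' C) (car A)).
Proof.
apply ghomS_eq; [exact z_act|].
apply cell_ind; [intros v | intros i | intros i | intros i | intros B HB P HP f IH].
(* A generator of the free computad is a cell [v] of [C]: the counit returns [v], and the other side
   is the action on a generator, settled by the unit law. *)
- transitivity (ext_cell v); [reflexivity|].
  exact (eq_sym (f_equal (fun k => ghnew k (ext_cell v)) (act_unit A))).
- destruct (inv_cptdS i).
- destruct (inv_cptdS i).
- destruct (inv_cptdS i).
- change (ext_cell (cellS_map (counit J' C) (coh HB HP f))
    = ghnew (act A) (cellS_map (lmap J' (ext_map : hom (radj J' C) (car A))) (coh HB HP f))).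
  rewrite !cellS_map_coh, ext_cell_coh; symmetry; rewrite act_coh; symmetry.
  apply (f_equal (fun k => ghnew (act A) (coh HB HP (lmap J' (X := tr (S n) (Pos B)) k)))).
  apply ghomS_eq; [|exact IH].
  change (z @@ (fmap Cell (counit J (base C) @@ hbase f) @@ unit J (tr n (Pos B)))
    = ghbase (act A) @@ (fmap Cell (lmap J z @@ hbase f) @@ unit J (tr n (Pos B)))).
  rewrite !fmap_cmp, !cmp_assoc, z_act; reflexivity.
Qed.

Definition level_ext : AlgHom (comparison_alg J' C) A :=
  @MkAlgHom _ _ J' (comparison_alg J' C) A ext_map ext_map_act.

End Extension.

(** [coh f] is the image under the counit of a coherence whose labels are generators naming the
    cells picked by [f]. The equation is compatibility of [z] with the actions at that coherence. *)
Lemma level_hom_coh (z : AlgHom (comparison_alg J' C) A)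
    (B : tree) (HB : dim B <= S n) (P : Par (Cell (Cptd (tr n (Pos B)))))
    (HP : lev_full P) (f : chom (cptdS L (tr (S n) (Pos B))) C) :
  ghnew (amap z) (coh HB HP f) = ghnew (act A) (coh HB HP (lmap J' (X := tr (S n) (Pos B))
    (ghomS_cmp (amap z) (ghomS_cmp (CellS_map f) (unitS L (tr (S n) (Pos B))))))).
Proof.
set (k := ghomS_cmp (CellS_map f) (unitS L (tr (S n) (Pos B)))).
pose proof (f_equal (fun h : ghomS (CellS_ob (cptdS L (CellS_ob C))) (car A) =>
  ghnew h (coh HB HP (lmap J' (X := tr (S n) (Pos B)) (Y := CellS_ob C) k))) (amap_act z)) as E.
change (ghnew (amap z) (cellS_map (counit J' C) (coh HB HP (lmap J' (X := tr (S n) (Pos B))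
  (Y := CellS_ob C) k))) = ghnew (act A) (cellS_map (lmap J' (amap z))
    (coh HB HP (lmap J' (X := tr (S n) (Pos B)) (Y := CellS_ob C) k)))) in E.
rewrite !cellS_map_coh in E.
transitivity (ghnew (amap z) (coh HB HP (chom_cmp (counit J' C)
   (lmap J' (X := tr (S n) (Pos B)) (Y := CellS_ob C) k)))).
- apply (f_equal (fun h => ghnew (amap z) (coh HB HP h))).
  change (f = counit J' C @@ lmap J' (X := tr (S n) (Pos B)) k).
  unfold counit; rewrite transpose_pre, cmp_idl; symmetry; apply (transpose_uniq J').
- etransitivity; [exact E|].
  apply (f_equal (fun h => ghnew (act A) (coh HB HP h))); symmetry.
  exact (lmap_cmp J' (X := tr (S n) (Pos B)) (amap z) k).
Qed.

(** Induction on cells: by [level_hom_coh] the value at a coherence is determined by the values at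
    its labels. *)
Lemma level_hom_uniq (z z' : AlgHom (comparison_alg J' C) A) :
  ghbase (amap z) = ghbase (amap z') ->
  (forall v, ghnew (amap z) (gen v) = ghnew (amap z') (gen v)) ->
  (forall i, ghnew (amap z) (fwd i) = ghnew (amap z') (fwd i)) ->
  (forall i, ghnew (amap z) (linv i) = ghnew (amap z') (linv i)) ->
  (forall i, ghnew (amap z) (rinv i) = ghnew (amap z') (rinv i)) ->
  z = z'.
Proof.
intros Hb HV HF HL HR; apply AlgHom_eq, ghomS_eq; [exact Hb|].
apply cell_ind; auto; intros B HB P HP f IH.
rewrite !level_hom_coh.
apply (f_equal (fun k => ghnew (act A) (coh HB HP (lmap J' (X := tr (S n) (Pos B)) k)))).
apply ghomS_eq; [|exact IH].
simpl; now rewrite Hb.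
Qed.

End LevelStep.

(** * Truncation of algebras *)

Lemma id_of_eq_symr (A : Cat) (X Y : A) (e : X = Y) :
  id_of_eq e @@ id_of_eq (eq_sym e) = idc Y.
Proof. destruct e; apply cmp_idl. Qed.

Lemma id_of_eq_syml (A : Cat) (X Y : A) (e : X = Y) :
  id_of_eq (eq_sym e) @@ id_of_eq e = idc X.
Proof. destruct e; apply cmp_idl. Qed.

Lemma hom_cast_square (A : Cat) (X X' Y Y' : A) (e : X = X') (d : Y = Y') (f : hom X Y) :
  hom_cast e d f @@ id_of_eq e = id_of_eq d @@ f.
Proof. destruct e, d; simpl; now rewrite cmp_idl, cmp_idr. Qed.

Lemma hl_square (C D : icomp) (h : icomp_hom C D) (n : nat) :
  h n @@ id_of_eq (lv_tr C n) = id_of_eq (lv_tr D n) @@ trc_map (h (S n)).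
Proof. rewrite <- (hl_tr h n); apply hom_cast_square. Qed.

Lemma top_map_id_of_eq (n : nat) (C D : iCompn n) (e : C = D) (x : top C) :
  top_map (id_of_eq e) x = top_cast e x.
Proof. destruct e; simpl; unfold top_map; now rewrite !fmap_id. Qed.

Lemma Inv_Cptdn_empty (n : nat) (X : gSetn n) : Invn n (Cptdn X) -> False.
Proof.
induction n as [|n IH]; [intros []|].
exact (inv_cptdS IH (X := X)).
Qed.

Definition tr_out (n : nat) (X : gset) : gtop _ (tr n X) -> X n :=
  match n return gtop _ (tr n X) -> X n with 0 => fun x => x | S _ => fun x => x end.
Arguments tr_out n {X} x.

Lemma tr_out_in n (X : gset) (x : X n) : tr_out n (tr_in n x) = x.
Proof. now destruct n. Qed.

(** Data for the inverse of [Cell_tr]. A level of [C] is only propositionally equal to the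
    truncation of the next, so each successor step inserts a transport. *)
Record CellUntr (C : icomp) (n : nat) := MkCellUntr {
  celluntr : hom (Celln n (C n)) (tr n (Cell C));
  celluntr_in : forall x : top (C n), fmap (gtop _) celluntr x = tr_in (X := Cell C) n x }.

Definition CellUntrS (C : icomp) (n : nat) (T : CellUntr C n) : CellUntr C (S n).
Proof.
unshelve refine (@MkCellUntr C (S n)
  (@MkGhomS (gSetn n) (Celln (S n) (C (S n))) (tr (S n) (Cell C))
    (celluntr T @@ fmap (Celln n) (id_of_eq (lv_tr C n)))
    (fun x : top (C (S n)) => x) _) _).
- intros x; rewrite Par_map_cmp; apply Par_eq; simpl; symmetry.
  + etransitivity; [exact (f_equal _ (top_map_id_of_eq (lv_tr C n) (psrc (bdryn x))))|].
    apply celluntr_in.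
  + etransitivity; [exact (f_equal _ (top_map_id_of_eq (lv_tr C n) (ptgt (bdryn x))))|].
    apply celluntr_in.
- reflexivity.
Defined.

Fixpoint CellUntr_of (C : icomp) (n : nat) : CellUntr C n :=
  match n with
  | 0 => @MkCellUntr C 0 (fun x => x) (fun x => eq_refl)
  | S m => CellUntrS (CellUntr_of C m)
  end.

Definition Cell_untr (n : nat) (C : icomp) : hom (Celln n (C n)) (tr n (Cell C)) :=
  celluntr (CellUntr_of C n).

Lemma Cell_untr_in n (C : icomp) (x : top (C n)) :
  fmap (gtop _) (Cell_untr n C) x = tr_in (X := Cell C) n x.
Proof. apply celluntr_in. Qed.

Lemma Cell_tr_untr n (C : icomp) : Cell_tr n C @@ Cell_untr n C = idc _.
Proof.
induction n as [|n IH]; [reflexivity|].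
apply ghomS_eq; [|reflexivity].
change ((fmap (Celln n) (id_of_eq (eq_sym (lv_tr C n))) @@ Cell_tr n C) @@
  (Cell_untr n C @@ fmap (Celln n) (id_of_eq (lv_tr C n))) = idc (Celln n (trc (C (S n))))).
rewrite cmp_assoc, <- (cmp_assoc _ (Cell_tr n C)), IH, cmp_idr, <- fmap_cmp, id_of_eq_syml.
apply fmap_id.
Qed.

Lemma Cell_untr_tr n (C : icomp) : Cell_untr n C @@ Cell_tr n C = idc _.
Proof.
induction n as [|n IH]; [reflexivity|].
apply ghomS_eq; [|reflexivity].
change ((Cell_untr n C @@ fmap (Celln n) (id_of_eq (lv_tr C n))) @@
  (fmap (Celln n) (id_of_eq (eq_sym (lv_tr C n))) @@ Cell_tr n C) = idc (tr n (Cell C))).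
rewrite cmp_assoc, <- (cmp_assoc (Cell_untr n C)), <- fmap_cmp, id_of_eq_symr, fmap_id, cmp_idr.
exact IH.
Qed.

Lemma Cell_untr_nat n (C D : icomp) (f : icomp_hom C D) :
  tr_map n (Cell_map f) @@ Cell_untr n C = Cell_untr n D @@ fmap (Celln n) (f n).
Proof.
induction n as [|n IH]; [reflexivity|].
apply ghomS_eq; [|reflexivity].
change (tr_map n (Cell_map f) @@ (Cell_untr n C @@ fmap (Celln n) (id_of_eq (lv_tr C n)))
  = (Cell_untr n D @@ fmap (Celln n) (id_of_eq (lv_tr D n)))
      @@ fmap (Celln n) (trc_map (f (S n)))).
rewrite cmp_assoc, IH, <- !cmp_assoc, <- !fmap_cmp; do 2 apply f_equal.
apply hl_square.
Qed.

Lemma Cell_tr_unit n (X : gset) :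
  Cell_tr n (Cptd_ob X) @@ tr_map n (Cptd_unit X) = unit (adjn n) (tr n X).
Proof.
induction n as [|n IH]; [reflexivity|].
apply ghomS_eq; [|reflexivity].
change ((fmap (Celln n) (idc _) @@ Cell_tr n (Cptd_ob X)) @@ tr_map n (Cptd_unit X)
  = unit (adjn n) (tr n X)).
now rewrite fmap_id, cmp_idl.
Qed.

(** * Restriction of maps, actions and morphisms to a level *)

Definition lvm (n : nat) (C : icomp) (X : gset) (z : gmap (Cell C) X) :
  hom (Celln n (C n)) (tr n X) := tr_map n z @@ Cell_untr n C.

Lemma lvm_top n C X (z : gmap (Cell C) X) (x : top (C n)) :
  fmap (gtop _) (lvm n z) x = tr_in n (z n x).
Proof.
unfold lvm; rewrite fmap_cmp.
etransitivity; [exact (f_equal _ (Cell_untr_in x))|]; apply tr_map_in.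
Qed.

Lemma lvm_S n C X (z : gmap (Cell C) X) :
  ghbase (lvm (S n) z) = lvm n z @@ fmap (Celln n) (id_of_eq (lv_tr C n)).
Proof. apply cmp_assoc. Qed.

Lemma lvm_inj C X (z z' : gmap (Cell C) X) : (forall n, lvm n z = lvm n z') -> z = z'.
Proof.
intros E; apply gmap_eq; intros n x.
rewrite <- (tr_out_in (z n x)), <- (tr_out_in (z' n x)).
rewrite <- !lvm_top, E; reflexivity.
Qed.

Lemma lvm_Cell_map n C D X (z : gmap (Cell D) X) (f : icomp_hom C D) :
  lvm n (gmap_cmp z (Cell_map f)) = lvm n z @@ fmap (Celln n) (f n).
Proof.
unfold lvm; rewrite <- cmp_assoc, <- Cell_untr_nat, cmp_assoc.
exact (f_equal (fun h => h @@ Cell_untr n C)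
  (fmap_cmp (trF n) (z : hom (Cell D : gSet) X) (Cell_map f))).
Qed.

Lemma counit_lv n (C : icomp) :
  counit CptdAdj C n = counit (adjn n) (C n) @@ lmap (adjn n) (Cell_tr n C).
Proof.
change (transpose (adjn n) (Cell_tr n C @@ tr_map n (gmap_id (Cell C)))
  = counit (adjn n) (C n) @@ lmap (adjn n) (Cell_tr n C)).
unfold counit; rewrite transpose_pre, cmp_idl; f_equal.
etransitivity; [exact (f_equal (cmp (Cell_tr n C)) (fmap_id (trF n) (Cell C : gSet)))|].
apply cmp_idr.
Qed.

Lemma lmap_lv n (X Y : gset) (h : gmap X Y) :
  lmap CptdAdj (X := X) (Y := Y) h n = lmap (adjn n) (tr_map n h).
Proof.
change (transpose (adjn n) (Cell_tr n (Cptd_ob Y) @@ tr_map n (gmap_cmp (Cptd_unit Y) h))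
  = transpose (adjn n) (unit (adjn n) (tr n Y) @@ tr_map n h)).
rewrite <- Cell_tr_unit, <- cmp_assoc; do 2 f_equal.
exact (fmap_cmp (trF n) (Cptd_unit Y : hom (Y : gSet) (Cell (Cptd_ob Y))) h).
Qed.

Lemma iso_swap (A : Cat) (X Y Z : A) (p : hom X Y) (q : hom Y X) (u : hom Y Z) (v : hom X Z) :
  p @@ q = idc Y -> q @@ p = idc X -> (u @@ p = v <-> u = v @@ q).
Proof.
intros E E'; split; [intros <- | intros ->]; rewrite <- cmp_assoc.
- now rewrite E, cmp_idr.
- now rewrite E', cmp_idr.
Qed.

Definition gmap_act_law (X : wCat) (C : icomp) (z : gmap (Cell C) (car X)) : Prop :=
  gmap_cmp z (Cell_map (counit CptdAdj C)) = gmap_cmp (act X) (monT_map CptdAdj (X := Cell C) z).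

Definition lv_act (n : nat) (X : wCat) :
  hom (Celln n (Cptdn (tr n (car X)))) (tr n (car X)) :=
  lvm (C := Cptd_ob (car X)) n (act X).

(** The two laws differ by the isomorphism that [Cell_tr] and [Cell_untr] induce on free computads;
    [iso_swap] moves it across. *)
Lemma lv_act_law n (X : wCat) (C : icomp) (z : gmap (Cell C) (car X)) :
  lvm n (gmap_cmp z (Cell_map (counit CptdAdj C)))
    = lvm n (gmap_cmp (act X) (monT_map CptdAdj (X := Cell C) z)) <->
  lvm n z @@ fmap (Celln n) (counit (adjn n) (C n))
    = lv_act n X @@ monT_map (adjn n) (lvm n z).
Proof.
assert (E : lvm n (gmap_cmp z (Cell_map (counit CptdAdj C)))
  = lvm n z @@ fmap (Celln n) (counit (adjn n) (C n))
      @@ fmap (Celln n) (lmap (adjn n) (Cell_tr n C))).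
{ rewrite lvm_Cell_map, counit_lv, fmap_cmp; apply cmp_assoc. }
assert (E' : lvm n (gmap_cmp (act X) (monT_map CptdAdj (X := Cell C) z))
  = lv_act n X @@ fmap (Celln n) (lmap (adjn n) (tr_map n z))).
{ etransitivity; [exact (lvm_Cell_map n (C := Cptd_ob (Cell C)) (act X)
    (lmap CptdAdj (X := Cell C) z))|].
  now rewrite lmap_lv. }
assert (E2 : lv_act n X @@ monT_map (adjn n) (lvm n z)
  = lv_act n X @@ fmap (Celln n) (lmap (adjn n) (tr_map n z))
      @@ fmap (Celln n) (lmap (adjn n) (Cell_untr n C))).
{ unfold lvm, monT_map; rewrite lmap_cmp, fmap_cmp; apply cmp_assoc. }
rewrite E, E', E2; apply iso_swap; rewrite <- fmap_cmp, <- lmap_cmp.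
- now rewrite Cell_tr_untr, lmap_id, fmap_id.
- now rewrite Cell_untr_tr, lmap_id, fmap_id.
Qed.

Lemma lv_act_S n (X : wCat) : ghbase (lv_act (S n) X) = lv_act n X.
Proof.
etransitivity; [exact (lvm_S n (C := Cptd_ob (car X)) (act X))|].
exact (eq_trans (f_equal (cmp (lv_act n X)) (fmap_id (Celln n) (Cptdn (tr n (car X)))))
  (cmp_idr (lv_act n X))).
Qed.

Definition trAlg (n : nat) (X : wCat) : Algebra (adjn n).
Proof.
refine (@MkAlg _ _ (adjn n) (tr n (car X)) (lv_act n X) _ _).
- transitivity (lvm n (C := Cptd_ob (car X)) (act X) @@
    (Cell_tr n (Cptd_ob (car X)) @@ tr_map n (Cptd_unit (car X)))).
  { now rewrite Cell_tr_unit. }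
  unfold lvm; rewrite <- cmp_assoc, (cmp_assoc (Cell_untr n (Cptd_ob (car X)))).
  rewrite Cell_untr_tr, cmp_idl.
  transitivity (tr_map n (gmap_cmp (act X) (Cptd_unit (car X)))).
  { symmetry; exact (fmap_cmp (trF n) (act X : hom (Cell (Cptd_ob (car X)) : gSet) (car X))
      (Cptd_unit (car X))). }
  etransitivity; [exact (f_equal (fun h => tr_map n h) (act_unit X))|].
  exact (fmap_id (trF n) (car X : gSet)).
(* Associativity of the action is the action law for [act X] as a map out of the cells of
   [Cptd_ob (car X)], so it truncates by [lv_act_law]. *)
- symmetry; apply (lv_act_law n (C := Cptd_ob (car X)) (act X)); f_equal.
  symmetry; exact (act_mult X).
Defined.

Definition lvhom (n : nat) (C : icomp) (X : wCat) : Type :=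
  AlgHom (comparison_alg (adjn n) (C n)) (trAlg n X).

Definition lvres (n : nat) (C : icomp) (X : wCat) (z : hom (K C) X) : lvhom n C X.
Proof.
refine (@MkAlgHom _ _ (adjn n) (comparison_alg (adjn n) (C n)) (trAlg n X)
  (lvm n (C := C) (amap z)) _).
apply lv_act_law; f_equal; exact (amap_act z).
Defined.

Definition lvhom_pre (n : nat) (C D : icomp) (X : wCat) (z : lvhom n D X)
    (h : hom (C n) (D n)) : lvhom n C X :=
  (z : hom (comparison_alg (adjn n) (D n) : AlgC (adjn n)) (trAlg n X)) @@
  fmap (comparison (adjn n)) h.

Lemma lvres_pre n (C D : icomp) (X : wCat) (z : hom (K D) X) (h : hom (C : iComp) D) :
  lvhom_pre (lvres n z) (h n) = lvres n (z @@ fmap K h).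
Proof. apply AlgHom_eq; symmetry; exact (lvm_Cell_map n (amap z) h). Qed.

Lemma lvres_inj (C : icomp) (X : wCat) (z z' : hom (K C) X) :
  (forall n, lvres n z = lvres n z') -> z = z'.
Proof.
intros H; apply AlgHom_eq, lvm_inj; intros n.
exact (f_equal (fun h : lvhom n C X => amap h) (H n)).
Qed.

Definition lvext (n : nat) (C : icomp) (X : wCat) (z : lvhom n C X) (z' : lvhom (S n) C X) :
  Prop := ghbase (amap z') = amap z @@ fmap (Celln n) (id_of_eq (lv_tr C n)).

Lemma lvres_S n (C : icomp) (X : wCat) (z : hom (K C) X) : lvext (lvres n z) (lvres (S n) z).
Proof. apply lvm_S. Qed.

(** Each cell is evaluated at the level of its own dimension. The hypothesis makes boundaries agree
    between consecutive levels, and the action law is checked level by level. *)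
Lemma lvhom_glue (C : icomp) (X : wCat) (z : forall n, lvhom n C X) :
  (forall n, lvext (z n) (z (S n))) -> exists z' : hom (K C) X, forall n, lvres n z' = z n.
Proof.
intros H.
assert (Hbd : forall n (x : top (C (S n))),
  tr_bd (X := car X) (tr_out (S n) (fmap (gtop _) (amap (z (S n))) x))
  = Par_map (amap (z n) @@ fmap (Celln n) (id_of_eq (lv_tr C n))) (bdryn x)).
{ intros n x; rewrite <- (H n); exact (ghbd (amap (z (S n))) x). }
unshelve epose (g := @MkGmap (Cell C) (car X)
  (fun n x => tr_out n (fmap (gtop _) (amap (z n)) x)) _ _).
- intros n x; refine (eq_trans (eq_sym (tr_out_in _)) _); apply (f_equal (tr_out n)).
  etransitivity; [exact (f_equal (@psrc _ _) (Hbd n x))|].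
  simpl; rewrite fmap_cmp; simpl; apply f_equal.
  exact (top_map_id_of_eq (lv_tr C n) (psrc (bdryn x))).
- intros n x; refine (eq_trans (eq_sym (tr_out_in _)) _); apply (f_equal (tr_out n)).
  etransitivity; [exact (f_equal (@ptgt _ _) (Hbd n x))|].
  simpl; rewrite fmap_cmp; simpl; apply f_equal.
  exact (top_map_id_of_eq (lv_tr C n) (ptgt (bdryn x))).
- assert (E : forall n, lvm n g = amap (z n)).
  { induction n as [|n IH]; [reflexivity|]; apply ghomS_eq.
    - rewrite lvm_S, IH; symmetry; apply H.
    - reflexivity. }
  assert (Hg : gmap_act_law g).
  { apply lvm_inj; intros n; apply lv_act_law; rewrite E; exact (amap_act (z n)). }
  exists (@MkAlgHom _ _ CptdAdj (K C) X g Hg); intros n; apply AlgHom_eq, E.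
Qed.

(** * Gluing *)

(** Dependent choice along the tower of levels, [P] being the invariant of the partial morphisms. *)
Lemma lvhom_limit (C : icomp) (X : wCat) (P : forall n, lvhom n C X -> Prop) :
  (exists z, P 0 z) ->
  (forall n z, P n z -> exists z', P (S n) z' /\ lvext z z') ->
  exists z : hom (K C) X, forall n, P n (lvres n z).
Proof.
intros H0 HS.
set (step := fun n (s : {z | P n z}) =>
  constructive_indefinite_description _ (HS n _ (proj2_sig s))).
set (s := nat_rect (fun n => {z | P n z}) (constructive_indefinite_description _ H0)
  (fun n s => exist (P (S n)) (proj1_sig (step n s)) (proj1 (proj2_sig (step n s))))).
destruct (lvhom_glue (z := fun n => proj1_sig (s n))) as [z Hz].
- intros n; exact (proj2 (proj2_sig (step n (s n)))).
- exists z; intros n; rewrite Hz; apply proj2_sig.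
Qed.

Definition isgen (n : nat) : forall C : iCompn n, top C -> Prop :=
  match n with
  | 0 => fun _ _ => True
  | S m => fun C c => exists v : Vgen C, c = genn v
  end.

Definition fwdn (n : nat) (C : iCompn n) (j : Invn n C) : top C := lev_fwd (l := lev n) j.
Definition linvn (n : nat) (C : iCompn n) (j : Invn n C) : top C := lev_linv (l := lev n) j.
Definition rinvn (n : nat) (C : iCompn n) (j : Invn n C) : top C := lev_rinv (l := lev n) j.

(** A generator of [E_i] need not be sent to a generator of [D].  The values on
    generators of [D] are read off the designated cells [des]; a generator that is not
    designated must have the same image as some cell of a member of the family all of
    whose generators are designated. *)
Section Glue.
Variables (I : Type) (D : icomp) (E : I -> icomp) (h : forall i, hom (E i : iComp) D)
  (X : wCat) (f : forall i, hom (K (E i)) X)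
  (des : forall i n, top (E i n) -> Prop).

Definition glue_val (i : I) (n : nat) (a : top (E i n)) : car X n := amap (f i) n a.
Local Notation val := glue_val.
Local Notation "'im' a" := (top_map (h _ _) a) (at level 10, a at level 8).

Definition glue_full (i : I) : Prop :=
  forall n (a : top (E i n)), isgen a -> des a /\ isgen (im a).

Hypothesis gen_surj : forall n (w : top (D n)), isgen w -> exists i a,
  des (i := i) a /\ im a = w.
Hypothesis gen_compat : forall n i i' (a : top (E i n)) (a' : top (E i' n)),
  des a -> des a' -> im a = im a' -> val a = val a'.
Hypothesis gen_cases : forall n i (a : top (E i n)), isgen a ->
  (des a /\ isgen (im a)) \/
  exists i0 (c : top (E i0 n)), glue_full i0 /\ im a = im c /\ val a = val c.
Hypothesis inv_surj : forall n (j : Invn n (D n)), exists i (j' : Invn n (E i n)),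
  fmap (Invn n) (h i n) j' = j.
Hypothesis inv_compat : forall n i i' (j : Invn n (E i n)) (j' : Invn n (E i' n)),
  fmap (Invn n) (h i n) j = fmap (Invn n) (h i' n) j' ->
  val (fwdn j) = val (fwdn j') /\ val (linvn j) = val (linvn j') /\
  val (rinvn j) = val (rinvn j').

Definition glue_at (n : nat) (z : lvhom n D X) : Prop :=
  forall i, lvhom_pre z (h i n) = lvres n (f i).

Lemma gen_choice n : exists s : {w : top (D n) | isgen w} -> {i : I & top (E i n)},
  forall w, des (projT2 (s w)) /\ im (projT2 (s w)) = proj1_sig w.
Proof.
apply (functional_choice (fun w (s : {i : I & top (E i n)}) =>
  des (projT2 s) /\ im (projT2 s) = proj1_sig w)).
intros [w Hw]; destruct (gen_surj Hw) as (i & a & H); now exists (existT _ i a).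
Qed.

Lemma inv_choice n : exists s : Invn n (D n) -> {i : I & Invn n (E i n)},
  forall j, fmap (Invn n) (h _ n) (projT2 (s j)) = j.
Proof.
apply (functional_choice (fun j (s : {i : I & Invn n (E i n)}) =>
  fmap (Invn n) (h _ n) (projT2 s) = j)).
intros j; destruct (inv_surj j) as (i & j' & H); now exists (existT _ i j').
Qed.

(** Agreement spreads in three rounds: designated cells over generators agree by [gen_compat]; full
    members then agree on all their cells; any other generator shares its image and value with a
    cell of a full member, so every member agrees. *)
Lemma glue_gens n (z : top (D n) -> car X n) :
  (forall w, isgen w -> exists i (a : top (E i n)), des a /\ im a = w /\ z w = val a) ->
  (forall i, (forall a : top (E i n), isgen a -> z (im a) = val a) ->
     forall a : top (E i n), z (im a) = val a) ->
  forall i (a : top (E i n)), z (im a) = val a.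
Proof.
intros Hz Hext.
assert (Hdes : forall i (a : top (E i n)), des a -> isgen (im a) -> z (im a) = val a).
{ intros i a Ha Hi; destruct (Hz _ Hi) as (i' & a' & Ha' & Ei & ->).
  now apply gen_compat. }
assert (Hfull : forall i, glue_full i -> forall a : top (E i n), z (im a) = val a).
{ intros i Hi; apply Hext; intros a Ha; now apply Hdes; apply Hi. }
intros i; apply Hext; intros a Ha.
destruct (gen_cases Ha) as [[H1 H2] | (i0 & c & H1 & -> & ->)]; auto.
Qed.

Lemma glue_base : exists z, glue_at (n := 0) z.
Proof.
destruct (gen_choice 0) as [s Hs].
set (z := fun w : top (D 0) => val (projT2 (s (exist _ w Logic.I : {w : top (D 0) | isgen w})))).
(* The unit in dimension 0 is the identity, so by the unit law the action is too, and every function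
   on 0-cells is a morphism. *)
assert (act0 : lv_act 0 X = fun x => x) by exact (act_unit (trAlg 0 X)).
unshelve refine (ex_intro _
  (@MkAlgHom _ _ (adjn 0) (comparison_alg (adjn 0) (D 0)) (trAlg 0 X) z _) _).
- simpl; rewrite act0; reflexivity.
- intros i; apply AlgHom_eq; extensionality a; revert i a.
  refine (glue_gens (n := 0) (z := z) _ _).
  + intros w Hw; destruct (Hs (exist _ w Logic.I)) as [H1 H2].
    exact (ex_intro _ _ (ex_intro _ _ (conj H1 (conj H2 eq_refl)))).
  + intros i Hi a; exact (Hi a Logic.I).
Qed.

Section GlueStep.
Variables (n : nat) (z : lvhom n D X).
Hypothesis Hz : glue_at z.

Definition step_base : hom (Celln n (trc (D (S n)))) (tr n (car X)) :=
  amap z @@ fmap (Celln n) (id_of_eq (lv_tr D n)).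

Lemma step_base_act :
  step_base @@ fmap (Celln n) (counit (adjn n) (trc (D (S n))))
  = ghbase (lv_act (S n) X) @@ monT_map (adjn n) step_base.
Proof.
rewrite lv_act_S.
exact (amap_act ((z : hom (comparison_alg (adjn n) (D n) : AlgC (adjn n)) (trAlg n X))
  @@ fmap (comparison (adjn n)) (id_of_eq (lv_tr D n)))).
Qed.

Lemma step_base_pre i :
  ghbase (lvm (S n) (amap (f i))) = step_base @@ fmap (Celln n) (trc_map (h i (S n))).
Proof.
rewrite lvm_S; unfold step_base.
transitivity (amap z @@ fmap (Celln n) (h i n @@ id_of_eq (lv_tr (E i) n))).
- rewrite fmap_cmp; etransitivity; [|symmetry; apply cmp_assoc].
  apply (f_equal (fun y => y @@ fmap (Celln n) (id_of_eq (lv_tr (E i) n)))).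
  symmetry; exact (f_equal (fun y : lvhom n (E i) X => amap y) (Hz i)).
- rewrite hl_square, fmap_cmp; apply cmp_assoc.
Qed.

(** The boundary of a value depends only on the image in [D]. Hence values read off chosen preimages
    satisfy the boundary conditions of [level_ext]. *)
Lemma step_bd i (a : top (E i (S n))) :
  tr_bd (val a) = Par_map step_base (bdryn (im a)).
Proof.
transitivity (Par_map (ghbase (lvm (S n) (amap (f i)))) (bdryn a)).
{ exact (ghbd (lvm (S n) (amap (f i))) a). }
rewrite step_base_pre, Par_map_cmp; apply f_equal; symmetry.
exact (ghbd (fmap (Celln (S n)) (h i (S n))) a).
Qed.

Lemma glue_step : exists z' : lvhom (S n) D X, glue_at z' /\ lvext z z'.
Proof.
destruct (gen_choice (S n)) as [s Hs], (inv_choice (S n)) as [t Ht].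
set (wgen := fun v : Vgen (D (S n)) =>
  exist (@isgen (S n) (D (S n))) (genn v) (ex_intro _ v eq_refl)).
set (gV := fun v => val (projT2 (s (wgen v)))).
set (gF := fun j => val (fwdn (projT2 (t j)))).
set (gL := fun j => val (linvn (projT2 (t j)))).
set (gR := fun j => val (rinvn (projT2 (t j)))).
unshelve epose (z' := @level_ext n (lev n) (@Inv_Cptdn_empty n) (trAlg (S n) X) (D (S n))
  step_base step_base_act gV gF gL gR _ _ _ _).
- intros v; etransitivity; [apply step_bd|].
  now rewrite (proj2 (Hs (wgen v))).
- intros j; etransitivity; [apply step_bd|]; apply f_equal.
  exact (f_equal (@ibdry n (lev n) (D (S n))) (Ht j)).
- intros j; etransitivity; [apply step_bd|]; apply f_equal.
  exact (f_equal (fun j => Par_op (@ibdry n (lev n) (D (S n)) j)) (Ht j)).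
- intros j; etransitivity; [apply step_bd|]; apply f_equal.
  exact (f_equal (fun j => Par_op (@ibdry n (lev n) (D (S n)) j)) (Ht j)).
- exists z'; split; [|reflexivity].
  (* [t] may choose a preimage of the image of [j] other than [j]; [inv_compat] makes the choice
     harmless. *)
  assert (HI : forall i (j : Invn (S n) (E i (S n))),
    ghnew (amap z') (im (fwdn j)) = val (fwdn j) /\
    ghnew (amap z') (im (linvn j)) = val (linvn j) /\
    ghnew (amap z') (im (rinvn j)) = val (rinvn j)).
  { intros i j; apply (inv_compat (Ht (fmap (Invn (S n)) (h i (S n)) j))). }
  assert (Hbase : forall i, ghbase (amap (lvhom_pre (z' : lvhom (S n) D X) (h i (S n))))
    = ghbase (amap (lvres (S n) (f i)))).
  { intros i; symmetry; apply step_base_pre. }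
  assert (Hcells : forall i (a : top (E i (S n))), ghnew (amap z') (im a) = val a).
  { refine (glue_gens (n := S n) (z := ghnew (amap z')) _ _).
    - intros w Hw; destruct Hw as [v ->]; destruct (Hs (wgen v)) as [H1 H2].
      exact (ex_intro _ _ (ex_intro _ _ (conj H1 (conj H2 eq_refl)))).
    - intros i Hi a.
      (* Agreement on generators, together with [HI], spreads to all cells of a member by uniqueness
         at one level. *)
      refine (f_equal (fun y : lvhom (S n) (E i) X => ghnew (amap y) a) (_ :
        lvhom_pre (z' : lvhom (S n) D X) (h i (S n)) = lvres (S n) (f i))).
      apply level_hom_uniq.
      + apply Hbase.
      + intros v; exact (Hi _ (ex_intro _ v eq_refl)).
      + intros j; apply HI.
      + intros j; apply HI.
      + intros j; apply HI. }
  intros i; apply AlgHom_eq, ghomS_eq; [apply Hbase | apply Hcells].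
Qed.

End GlueStep.

Lemma glue_exists : exists z : hom (K D) X, forall i, z @@ fmap K (h i) = f i.
Proof.
destruct (lvhom_limit glue_base glue_step) as [z Hz].
exists z; intros i; apply lvres_inj; intros n.
rewrite <- lvres_pre; apply Hz.
Qed.

End Glue.

(** Induction on the dimension: the two morphisms agree on the image of every [h i], and these
    images contain all the cells to which [level_hom_uniq] reduces equality. *)
Lemma glue_uniq (I : Type) (D : icomp) (E : I -> icomp) (h : forall i, hom (E i : iComp) D)
    (X : wCat) (z z' : hom (K D) X) :
  (forall n (w : top (D n)), isgen w -> exists i (a : top (E i n)), top_map (h i n) a = w) ->
  (forall n (j : Invn n (D n)), exists i (j' : Invn n (E i n)),
     fmap (Invn n) (h i n) j' = j) ->
  (forall i, z @@ fmap K (h i) = z' @@ fmap K (h i)) -> z = z'.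
Proof.
intros HV HI H.
assert (Hcell : forall i n (a : top (E i n)),
  amap z n (top_map (h i n) a) = amap z' n (top_map (h i n) a)).
{ intros i n a; exact (f_equal (fun y : hom (K (E i)) X => amap y n a) (H i)). }
apply lvres_inj; induction n as [|n IH].
- apply AlgHom_eq; extensionality a.
  destruct (HV 0 a Logic.I) as (i & b & <-); apply Hcell.
- apply level_hom_uniq.
  + etransitivity; [apply (lvres_S n z)|].
    etransitivity; [|symmetry; apply (lvres_S n z')].
    now rewrite IH.
  + intros v; destruct (HV (S n) (genn v)) as (i & b & e); [now exists v|].
    change (amap z (S n) (genn v) = amap z' (S n) (genn v)).
    rewrite <- e; apply Hcell.
  + intros j; destruct (HI (S n) j) as (i & j' & <-).
    exact (Hcell i (S n) (fwdn j')).
  + intros j; destruct (HI (S n) j) as (i & j' & <-).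
    exact (Hcell i (S n) (linvn j')).
  + intros j; destruct (HI (S n) j) as (i & j' & <-).
    exact (Hcell i (S n) (rinvn j')).
Qed.

(** * Generators and invertibility sets *)

Definition isigen (n : nat) : forall C : iCompn n, Invn n C -> Prop :=
  match n with
  | 0 => fun _ _ => False
  | S m => fun C j => exists u : Ugen C, j = igenn u
  end.

(** Skeleta at different levels are related by equalities of computads only, so the
    components of the canonical inclusions are transports along equalities. *)
Definition is_lvid (n : nat) (C D : iCompn n) (g : hom C D) : Prop :=
  exists e : C = D, g = id_of_eq e.

Section Lvid.
Variables (n : nat) (C D : iCompn n) (g : hom C D).
Hypothesis Hg : is_lvid g.

Lemma lvid_isgen (a : top C) : isgen (top_map g a) <-> isgen a.
Proof.
destruct Hg as [e ->]; rewrite top_map_id_of_eq; destruct e; reflexivity.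
Qed.

Lemma lvid_top_surj (b : top D) : exists a, top_map g a = b.
Proof.
destruct Hg as [e ->]; destruct e; exists b; apply (top_map_id_of_eq eq_refl).
Qed.

Lemma lvid_top_inj (a a' : top C) : top_map g a = top_map g a' -> a = a'.
Proof.
destruct Hg as [e ->]; rewrite !top_map_id_of_eq; destruct e; auto.
Qed.

Lemma lvid_isigen (j : Invn n C) : isigen (fmap (Invn n) g j) <-> isigen j.
Proof.
destruct Hg as [e ->]; destruct e; simpl id_of_eq; rewrite fmap_id; reflexivity.
Qed.

Lemma lvid_inv_surj (j : Invn n D) : exists j', fmap (Invn n) g j' = j.
Proof.
destruct Hg as [e ->]; destruct e; exists j; simpl id_of_eq; now rewrite fmap_id.
Qed.

Lemma lvid_inv_inj (j j' : Invn n C) :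
  fmap (Invn n) g j = fmap (Invn n) g j' -> j = j'.
Proof.
destruct Hg as [e ->]; destruct e; simpl id_of_eq; now rewrite fmap_id.
Qed.

Lemma lvid_eq (g' : hom C D) : is_lvid g' -> g = g'.
Proof.
intros [e' ->]; destruct Hg as [e ->]; now rewrite (proof_irrelevance _ e e').
Qed.

Lemma lvid_cmp (E : iCompn n) (g' : hom D E) : is_lvid g' -> is_lvid (g' @@ g).
Proof.
intros [e' ->]; destruct Hg as [e ->]; destruct e, e'; exists eq_refl; apply cmp_idl.
Qed.

End Lvid.

Lemma lvid_trc (n : nat) (C D : iCompn (S n)) (g : hom C D) (P Q : iCompn n)
    (p : trc C = P) (q : trc D = Q) : is_lvid g -> is_lvid (hom_cast p q (trc_map g)).
Proof. intros [e ->]; destruct e, p, q; now exists eq_refl. Qed.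

Lemma lvid_le (C D : icomp) (h : icomp_hom C D) (m n : nat) :
  m <= n -> is_lvid (h n) -> is_lvid (h m).
Proof.
induction 1 as [|n _ IH]; [auto|]; intros H; apply IH.
rewrite <- hl_tr; now apply lvid_trc.
Qed.

Lemma skel_ext_lvid (C D : icomp) (n : nat) (HC : skeletal n C) (e : C n = D n) m :
  m <= n -> is_lvid (skel_ext HC (id_of_eq e) m).
Proof. intros H; apply (lvid_le H); rewrite skel_ext_lv; now exists e. Qed.

Lemma skeletal_isgen (C : icomp) (n m : nat) (a : top (C m)) :
  skeletal n C -> isgen a -> m <= n.
Proof.
intros HC Ha; destruct (PeanoNat.Nat.le_gt_cases m n) as [H|H]; [exact H|].
destruct m as [|m]; [destruct (PeanoNat.Nat.nlt_0_r _ H)|]; destruct Ha as [v _].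
destruct (proj1 (HC m (le_S_n _ _ H)) v).
Qed.

Lemma skeletal_isigen (C : icomp) (n m : nat) (j : Invn m (C m)) :
  skeletal n C -> isigen j -> m <= n.
Proof.
intros HC Hj; destruct (PeanoNat.Nat.le_gt_cases m n) as [H|H]; [exact H|].
destruct m as [|m]; [destruct (PeanoNat.Nat.nlt_0_r _ H)|]; destruct Hj as [u _].
destruct (proj2 (HC m (le_S_n _ _ H)) u).
Qed.

Lemma hl_trc (C D : icomp) (h : icomp_hom C D) (n : nat) :
  trc_map (h (S n)) = hom_cast (eq_sym (lv_tr C n)) (eq_sym (lv_tr D n)) (h n).
Proof. rewrite <- (hl_tr h n); now destruct (lv_tr C n), (lv_tr D n). Qed.

(** Below [n] the components are truncations of the one at [n]; above [n] there are no generators on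
    which to differ. *)
Lemma skeletal_hom_eq (C D : icomp) (n : nat) (f g : icomp_hom C D) :
  skeletal n C -> f n = g n -> f = g.
Proof.
intros HC E; apply icomp_hom_eq.
assert (Hup : forall m, n <= m -> f m = g m).
{ induction 1 as [|m H IH]; [exact E|]; destruct (HC m H) as [HV HU].
  apply chom_eq; [|intros v; destruct (HV v) | intros u; destruct (HU u)].
  change (trc_map (f (S m)) = trc_map (g (S m))); now rewrite !hl_trc, IH. }
assert (Hdown : forall m k, m <= k -> f k = g k -> f m = g m).
{ induction 1 as [|k _ IH]; [auto|]; intros e; apply IH.
  now rewrite <- (hl_tr f), <- (hl_tr g), e. }
intros m; destruct (PeanoNat.Nat.le_ge_cases n m) as [H|H]; [now apply Hup|].
exact (Hdown m n H E).
Qed.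

(** * Coverings and overlaps of invertibility sets *)

Definition invc (C : icomp) (n : nat) : Invn n (trc (C (S n))) -> Invn n (C n) :=
  fmap (Invn n) (id_of_eq (lv_tr C n)).

Definition invc_inv (C : icomp) (n : nat) : Invn n (C n) -> Invn n (trc (C (S n))) :=
  fmap (Invn n) (id_of_eq (eq_sym (lv_tr C n))).

Lemma invcK C n j : invc_inv (invc (C := C) (n := n) j) = j.
Proof.
transitivity (fmap (Invn n) (id_of_eq (eq_sym (lv_tr C n)) @@ id_of_eq (lv_tr C n)) j).
- now rewrite fmap_cmp.
- now rewrite id_of_eq_syml, fmap_id.
Qed.

Lemma invc_invK C n j : invc (invc_inv (C := C) (n := n) j) = j.
Proof.
transitivity (fmap (Invn n) (id_of_eq (lv_tr C n) @@ id_of_eq (eq_sym (lv_tr C n))) j).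
- now rewrite fmap_cmp.
- now rewrite id_of_eq_symr, fmap_id.
Qed.

Lemma invc_nat (C D : icomp) (h : icomp_hom C D) n (j : Invn n (trc (C (S n)))) :
  fmap (Invn n) (h n) (invc j) = invc (fmap (Invn n) (trc_map (h (S n))) j).
Proof.
transitivity (fmap (Invn n) (h n @@ id_of_eq (lv_tr C n)) j).
- now rewrite fmap_cmp.
- now rewrite hl_square, fmap_cmp.
Qed.

Section InvFamily.
Variables (I : Type) (D : icomp) (E : I -> icomp) (h : forall i, icomp_hom (E i) D).

(** Induction on [n]: an element [lunit] or [runit] is covered because the element below it is. *)
Lemma inv_family_surj :
  (forall n (j : Invn n (D n)), isigen j ->
     exists i (j' : Invn n (E i n)), fmap (Invn n) (h i n) j' = j) ->
  forall n (j : Invn n (D n)), exists i (j' : Invn n (E i n)), fmap (Invn n) (h i n) j' = j.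
Proof.
intros H; induction n as [|n IH]; intros j; [destruct j|].
assert (Hu : forall j0 : Invn n (trc (D (S n))), exists i (j' : Invn n (trc (E i (S n)))),
  fmap (Invn n) (trc_map (h i (S n))) j' = j0).
{ intros j0; destruct (IH (invc j0)) as (i & j' & e); exists i, (invc_inv j').
  rewrite <- (invcK (fmap (Invn n) (trc_map (h i (S n))) (invc_inv j'))).
  now rewrite <- invc_nat, invc_invK, e, invcK. }
destruct j as [u|j0|j0].
- apply H; now exists u.
- destruct (Hu j0) as (i & j' & e); exists i, (lunit (L := lev n) (C := E i (S n)) j').
  exact (f_equal (lunit (L := lev n) (C := D (S n))) e).
- destruct (Hu j0) as (i & j' & e); exists i, (runit (L := lev n) (C := E i (S n)) j').
  exact (f_equal (runit (L := lev n) (C := D (S n))) e).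
Qed.

(** Equality is taken in the total space because the two elements may lie in different members. The
    first hypothesis keeps an invertible generator from colliding with a [lunit] or [runit]. *)
Lemma inv_family_inj :
  (forall n i (j : Invn n (E i n)), isigen j -> isigen (fmap (Invn n) (h i n) j)) ->
  (forall n i i' (j : Invn n (E i n)) (j' : Invn n (E i' n)), isigen j -> isigen j' ->
     fmap (Invn n) (h i n) j = fmap (Invn n) (h i' n) j' ->
     existT (fun i => fob (Invn n) (E i n)) i j = existT _ i' j') ->
  forall n i i' (j : Invn n (E i n)) (j' : Invn n (E i' n)),
     fmap (Invn n) (h i n) j = fmap (Invn n) (h i' n) j' ->
     existT (fun i => fob (Invn n) (E i n)) i j = existT _ i' j'.
Proof.
intros Higen H; induction n as [|n IH]; intros i i' j j' e; [destruct j|].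
assert (Hu : forall (j0 : Invn n (trc (E i (S n)))) (j0' : Invn n (trc (E i' (S n)))),
  fmap (Invn n) (trc_map (h i (S n))) j0 = fmap (Invn n) (trc_map (h i' (S n))) j0' ->
  existT (fun i => fob (Invn n) (trc (E i (S n)))) i j0 = existT _ i' j0').
{ intros j0 j0' e0.
  assert (E0 := IH i i' (invc j0) (invc j0')); rewrite !invc_nat, e0 in E0.
  apply (f_equal (fun s => existT (fun i => fob (Invn n) (trc (E i (S n)))) (projT1 s)
    (invc_inv (projT2 s)))) in E0; [|reflexivity].
  simpl in E0; now rewrite !invcK in E0. }
assert (Hg := Higen (S n)).
destruct j as [u|j0|j0], j' as [u'|j0'|j0'].
- apply H; [now exists u | now exists u' | exact e].
- destruct (Hg i (igenn u) (ex_intro _ u eq_refl)) as [u0 e0].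
  assert (e1 := eq_trans (eq_sym e0) e); discriminate e1.
- destruct (Hg i (igenn u) (ex_intro _ u eq_refl)) as [u0 e0].
  assert (e1 := eq_trans (eq_sym e0) e); discriminate e1.
- destruct (Hg i' (igenn u') (ex_intro _ u' eq_refl)) as [u0 e0].
  assert (e1 := eq_trans e e0); discriminate e1.
- injection e as e.
  exact (f_equal (fun s => existT (fun i => fob (Invn (S n)) (E i (S n))) (projT1 s)
    (lunit (L := lev n) (C := E (projT1 s) (S n)) (projT2 s))) (Hu _ _ e)).
- discriminate e.
- destruct (Hg i' (igenn u') (ex_intro _ u' eq_refl)) as [u0 e0].
  assert (e1 := eq_trans e e0); discriminate e1.
- discriminate e.
- injection e as e.
  exact (f_equal (fun s => existT (fun i => fob (Invn (S n)) (E i (S n))) (projT1 s)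
    (runit (L := lev n) (C := E (projT1 s) (S n)) (projT2 s))) (Hu _ _ e)).
Qed.

End InvFamily.

(** * Coproducts of computads *)

Lemma genn_inj (n : nat) (C : iCompn (S n)) (v v' : Vgen C) : genn v = genn v' -> v = v'.
Proof.
intros e.
apply (f_equal (fun c : cellS C => match projT2 c with icell_gen v => Some v | _ => None end)) in e.
now injection e.
Qed.

Lemma igenn_inj (n : nat) (C : iCompn (S n)) (u u' : Ugen C) : igenn u = igenn u' -> u = u'.
Proof. intros e; now injection e. Qed.

Section CopLevel.
Variable I : Type.

(** Only the object and the injections are recorded; the universal property is established after
    applying [K], in [K_cop]. *)
Record Cop (n : nat) (F : I -> iCompn n) := MkCop {
  cop_ob : iCompn n;
  cop_in : forall i, hom (F i) cop_ob }.

Definition Cop0 (F : I -> iCompn 0) : Cop (n := 0) F :=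
  @MkCop 0 F {i : I & (F i : SetC)} (fun i (x : (F i : SetC)) => existT (fun i => (F i : SetC) : Type) i x).

Definition CopS (n : nat) (F : I -> iCompn (S n)) (T : Cop (fun i => trc (F i))) :
  Cop (n := S n) F.
Proof.
set (C := @MkComp n (lev n) (cop_ob T) {i : I & Vgen (F i)} {i : I & Ugen (F i)}
  (fun s => Par_map (fmap (Celln n) (cop_in T (projT1 s))) (phin (projT2 s)))
  (fun s => Par_map (fmap (Celln n) (cop_in T (projT1 s))) (psin (projT2 s)))).
exact (@MkCop (S n) F C (fun i => @MkChom n (lev n) (F i) C (cop_in T i)
  (fun v => gen (L := lev n) (C := C) (existT _ i v))
  (fun u => igen (L := lev n) (C := C) (existT _ i u))
  (fun v => eq_refl) (fun u => eq_refl))).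
Defined.

Fixpoint Cop_of (n : nat) : forall F : I -> iCompn n, Cop F :=
  match n with
  | 0 => Cop0
  | S m => fun F => CopS (Cop_of (n := m) (fun i => trc (F i)))
  end.

Variables (n : nat) (F : I -> iCompn n).
Local Notation inj i := (cop_in (Cop_of F) i).

Lemma cop_isgen i (a : top (F i)) : isgen a -> isgen (top_map (inj i) a).
Proof.
destruct n as [|m]; [trivial|]; intros [v ->].
now exists (existT (fun i => Vgen (F i)) i v).
Qed.

Lemma cop_gen_surj (w : top (cop_ob (Cop_of F))) : isgen w ->
  exists i a, isgen a /\ top_map (inj i) a = w.
Proof.
destruct n as [|m].
- intros _; destruct w as [i a]; now exists i, a.
- intros [[i v] ->]; exists i, (genn v); split; [now exists v | reflexivity].
Qed.

Lemma cop_gen_inj i i' (a : top (F i)) (a' : top (F i')) : isgen a -> isgen a' ->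
  top_map (inj i) a = top_map (inj i') a' ->
  existT (fun i => top (F i)) i a = existT _ i' a'.
Proof.
destruct n as [|m].
- intros _ _ e; exact e.
- intros [v ->] [v' ->] e.
  apply (genn_inj (C := cop_ob (Cop_of F))) in e.
  exact (f_equal (fun s : {i : I & Vgen (F i)} => existT (fun i => top (F i)) (projT1 s) (genn (projT2 s))) e).
Qed.

Lemma cop_isigen i (j : Invn n (F i)) : isigen j -> isigen (fmap (Invn n) (inj i) j).
Proof.
destruct n as [|m]; [trivial|]; intros [u ->].
now exists (existT (fun i => Ugen (F i)) i u).
Qed.

Lemma cop_igen_surj (j : Invn n (cop_ob (Cop_of F))) : isigen j ->
  exists i j', fmap (Invn n) (inj i) j' = j.
Proof.
destruct n as [|m]; [intros []|].
intros [[i u] ->]; now exists i, (igenn u).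
Qed.

Lemma cop_igen_inj i i' (j : Invn n (F i)) (j' : Invn n (F i')) : isigen j -> isigen j' ->
  fmap (Invn n) (inj i) j = fmap (Invn n) (inj i') j' ->
  existT (fun i => fob (Invn n) (F i)) i j = existT _ i' j'.
Proof.
destruct n as [|m]; [intros []|].
intros [u ->] [u' ->] e.
apply (igenn_inj (C := cop_ob (Cop_of F))) in e.
exact (f_equal (fun s : {i : I & Ugen (F i)} =>
  existT (fun i => fob (Invn (S m)) (F i)) (projT1 s) (igenn (projT2 s))) e).
Qed.

End CopLevel.

Section Cop.
Variables (I : Type) (E : I -> icomp).

(** Truncating a coproduct gives by computation the coproduct of the truncated family; that family
    equals the family of lower levels only pointwise, hence function extensionality. *)
Definition cop : icomp := {|
  lv n := cop_ob (Cop_of (fun i => E i n));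
  lv_tr n := f_equal (fun F => cop_ob (Cop_of (n := n) F))
    (functional_extensionality (fun i => trc (E i (S n))) (fun i => E i n)
       (fun i => lv_tr (E i) n)) |}.

Lemma cop_in_cast n (F G : I -> iCompn n) (e : F = G) i (p : F i = G i) :
  hom_cast p (f_equal (fun F => cop_ob (Cop_of (n := n) F)) e) (cop_in (Cop_of F) i)
  = cop_in (Cop_of G) i.
Proof. destruct e; now rewrite (proof_irrelevance _ p eq_refl). Qed.

Definition cop_inj (i : I) : hom (E i : iComp) cop :=
  @MkIcompHom (E i) cop (fun n => cop_in (Cop_of (fun i => E i n)) i)
    (fun n => cop_in_cast _ _).

(** Gluing along the injections with every generator designated. Generators and invertibility
    elements have a unique preimage in the whole family, so all compatibility conditions are
    trivial. *)
Lemma K_cop : is_coproduct (X := fun i => K (E i)) (Z := K cop) (fun i => fmap K (cop_inj i)).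
Proof.
intros X f.
assert (HI : forall n (j : Invn n (cop n)), exists i (j' : Invn n (E i n)),
    fmap (Invn n) (cop_inj i n) j' = j).
{ apply inv_family_surj; intros n j Hj; exact (cop_igen_surj Hj). }
destruct (@glue_exists I cop E cop_inj X f (fun i n a => isgen a)) as [z Hz].
- intros n w Hw; exact (cop_gen_surj Hw).
- intros n i i' a a' Ha Ha' e.
  exact (f_equal (fun s : {i : I & top (E i n)} => glue_val f (projT2 s)) (cop_gen_inj Ha Ha' e)).
- intros n i a Ha; left; split; [exact Ha | exact (cop_isgen Ha)].
- exact HI.
- intros n i i' j j' e.
  assert (E0 : existT (fun i => fob (Invn n) (E i n)) i j = existT _ i' j').
  { revert e; apply inv_family_inj.
    - intros m k l Hl; exact (cop_isigen Hl).
    - intros m k k' l l' Hl Hl' e; exact (cop_igen_inj Hl Hl' e). }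
  repeat split.
  + exact (f_equal (fun s : {i : I & fob (Invn n) (E i n)} =>
      glue_val f (fwdn (C := E (projT1 s) n) (projT2 s))) E0).
  + exact (f_equal (fun s : {i : I & fob (Invn n) (E i n)} =>
      glue_val f (linvn (C := E (projT1 s) n) (projT2 s))) E0).
  + exact (f_equal (fun s : {i : I & fob (Invn n) (E i n)} =>
      glue_val f (rinvn (C := E (projT1 s) n) (projT2 s))) E0).
- exists z; split; [exact Hz|]; intros z' Hz'.
  apply (glue_uniq (h := cop_inj)).
  + intros n w Hw; destruct (cop_gen_surj Hw) as (i & a & _ & e); now exists i, a.
  + exact HI.
  + intros i; now rewrite Hz, Hz'.
Qed.

Definition K_coproduct : Coproduct (fun i => K (E i)) := MkCoproduct K_cop.

End Cop.

(** [if b then K C else K D] and [K (if b then C else D)] agree only after case analysis on [b],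
    hence the matches around [K_cop]. *)
Definition K_coproduct2 (C D : icomp) : Coproduct2 (K C) (K D).
Proof.
unshelve refine (@MkCoproduct wCat bool _ (K (cop (fun b : bool => if b then C else D)))
  (fun b => match b return hom (if b then K C else K D) (K (cop _)) with
     | true => fmap K (cop_inj (fun b : bool => if b then C else D) true)
     | false => fmap K (cop_inj (fun b : bool => if b then C else D) false)
     end) _).
intros X f.
destruct (@K_cop bool (fun b => if b then C else D) X
  (fun b => match b return hom (if b then K C else K D) X -> hom (K (if b then C else D)) X with
    true => fun f => f | false => fun f => f end (f b))) as [z [Hz Hu]].
exists z; split.
- intros [|]; [exact (Hz true) | exact (Hz false)].
- intros z' Hz'; apply Hu; intros [|]; [exact (Hz' true) | exact (Hz' false)].
Defined.

(** Ensures that quantifying over choices of coproducts is not vacuous. [F X] is [K (Cptd_ob X)] by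
    computation, so [K_cop] provides all of them. *)
Lemma Cellular_inhabited (n : nat) (C : iCompn (S n)) : inhabited (Cellular C).
Proof.
constructor.
pose (VS := K_coproduct (fun _ : Vgen C => Cptd_ob (sphere n))).
pose (US := K_coproduct (fun _ : Ugen C => Cptd_ob (sphere n))).
pose (VD := K_coproduct (fun _ : Vgen C => Cptd_ob (disk (S n)))).
pose (UE := K_coproduct (fun _ : Ugen C => walking n)).
exact (@MkCellular n C VS US VD UE
  (K_coproduct2 (cop (fun _ : Vgen C => Cptd_ob (sphere n)))
                (cop (fun _ : Ugen C => Cptd_ob (sphere n))))
  (K_coproduct2 (cop (fun _ : Vgen C => Cptd_ob (disk (S n))))
                (cop (fun _ : Ugen C => walking n)))).
Qed.

(** * Dimensions -1 and 0 *)

Section FreeAlgebras.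
Variables (A B : Cat) (J : Adjunction A B).

Lemma freealg_ext_unit (X : A) (Y : Algebra J) (g : hom X (car Y)) :
  amap (freealg_ext g) @@ unit J X = g.
Proof.
change (act Y @@ monT_map J g @@ unit J X = g).
rewrite <- cmp_assoc; unfold monT_map; rewrite unit_nat, cmp_assoc, act_unit.
apply cmp_idl.
Qed.

(** Compatibility with the actions and the triangle identity recover [z] from its restriction along
    the unit. *)
Lemma freealg_hom_eta (X : A) (Y : Algebra J) (z : AlgHom (freealg J X) Y) :
  amap z = act Y @@ monT_map J (amap z @@ unit J X).
Proof.
rewrite monT_map_cmp, cmp_assoc, <- amap_act, <- cmp_assoc.
transitivity (amap z @@ idc (car (freealg J X))); [symmetry; apply cmp_idr|].
apply f_equal; symmetry.
transitivity (fmap (radj J) (counit J (ladj J X) @@ lmap J (unit J X))); [symmetry; apply fmap_cmp|].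
transitivity (fmap (radj J) (idc (ladj J X))); [apply f_equal | apply fmap_id].
unfold counit; rewrite transpose_pre, <- (transpose_uniq J (idc (ladj J X))).
now rewrite fmap_id.
Qed.

Lemma freealg_hom_ext (X : A) (Y : Algebra J) (z z' : AlgHom (freealg J X) Y) :
  amap z @@ unit J X = amap z' @@ unit J X -> z = z'.
Proof.
intros E; apply AlgHom_eq; rewrite (freealg_hom_eta z), (freealg_hom_eta z'), E.
reflexivity.
Qed.

(** Puts the classifying morphisms in the image of the comparison functor, so that they can be
    members of a gluing family. *)
Lemma freealg_ext_comparison (X : A) (Y : B) (g : hom X (radj J Y)) :
  freealg_ext (Y := comparison_alg J Y) g = fmap (comparison J) (transpose J g).
Proof.
apply freealg_hom_ext; rewrite freealg_ext_unit; symmetry; apply transpose_unit.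
Qed.

End FreeAlgebras.

Lemma Cptd_isgen (X : gset) (n : nat) (a : top (Cptd_ob X n)) :
  isgen a -> exists x : X n, a = Cptd_unit X n x.
Proof.
destruct n as [|n]; [intros _; now exists a|].
intros [v ->]; now exists v.
Qed.

Lemma Cptd_unit_isgen (X : gset) (n : nat) (x : X n) :
  isgen (C := Cptd_ob X n) (Cptd_unit X n x).
Proof. destruct n as [|n]; [exact I | now exists x]. Qed.

Lemma transpose_at (X : gset) (C : icomp) (g : gmap X (Cell C)) (n : nat) (x : X n) :
  top_map (Cptd_transpose g n) (Cptd_unit X n x) = g n x.
Proof. exact (f_equal (fun k : gmap X (Cell C) => k n x) (transpose_unit CptdAdj g)). Qed.

Lemma freealg_ext_at (X : gset) (Y : wCat) (g : gmap X (car Y)) (n : nat) (x : X n) :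
  amap (freealg_ext (J := CptdAdj) (X := X) (Y := Y) g) n (Cptd_unit X n x) = g n x.
Proof.
exact (f_equal (fun k : gmap X (car Y) => k n x)
  (freealg_ext_unit (J := CptdAdj) (X := X) (Y := Y) g)).
Qed.

Lemma F_map_at (X Y : gset) (g : gmap X Y) (n : nat) (x : X n) :
  amap (F_map g) n (Cptd_unit X n x) = Cptd_unit Y n (g n x).
Proof. exact (freealg_ext_at (Y := F Y) (gmap_cmp (Cptd_unit Y) g) x). Qed.

(** The empty family covers an empty set of invertible generators, hence by [inv_family_surj] the
    whole invertibility sets. *)
Lemma no_inv_of_no_igen (C : icomp) :
  (forall n (j : Invn n (C n)), isigen j -> False) -> forall n, Invn n (C n) -> False.
Proof.
intros H n j.
destruct (@inv_family_surj Empty_set C (fun i => match i with end)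
  (fun i => match i with end)) with (n := n) (j := j) as [[] _].
intros m l Hl; destruct (H m l Hl).
Qed.

Lemma isgen_cast (n : nat) (C D : iCompn n) (e : C = D) (a : top C) :
  isgen (top_cast e a) <-> isgen a.
Proof. now destruct e. Qed.

Lemma top_cast_trans (n : nat) (C D E : iCompn n) (e : C = D) (d : D = E) (a : top C) :
  top_cast d (top_cast e a) = top_cast (eq_trans e d) a.
Proof. now destruct d. Qed.

Lemma top_cast_irr (n : nat) (C D : iCompn n) (e d : C = D) (a : top C) :
  top_cast e a = top_cast d a.
Proof. now rewrite (proof_irrelevance _ e d). Qed.

Lemma top_cast_inj (n : nat) (C D : iCompn n) (e : C = D) (x y : top C) :
  top_cast e x = top_cast e y -> x = y.
Proof. now destruct e. Qed.

Lemma top_cast_surj (n : nat) (C D : iCompn n) (e : C = D) (y : top D) :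
  exists x, y = top_cast e x.
Proof. destruct e; now exists y. Qed.

Lemma sk_cell_inj (n : nat) (C : iCompn n) (x y : top C) : sk_cell x = sk_cell y -> x = y.
Proof. apply top_cast_inj. Qed.

Lemma sk_cell_surj (n : nat) (C : iCompn n) (w : top (sk C n)) : exists x, w = sk_cell x.
Proof. apply top_cast_surj. Qed.

Lemma sk_cell_isgen (n : nat) (C : iCompn n) (x : top C) : isgen (sk_cell x) <-> isgen x.
Proof. apply isgen_cast. Qed.

Lemma sk_m1_no_gen n (a : top (sk_m1 tt n)) : isgen a -> False.
Proof.
intros H; pose proof (skeletal_isgen (sk_skeletal (n := 0) (Empty_set : SetC)) H) as Hn.
destruct n as [|n]; [|exact (PeanoNat.Nat.nle_succ_0 _ Hn)].
destruct (sk_cell_surj (n := 0) (C := (Empty_set : SetC)) a) as [[] _].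
Qed.

Lemma sk_0_no_igen (C : iCompn 0) n (j : Invn n (sk C n)) : isigen j -> False.
Proof.
intros H; pose proof (skeletal_isigen (sk_skeletal C) H) as Hn.
destruct n as [|n]; [exact H | exact (PeanoNat.Nat.nle_succ_0 _ Hn)].
Qed.

(** Gluing along the empty family: there are no generators and no invertibility elements to
    cover. *)
Lemma K_sk_m1_initial (C : iComp_m1) : is_initial (K (sk_m1 C)).
Proof.
destruct C; intros X.
assert (HI : forall n, Invn n (sk_m1 tt n) -> False).
{ apply no_inv_of_no_igen; intros n j; apply sk_0_no_igen. }
destruct (@glue_exists Empty_set (sk_m1 tt) (fun i => match i with end)
  (fun i => match i with end) X (fun i => match i with end) (fun i => match i with end))
  as [z _]; try (intros n i; now destruct i).
- intros n w Hw; destruct (sk_m1_no_gen Hw).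
- intros n j; destruct (HI n j).
- exists z; split; [exact I|]; intros z' _.
  apply (@glue_uniq Empty_set (sk_m1 tt) (fun i => match i with end)
    (fun i => match i with end) X).
  + intros n w Hw; destruct (sk_m1_no_gen Hw).
  + intros n j; destruct (HI n j).
  + intros [].
Qed.

Lemma disk_top_uniq (n : nat) (x : disk n n) : x = disk_top n.
Proof.
destruct x as [b [H|H]]; [destruct (PeanoNat.Nat.lt_irrefl _ H)|].
destruct H as [H ->]; unfold disk_top; f_equal; apply proof_irrelevance.
Qed.

Lemma disk_0_cell (n : nat) (x : disk 0 n) : n = 0.
Proof. destruct x as [b [H|H]]; [destruct (PeanoNat.Nat.nlt_0_r _ H) | apply H]. Qed.

(** Gluing along one disc per point of [C]. Each disc contributes exactly one generator, and all
    invertibility sets are empty. *)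
Lemma K_sk_0_copower (C : iCompn 0) :
  is_coproduct (X := fun _ : (C : SetC) => F (disk 0)) (Z := K (sk C))
    (fun v => sk_cell_cls (gen0 v)).
Proof.
set (h := fun v : (C : SetC) => Cptd_transpose (disk_map (X := Cell (sk C)) (sk_cell (gen0 v)))
  : hom (Cptd_ob (disk 0) : iComp) (sk C)).
assert (Ecls : forall v, sk_cell_cls (gen0 v) = fmap K (h v)).
{ intros v; exact (freealg_ext_comparison (J := CptdAdj) (Y := sk C) _). }
assert (Hh : forall v, top_map (h v 0) (Cptd_unit (disk 0) 0 (disk_top 0)) = sk_cell (gen0 v)).
{ intros v; etransitivity; [apply transpose_at | exact (disk_map_top (X := Cell (sk C)) (n := 0) (sk_cell (gen0 v)))]. }
assert (Hgen : forall n (w : top (sk C n)), isgen w ->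
  exists v (a : top (Cptd_ob (disk 0) n)), isgen a /\ top_map (h v n) a = w).
{ intros n w Hw; pose proof (skeletal_isgen (sk_skeletal C) Hw) as Hn.
  destruct n as [|n]; [|destruct (PeanoNat.Nat.nle_succ_0 _ Hn)].
  destruct (sk_cell_surj w) as [v ->].
  exists v, (Cptd_unit (disk 0) 0 (disk_top 0)); split; [exact I | apply Hh]. }
assert (HI : forall n, Invn n (sk C n) -> False).
{ apply no_inv_of_no_igen; intros n j; apply sk_0_no_igen. }
assert (Hdisk : forall (P : forall n, top (Cptd_ob (disk 0) n) -> Prop),
  P 0 (Cptd_unit (disk 0) 0 (disk_top 0)) -> forall n a, isgen a -> P n a).
{ intros P HP n a Ha; destruct (Cptd_isgen Ha) as [x ->].
  pose proof (disk_0_cell x); subst n; now rewrite (disk_top_uniq x). }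
intros X f.
destruct (@glue_exists _ (sk C) _ h X f (fun i n a => isgen a)) as [z Hz].
- exact Hgen.
- intros n i i' a a' Ha Ha' e.
  destruct (Cptd_isgen Ha) as [x ->], (Cptd_isgen Ha') as [x' ->].
  pose proof (disk_0_cell x); subst n.
  rewrite (disk_top_uniq x), (disk_top_uniq x') in *.
  (* A point is recovered from its image, so equal images come from the same disc. *)
  rewrite !Hh in e; apply sk_cell_inj in e.
  change (i = i') in e; now subst i'.
- intros n i a Ha; left; split; [exact Ha|]; revert n a Ha.
  exact (Hdisk _ I).
- intros n j; destruct (HI n j).
- intros n i i' j; destruct (Inv_Cptdn_empty (n := n) j).
- exists z; split.
  + intros v; rewrite Ecls; apply Hz.
  + intros z' Hz'; apply (glue_uniq (h := h)).
    * intros n w Hw; destruct (Hgen n w Hw) as (v & a & _ & e); now exists v, a.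
    * intros n j; destruct (HI n j).
    * intros v; rewrite Hz, <- Ecls; symmetry; apply Hz'.
Qed.

(** * The pushout square *)

Lemma sphere_map_ext (n : nat) (X : gset) (g g' : gmap (sphere n) X) :
  g n (sphere_src n) = g' n (sphere_src n) -> g n (sphere_tgt n) = g' n (sphere_tgt n) ->
  g = g'.
Proof.
intros Es Et; apply gmap_eq.
(* Induction on the codimension [d]: a cell below dimension [n] is the source or target of a cell
   one dimension up. *)
assert (H : forall d k (x : sphere n k), n = d + k -> g k x = g' k x).
{ induction d as [|d IH]; intros k [b Hb] E.
  - simpl in E; subst k; destruct b.
    + now rewrite (proof_irrelevance _ Hb (le_n (S n))).
    + now rewrite (proof_irrelevance _ Hb (le_n (S n))).
  - assert (Hs : S k < S n) by lia.
    assert (E2 : n = d + S k) by lia.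
    pose proof (fun b => IH _ (exist _ b Hs : sphere n (S k)) E2) as E'.
    destruct b.
    + transitivity (src (g (S k) (exist _ true Hs : sphere n (S k)))).
      * rewrite gm_src; simpl; do 2 f_equal; apply proof_irrelevance.
      * rewrite E', gm_src; simpl; do 2 f_equal; apply proof_irrelevance.
    + transitivity (tgt (g (S k) (exist _ true Hs : sphere n (S k)))).
      * rewrite gm_tgt; simpl; do 2 f_equal; apply proof_irrelevance.
      * rewrite E', gm_tgt; simpl; do 2 f_equal; apply proof_irrelevance. }
intros k x; apply (H (n - k)); symmetry; apply PeanoNat.Nat.sub_add.
apply le_S_n, (proj2_sig x).
Qed.

(** Reduces the commutation of the attaching squares to the two n-cells of the sphere. *)
Lemma sphere_F_ext (n : nat) (Y : wCat) (z z' : hom (F (sphere n)) Y) :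
  amap z n (Cptd_unit (sphere n) n (sphere_src n))
    = amap z' n (Cptd_unit (sphere n) n (sphere_src n)) ->
  amap z n (Cptd_unit (sphere n) n (sphere_tgt n))
    = amap z' n (Cptd_unit (sphere n) n (sphere_tgt n)) -> z = z'.
Proof.
intros Es Et; apply (freealg_hom_ext (J := CptdAdj) (X := sphere n)).
exact (sphere_map_ext (g := gmap_cmp (amap z) (Cptd_unit (sphere n)))
  (g' := gmap_cmp (amap z') (Cptd_unit (sphere n))) Es Et).
Qed.

Lemma psrc_bdryn_cast (n : nat) (C D : iCompn (S n)) (e : C = D) (c : top C) :
  psrc (bdryn (top_cast e c)) = top_cast (f_equal (@trc n) e) (psrc (bdryn c)).
Proof. now destruct e. Qed.

Lemma ptgt_bdryn_cast (n : nat) (C D : iCompn (S n)) (e : C = D) (c : top C) :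
  ptgt (bdryn (top_cast e c)) = top_cast (f_equal (@trc n) e) (ptgt (bdryn c)).
Proof. now destruct e. Qed.

Lemma trc_map_cast (n : nat) (C C' D D' : iCompn (S n)) (e : C = C') (d : D = D')
    (f : hom C D) :
  trc_map (hom_cast e d f) = hom_cast (f_equal (@trc n) e) (f_equal (@trc n) d) (trc_map f).
Proof. now destruct e, d. Qed.

Lemma hom_cast_trans (A : Cat) (X X' X'' Y Y' Y'' : A) (e : X = X') (e' : X' = X'')
    (d : Y = Y') (d' : Y' = Y'') (f : hom X Y) :
  hom_cast e' d' (hom_cast e d f) = hom_cast (eq_trans e e') (eq_trans d d') f.
Proof. now destruct e', d'. Qed.

Section Cell.
Variables (n : nat) (C : iCompn (S n)).

Lemma sk_step_lvid m : m <= n -> is_lvid (sk_step C m).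
Proof. apply skel_ext_lvid. Qed.

Lemma walking_bd_lvid m : m <= n -> is_lvid (walking_bd n m).
Proof. apply skel_ext_lvid. Qed.

Definition trc_sk : trc C = sk C n := eq_sym (sk_lv_trc C).

Lemma sk_step_cell (x : top (trc C)) :
  top_map (sk_step C n) (sk_cell x) = top_cast trc_sk x.
Proof.
unfold sk_step, sk_cell; rewrite skel_ext_lv, top_map_id_of_eq, top_cast_trans.
apply top_cast_irr.
Qed.

Lemma sk_cell_src (c : top C) :
  src (g := Cell (sk C)) (sk_cell c) = top_cast trc_sk (psrc (bdryn c)).
Proof.
unfold sk_cell; simpl; unfold cell_src.
rewrite psrc_bdryn_cast, top_cast_trans; apply top_cast_irr.
Qed.

Lemma sk_cell_tgt (c : top C) :
  tgt (g := Cell (sk C)) (sk_cell c) = top_cast trc_sk (ptgt (bdryn c)).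
Proof.
unfold sk_cell; simpl; unfold cell_tgt.
rewrite ptgt_bdryn_cast, top_cast_trans; apply top_cast_irr.
Qed.

Lemma sk_map_lv (B : iCompn (S n)) (f : hom B C) :
  sk_map f n = hom_cast (eq_sym (sk_lv_trc B)) trc_sk (trc_map f).
Proof.
rewrite <- hl_tr; unfold sk_map; rewrite skel_ext_lv, trc_map_cast, hom_cast_trans.
f_equal; apply proof_irrelevance.
Qed.

(** The transports into and out of the n-th level of [walking n] cancel, leaving the one from
    [trc C] to [sk C n]. *)
Lemma walk_map_cell (i : Invn (S n) C) (y : sphere n n) (x : top (trc C)) :
  top_map (trc_map (walk_map i)) (Cptd_unit (sphere n) n y) = x ->
  top_map (sk_map (walk_map i) n) (top_map (walking_bd n n) (Cptd_unit (sphere n) n y))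
  = top_cast trc_sk x.
Proof.
intros <-; rewrite sk_map_lv, <- (top_cast_nat (eq_sym (sk_lv_trc (walk n)))).
f_equal; unfold walking_bd; rewrite skel_ext_lv; apply top_map_id_of_eq.
Qed.

(** Both sides send the two n-cells of the sphere to the source and target of [genn v]: one side by
    the attaching pair, the other because the classifying map of the disc preserves boundaries. *)
Lemma sq_commutes_V (v : Vgen C) :
  fmap K (sk_step C) @@ sk_pair_cls (phin v) = sk_cell_cls (genn v) @@ F_map (sphere_incl n).
Proof.
assert (H : forall y : sphere n n,
  amap (sk_cell_cls (genn v) @@ F_map (sphere_incl n)) n (Cptd_unit (sphere n) n y)
  = disk_map (X := Cell (sk C)) (n := S n) (sk_cell (genn v)) n (sphere_incl n n y)).
{ intros y; transitivity (amap (sk_cell_cls (genn v)) n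
    (Cptd_unit (disk (S n)) n (sphere_incl n n y))).
  - exact (f_equal (amap (sk_cell_cls (genn v)) n) (F_map_at (sphere_incl n) y)).
  - apply (freealg_ext_at (Y := K (sk C))). }
apply sphere_F_ext; (etransitivity; [|symmetry; apply H]).
- transitivity (top_map (sk_step C n) (sk_cell (psrc (phin v)))).
  { apply (f_equal (top_map (sk_step C n))).
    etransitivity; [apply (freealg_ext_at (Y := K (sk (trc C))))|].
    apply (sphere_map_src (X := Cell (sk (trc C)))). }
  rewrite sk_step_cell; transitivity (src (g := Cell (sk C)) (sk_cell (genn v))).
  { symmetry; apply sk_cell_src. }
  etransitivity; [exact (f_equal (@src (Cell (sk C)) n)
    (eq_sym (disk_map_top (X := Cell (sk C)) (n := S n) (sk_cell (genn v)))))|].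
  etransitivity; [apply gm_src|].
  apply f_equal; simpl; f_equal; apply proof_irrelevance.
- transitivity (top_map (sk_step C n) (sk_cell (ptgt (phin v)))).
  { apply (f_equal (top_map (sk_step C n))).
    etransitivity; [apply (freealg_ext_at (Y := K (sk (trc C))))|].
    apply (sphere_map_tgt (X := Cell (sk (trc C)))). }
  rewrite sk_step_cell; transitivity (tgt (g := Cell (sk C)) (sk_cell (genn v))).
  { symmetry; apply sk_cell_tgt. }
  etransitivity; [exact (f_equal (@tgt (Cell (sk C)) n)
    (eq_sym (disk_map_top (X := Cell (sk C)) (n := S n) (sk_cell (genn v)))))|].
  etransitivity; [apply gm_tgt|].
  apply f_equal; simpl; f_equal; apply proof_irrelevance.
Qed.

(** The same comparison on two n-cells, with [walk_map_bd] computing the boundary of the walking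
    equivalence. *)
Lemma sq_commutes_U (u : Ugen C) :
  fmap K (sk_step C) @@ sk_pair_cls (psin u)
  = fmap K (sk_map (walk_map (igenn u))) @@ fmap K (walking_bd n).
Proof.
apply sphere_F_ext.
- transitivity (top_map (sk_step C n) (sk_cell (psrc (psin u)))).
  { apply (f_equal (top_map (sk_step C n))).
    etransitivity; [apply (freealg_ext_at (Y := K (sk (trc C))))|].
    apply (sphere_map_src (X := Cell (sk (trc C)))). }
  rewrite sk_step_cell; symmetry; apply walk_map_cell.
  exact (f_equal (@psrc _ _) (eq_sym (walk_map_bd (igenn u)))).
- transitivity (top_map (sk_step C n) (sk_cell (ptgt (psin u)))).
  { apply (f_equal (top_map (sk_step C n))).
    etransitivity; [apply (freealg_ext_at (Y := K (sk (trc C))))|].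
    apply (sphere_map_tgt (X := Cell (sk (trc C)))). }
  rewrite sk_step_cell; symmetry; apply walk_map_cell.
  exact (f_equal (@ptgt _ _) (eq_sym (walk_map_bd (igenn u)))).
Qed.

End Cell.

(** The level [n] of a skeleton [sk C] equals [C] only up to [sk_lv]. This and the next three lemmas
    quantify over such equalities so that they can be destructed. *)
Lemma isigen_cast_map (n : nat) (C C' D D' : iCompn n) (e : C = C') (d : D = D')
    (f : hom C D) (k : Invn n D) :
  (forall j : Invn n C, isigen j -> fmap (Invn n) f j = k) ->
  forall j : Invn n C', isigen j ->
    fmap (Invn n) (hom_cast e d f) j = fmap (Invn n) (id_of_eq d) k.
Proof. destruct e, d; intros H j Hj; simpl; rewrite fmap_id; now apply H. Qed.

Lemma isgen_transport (n : nat) (C C' : iCompn n) (e : C = C') :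
  (forall a : top C', isgen a -> False) -> forall a : top C, isgen a -> False.
Proof. now destruct e. Qed.

Lemma isigen_transport_uniq (n : nat) (C C' : iCompn n) (e : C = C') :
  (forall j j' : Invn n C', isigen j -> isigen j' -> j = j') ->
  forall j j' : Invn n C, isigen j -> isigen j' -> j = j'.
Proof. now destruct e. Qed.

Lemma isigen_transport_ex (n : nat) (C C' : iCompn n) (e : C = C') :
  (exists j : Invn n C', isigen j) -> exists j : Invn n C, isigen j.
Proof. now destruct e. Qed.

Lemma disk_S_cell (n m : nat) (y : disk (S n) m) :
  (m <= n /\ exists x : sphere n m, y = sphere_incl n m x) \/ m = S n.
Proof.
destruct y as [b H]; destruct (PeanoNat.Nat.le_gt_cases m n) as [Hm|Hm]; [left|right; lia].
split; [exact Hm|]; exists (exist _ b (le_n_S _ _ Hm)); unfold sphere_incl; simpl.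
f_equal; apply proof_irrelevance.
Qed.

Lemma walking_isgen (n m : nat) (a : top (walking n m)) : isgen a ->
  m <= n /\ exists b : sphere n m, a = top_map (walking_bd n m) (Cptd_unit (sphere n) m b).
Proof.
intros Ha; pose proof (skeletal_isgen (sk_skeletal (walk n)) Ha) as Hm.
assert (Hm' : m <= n).
{ destruct (PeanoNat.Nat.eq_dec m (S n)) as [E|E]; [exfalso; subst m | lia].
  (* The only generator of [walk n] in dimension n+1 is invertible, so no ordinary one remains
     there. *)
  revert a Ha; apply (isgen_transport (sk_lv (walk n))); intros a [[] _]. }
split; [exact Hm'|]; pose proof (walking_bd_lvid Hm') as Hid.
destruct (lvid_top_surj Hid a) as [c <-].
destruct (Cptd_isgen (proj1 (lvid_isgen Hid c) Ha)) as [b ->]; now exists b.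
Qed.

Lemma walking_isigen (n m : nat) (j : Invn m (walking n m)) : isigen j -> m = S n.
Proof.
intros Hj; pose proof (skeletal_isigen (sk_skeletal (walk n)) Hj) as Hm.
destruct (PeanoNat.Nat.eq_dec m (S n)) as [E|E]; [exact E|].
assert (Hm' : m <= n) by lia.
destruct (lvid_inv_surj (walking_bd_lvid Hm') j) as [j' _].
destruct (Inv_Cptdn_empty j').
Qed.

Lemma walking_isigen_uniq (n : nat) (j j' : Invn (S n) (walking n (S n))) :
  isigen j -> isigen j' -> j = j'.
Proof.
apply (isigen_transport_uniq (sk_lv (walk n))).
intros l l' [[] ->] [[] ->]; reflexivity.
Qed.

(** * The attaching family: the lower skeleton, discs and walking equivalences *)

Section Pushout.
Variables (n : nat) (C : iCompn (S n)).

Definition attach_ix : Type := option (Vgen C + Ugen C).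

Definition attach_ob (i : attach_ix) : icomp :=
  match i with
  | None => sk (trc C)
  | Some (inl v) => Cptd_ob (disk (S n))
  | Some (inr u) => walking n
  end.

Definition attach_map (i : attach_ix) : hom (attach_ob i : iComp) (sk C) :=
  match i return hom (attach_ob i : iComp) (sk C) with
  | None => sk_step C
  | Some (inl v) => Cptd_transpose (disk_map (X := Cell (sk C)) (n := S n) (sk_cell (genn v)))
  | Some (inr u) => sk_map (walk_map (igenn u))
  end.

Lemma sk_cell_cls_K (v : Vgen C) :
  sk_cell_cls (genn v) = fmap K (attach_map (Some (inl v))).
Proof. exact (freealg_ext_comparison (J := CptdAdj) (Y := sk C) _). Qed.

(** Each generator of [sk C] is read off either the lower skeleton or the top cell of a disc. The
    ordinary generators of boundary spheres are not designated: the attaching maps may send them to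
    arbitrary cells of the lower skeleton. *)
Definition attach_des (i : attach_ix) : forall m, top (attach_ob i m) -> Prop :=
  match i return forall m, top (attach_ob i m) -> Prop with
  | None => fun m a => isgen a
  | Some (inl v) => fun m a => m = S n /\ isgen a
  | Some (inr u) => fun _ _ => False
  end.

Definition attach_top : top (Cptd_ob (disk (S n)) (S n)) :=
  Cptd_unit (disk (S n)) (S n) (disk_top (S n)).

Lemma attach_map_top v : top_map (attach_map (Some (inl v)) (S n)) attach_top = sk_cell (genn v).
Proof.
etransitivity; [apply transpose_at|].
exact (disk_map_top (X := Cell (sk C)) (n := S n) (sk_cell (genn v))).
Qed.

Lemma attach_des_top v (a : top (Cptd_ob (disk (S n)) (S n))) :
  attach_des (i := Some (inl v)) a -> a = attach_top.
Proof.
intros [_ Ha]; destruct (Cptd_isgen Ha) as [x ->]; now rewrite (disk_top_uniq x).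
Qed.

Lemma attach_gen_surj m (w : top (sk C m)) : isgen w ->
  exists i (a : top (attach_ob i m)), attach_des a /\ top_map (attach_map i m) a = w.
Proof.
intros Hw; pose proof (skeletal_isgen (sk_skeletal C) Hw) as Hm.
destruct (PeanoNat.Nat.eq_dec m (S n)) as [E|E].
- subst m; destruct (sk_cell_surj w) as [x ->].
  destruct (proj1 (sk_cell_isgen x) Hw) as [v ->].
  exists (Some (inl v)), attach_top; split; [|apply attach_map_top].
  split; [reflexivity | exact (Cptd_unit_isgen (disk_top (S n)))].
- assert (Hm' : m <= n) by lia; pose proof (sk_step_lvid C Hm') as Hid.
  destruct (lvid_top_surj Hid w) as [a <-]; exists None, a; split; [|reflexivity].
  exact (proj1 (lvid_isgen Hid a) Hw).
Qed.

Definition attach_igen (u : Ugen C) : Invn (S n) (sk C (S n)) :=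
  fmap (Invn (S n)) (id_of_eq (eq_sym (sk_lv C))) (igenn u).

Lemma attach_map_igen u (j : Invn (S n) (walking n (S n))) : isigen j ->
  fmap (Invn (S n)) (attach_map (Some (inr u)) (S n)) j = attach_igen u.
Proof.
intros Hj; change (fmap (Invn (S n)) (sk_map (walk_map (igenn u)) (S n)) j = attach_igen u).
unfold sk_map; rewrite skel_ext_lv.
revert j Hj; apply isigen_cast_map; intros j [[] ->]; reflexivity.
Qed.

Lemma attach_igen_isigen u : isigen (attach_igen u).
Proof.
apply lvid_isigen; [now eexists | now exists u].
Qed.

Lemma attach_igen_inj u u' : attach_igen u = attach_igen u' -> u = u'.
Proof.
intros e; apply igenn_inj; revert e; apply lvid_inv_inj; now eexists.
Qed.

Lemma attach_inv_surj m (j : Invn m (sk C m)) :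
  exists i (j' : Invn m (attach_ob i m)), fmap (Invn m) (attach_map i m) j' = j.
Proof.
revert m j; apply inv_family_surj; intros m j Hj.
pose proof (skeletal_isigen (sk_skeletal C) Hj) as Hm.
destruct (PeanoNat.Nat.eq_dec m (S n)) as [E|E].
- subst m.
  assert (Hid : is_lvid (id_of_eq (eq_sym (sk_lv C)))) by now eexists.
  destruct (lvid_inv_surj Hid j) as [j0 E0].
  assert (Hj0 : isigen j0) by now rewrite <- (lvid_isigen Hid), E0.
  destruct Hj0 as [u ->].
  destruct (isigen_transport_ex (sk_lv (walk n))) as [l Hl].
  { exists (igenn (C := walk n) tt); now exists tt. }
  exists (Some (inr u)), l; now rewrite (attach_map_igen u Hl).
- assert (Hm' : m <= n) by lia; pose proof (sk_step_lvid C Hm') as Hid.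
  destruct (lvid_inv_surj Hid j) as [l <-]; now exists None, l.
Qed.

(** Discs have no invertibility elements; invertible generators of the lower skeleton have dimension
    at most [n], that of a walking equivalence has dimension n+1, and distinct [u] give distinct
    images. *)
Lemma attach_inv_inj m i i' (j : Invn m (attach_ob i m)) (j' : Invn m (attach_ob i' m)) :
  fmap (Invn m) (attach_map i m) j = fmap (Invn m) (attach_map i' m) j' ->
  existT (fun i => fob (Invn m) (attach_ob i m)) i j = existT _ i' j'.
Proof.
assert (Hlow : forall m (j : Invn m (sk (trc C) m)), isigen j -> m <= n).
{ intros k l; apply skeletal_isigen, sk_skeletal. }
revert m i i' j j'; apply inv_family_inj.
- intros m i j Hj; destruct i as [[v|u]|].
  + destruct (Inv_Cptdn_empty (n := m) j).
  + pose proof (walking_isigen Hj); subst m.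
    rewrite (attach_map_igen u Hj); apply attach_igen_isigen.
  + exact (proj2 (lvid_isigen (sk_step_lvid C (Hlow _ _ Hj)) j) Hj).
- intros m i i' j j' Hj Hj' e; destruct i as [[v|u]|], i' as [[v'|u']|];
    try (destruct (Inv_Cptdn_empty (n := m) j));
    try (destruct (Inv_Cptdn_empty (n := m) j')).
  + pose proof (walking_isigen Hj); subst m.
    rewrite (attach_map_igen u Hj), (attach_map_igen u' Hj') in e.
    apply attach_igen_inj in e; subst u'.
    now rewrite (walking_isigen_uniq Hj Hj').
  + pose proof (walking_isigen Hj); pose proof (Hlow _ _ Hj'); lia.
  + pose proof (walking_isigen Hj'); pose proof (Hlow _ _ Hj); lia.
  + now rewrite (lvid_inv_inj (sk_step_lvid C (Hlow _ _ Hj)) e).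
Qed.

Lemma attach_uniq (X : wCat) (z z' : hom (K (sk C)) X) :
  (forall i, z @@ fmap K (attach_map i) = z' @@ fmap K (attach_map i)) -> z = z'.
Proof.
apply glue_uniq.
- intros m w Hw; destruct (attach_gen_surj Hw) as (i & a & _ & e); now exists i, a.
- apply attach_inv_surj.
Qed.

Section Existence.
Variables (X : wCat) (x : hom (K (sk (trc C))) X)
  (q : Vgen C -> hom (F (disk (S n))) X) (r : Ugen C -> hom (K (walking n)) X).
Hypothesis Hq : forall v, x @@ sk_pair_cls (phin v) = q v @@ F_map (sphere_incl n).
Hypothesis Hr : forall u, x @@ sk_pair_cls (psin u) = r u @@ fmap K (walking_bd n).

Definition attach_cocone (i : attach_ix) : hom (K (attach_ob i)) X :=
  match i return hom (K (attach_ob i)) X with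
  | None => x
  | Some (inl v) => q v
  | Some (inr u) => r u
  end.

Lemma attach_full : glue_full attach_map attach_des None.
Proof.
intros m a Ha; split; [exact Ha|].
apply (lvid_isgen (sk_step_lvid C (skeletal_isgen (sk_skeletal (trc C)) Ha))), Ha.
Qed.

Lemma attach_exists : exists z : hom (K (sk C)) X,
  forall i, z @@ fmap K (attach_map i) = attach_cocone i.
Proof.
apply (glue_exists (des := attach_des)).
- apply attach_gen_surj.
- assert (Hlow : forall m (a : top (sk (trc C) m)), isgen a -> m <= n).
  { intros k l; apply skeletal_isgen, sk_skeletal. }
  intros m i i' a a' Ha Ha' e; destruct i as [[v|u]|], i' as [[v'|u']|];
    try (exfalso; exact Ha); try (exfalso; exact Ha').
  + pose proof (proj1 Ha); subst m; rewrite (attach_des_top Ha), (attach_des_top Ha') in *.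
    rewrite !attach_map_top in e; apply sk_cell_inj, genn_inj in e; now subst v'.
  + pose proof (Hlow _ _ Ha'); destruct Ha; lia.
  + pose proof (Hlow _ _ Ha); destruct Ha'; lia.
  + now rewrite (lvid_top_inj (sk_step_lvid C (Hlow _ _ Ha)) e).
- intros m i a Ha; destruct i as [[v|u]|].
  + destruct (Cptd_isgen Ha) as [y ->]; destruct (disk_S_cell y) as [[Hm [b ->]]|Hm].
    (* The witness is the image of the boundary cell [b] under the attaching map. [sq_commutes_V]
       gives equality of images in [sk C], and [Hq] equality of values in [X]. *)
    * right; exists None, (amap (sk_pair_cls (phin v)) m (Cptd_unit (sphere n) m b)).
      split; [exact attach_full|].
      pose proof (F_map_at (sphere_incl n) b) as Eb; split.
      -- pose proof (sq_commutes_V v) as E; rewrite sk_cell_cls_K in E.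
         apply (f_equal (fun z : hom (F (sphere n)) (K (sk C)) =>
           amap z m (Cptd_unit (sphere n) m b))) in E.
         etransitivity; [|symmetry; exact E].
         exact (f_equal (top_map (attach_map (Some (inl v)) m)) (eq_sym Eb)).
      -- pose proof (f_equal (fun z : hom (F (sphere n)) X =>
           amap z m (Cptd_unit (sphere n) m b)) (Hq v)) as E.
         etransitivity; [|symmetry; exact E].
         exact (f_equal (amap (q v) m) (eq_sym Eb)).
    * left; split; [split; [exact Hm | exact Ha]|].
      subst m; rewrite (attach_des_top (v := v) (conj eq_refl Ha)), attach_map_top.
      apply sk_cell_isgen; now exists v.
  + destruct (walking_isgen Ha) as [Hm [b ->]].
    (* Every ordinary generator of the walking equivalence lies on its boundary sphere, so the
       attaching map again provides the witness. *)
    right; exists None, (amap (sk_pair_cls (psin u)) m (Cptd_unit (sphere n) m b)).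
    split; [exact attach_full | split].
    * exact (f_equal (fun z : hom (F (sphere n)) (K (sk C)) =>
        amap z m (Cptd_unit (sphere n) m b)) (eq_sym (sq_commutes_U u))).
    * exact (f_equal (fun z : hom (F (sphere n)) X =>
        amap z m (Cptd_unit (sphere n) m b)) (eq_sym (Hr u))).
  + left; exact (attach_full Ha).
- apply attach_inv_surj.
- intros m i i' j j' e; apply attach_inv_inj in e; repeat split.
  + exact (f_equal (fun s : {i : attach_ix & fob (Invn m) (attach_ob i m)} =>
      glue_val attach_cocone (fwdn (C := attach_ob (projT1 s) m) (projT2 s))) e).
  + exact (f_equal (fun s : {i : attach_ix & fob (Invn m) (attach_ob i m)} =>
      glue_val attach_cocone (linvn (C := attach_ob (projT1 s) m) (projT2 s))) e).
  + exact (f_equal (fun s : {i : attach_ix & fob (Invn m) (attach_ob i m)} =>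
      glue_val attach_cocone (rinvn (C := attach_ob (projT1 s) m) (projT2 s))) e).
Qed.

End Existence.

Lemma K_attach (X : wCat) (x : hom (K (sk (trc C))) X)
    (q : Vgen C -> hom (F (disk (S n))) X) (r : Ugen C -> hom (K (walking n)) X) :
  (forall v, x @@ sk_pair_cls (phin v) = q v @@ F_map (sphere_incl n)) ->
  (forall u, x @@ sk_pair_cls (psin u) = r u @@ fmap K (walking_bd n)) ->
  exists z : hom (K (sk C)) X, z @@ fmap K (sk_step C) = x /\
    (forall v, z @@ sk_cell_cls (genn v) = q v) /\
    (forall u, z @@ fmap K (sk_map (walk_map (igenn u))) = r u).
Proof.
intros Hq Hr; destruct (attach_exists Hq Hr) as [z Hz]; exists z; split; [|split].
- exact (Hz None).
- intros v; rewrite sk_cell_cls_K; exact (Hz (Some (inl v))).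
- intros u; exact (Hz (Some (inr u))).
Qed.

Lemma K_attach_uniq (X : wCat) (z z' : hom (K (sk C)) X) :
  z @@ fmap K (sk_step C) = z' @@ fmap K (sk_step C) ->
  (forall v, z @@ sk_cell_cls (genn v) = z' @@ sk_cell_cls (genn v)) ->
  (forall u, z @@ fmap K (sk_map (walk_map (igenn u)))
    = z' @@ fmap K (sk_map (walk_map (igenn u)))) -> z = z'.
Proof.
intros Hx HV HU; apply attach_uniq; intros [[v|u]|].
- rewrite <- sk_cell_cls_K; apply HV.
- apply HU.
- exact Hx.
Qed.

End Pushout.

Lemma coproduct_ext (A : Cat) (I : Type) (Y : I -> A) (P : Coproduct Y) (Z : A)
    (f g : hom (cp_ob P) Z) : (forall i, f @@ cp_in P i = g @@ cp_in P i) -> f = g.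
Proof.
intros H; destruct (@cp_is _ _ _ P Z (fun i => g @@ cp_in P i)) as [k [_ Hk]].
transitivity k; [symmetry|]; apply Hk; auto.
Qed.

(** * The square for arbitrary choices of coproducts *)

Section Square.
Variables (n : nat) (C : iCompn (S n)) (P : Cellular C).

Local Notation inVS v := (cp_in (VSUS P) true @@ cp_in (VS P) v).
Local Notation inUS u := (cp_in (VSUS P) false @@ cp_in (US P) u).
Local Notation inVD v := (cp_in (VDUE P) true @@ cp_in (VD P) v).
Local Notation inUE u := (cp_in (VDUE P) false @@ cp_in (UE P) u).

Lemma sq_top_V v : sq_top P @@ inVS v = sk_pair_cls (phin v).
Proof.
rewrite cmp_assoc; unfold sq_top, copair2.
etransitivity; [apply (f_equal (fun k => k @@ _)), (copair_in (VSUS P) _ true) | exact (copair_in (VS P) _ v)].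
Qed.

Lemma sq_top_U u : sq_top P @@ inUS u = sk_pair_cls (psin u).
Proof.
rewrite cmp_assoc; unfold sq_top, copair2.
etransitivity; [apply (f_equal (fun k => k @@ _)), (copair_in (VSUS P) _ false) | exact (copair_in (US P) _ u)].
Qed.

Lemma sq_bottom_V v : sq_bottom P @@ inVD v = sk_cell_cls (genn v).
Proof.
rewrite cmp_assoc; unfold sq_bottom, copair2.
etransitivity; [apply (f_equal (fun k => k @@ _)), (copair_in (VDUE P) _ true) | exact (copair_in (VD P) _ v)].
Qed.

Lemma sq_bottom_U u : sq_bottom P @@ inUE u = fmap K (sk_map (walk_map (igenn u))).
Proof.
rewrite cmp_assoc; unfold sq_bottom, copair2.
etransitivity; [apply (f_equal (fun k => k @@ _)), (copair_in (VDUE P) _ false) | exact (copair_in (UE P) _ u)].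
Qed.

Lemma sq_left_V v : sq_left P @@ inVS v = inVD v @@ F_map (sphere_incl n).
Proof.
rewrite cmp_assoc; unfold sq_left, coproduct2_map, copair2.
etransitivity; [apply (f_equal (fun k => k @@ _)), (copair_in (VSUS P) _ true)|].
rewrite <- !cmp_assoc; apply f_equal; exact (copair_in (VS P) _ v).
Qed.

Lemma sq_left_U u : sq_left P @@ inUS u = inUE u @@ fmap K (walking_bd n).
Proof.
rewrite cmp_assoc; unfold sq_left, coproduct2_map, copair2.
etransitivity; [apply (f_equal (fun k => k @@ _)), (copair_in (VSUS P) _ false)|].
rewrite <- !cmp_assoc; apply f_equal; exact (copair_in (US P) _ u).
Qed.

Lemma VSUS_ext (Z : wCat) (f g : hom (cp_ob (VSUS P)) Z) :
  (forall v, f @@ inVS v = g @@ inVS v) -> (forall u, f @@ inUS u = g @@ inUS u) -> f = g.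
Proof.
intros HV HU; apply coproduct_ext; intros [|]; apply coproduct_ext; intros i;
  rewrite <- !cmp_assoc; [apply HV | apply HU].
Qed.

Lemma VDUE_ext (Z : wCat) (f g : hom (cp_ob (VDUE P)) Z) :
  (forall v, f @@ inVD v = g @@ inVD v) -> (forall u, f @@ inUE u = g @@ inUE u) -> f = g.
Proof.
intros HV HU; apply coproduct_ext; intros [|]; apply coproduct_ext; intros i;
  rewrite <- !cmp_assoc; [apply HV | apply HU].
Qed.

(** Equations out of the coproducts are tested on components, where the universal property is
    [K_attach] with [K_attach_uniq]. *)
Lemma K_cellular_pushout : is_pushout (sq_top P) (sq_left P) (sq_right C) (sq_bottom P).
Proof.
split.
- apply VSUS_ext; intros i; rewrite <- !cmp_assoc.
  + rewrite sq_top_V, sq_left_V, cmp_assoc, sq_bottom_V; apply sq_commutes_V.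
  + rewrite sq_top_U, sq_left_U, cmp_assoc, sq_bottom_U; apply sq_commutes_U.
- intros Y x q E.
  destruct (@K_attach n C Y x (fun v => q @@ inVD v) (fun u => q @@ inUE u))
    as (z & Hx & HV & HU).
  + intros v; rewrite <- sq_top_V, cmp_assoc, E, <- cmp_assoc, sq_left_V; apply cmp_assoc.
  + intros u; rewrite <- sq_top_U, cmp_assoc, E, <- cmp_assoc, sq_left_U; apply cmp_assoc.
  + exists z; split.
    * split; [exact Hx|]; apply VDUE_ext; intros i; rewrite <- cmp_assoc.
      -- rewrite sq_bottom_V; apply HV.
      -- rewrite sq_bottom_U; apply HU.
    * intros z' [Hx' Hq']; apply K_attach_uniq.
      -- now rewrite Hx, <- Hx'.
      -- intros v; rewrite HV, <- Hq', <- sq_bottom_V; symmetry; apply cmp_assoc.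
      -- intros u; rewrite HU, <- Hq', <- sq_bottom_U; symmetry; apply cmp_assoc.
Qed.

End Square.

(** * The sequence of skeleta *)

Lemma sk_m1_hom_eq (D : icomp) (f g : hom (sk_m1 tt : iComp) D) : f = g.
Proof.
apply (skeletal_hom_eq (sk_skeletal (n := 0) (Empty_set : SetC))).
extensionality a; destruct (@sk_m1_no_gen 0 a I).
Qed.

Lemma top_map_cmp (n : nat) (C D E : iCompn n) (g : hom D E) (f : hom C D) (a : top C) :
  top_map (g @@ f) a = top_map g (top_map f a).
Proof. unfold top_map; now rewrite !fmap_cmp. Qed.

Section Skeleta.
Variable C : icomp.

(** The bound is strict because index [k] stands for dimension [k - 1]. *)
Lemma skeleton_isgen k m (a : top ((skeleton C k : icomp) m)) : isgen a -> m < k.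
Proof.
destruct k as [|n]; intros Ha; [destruct (sk_m1_no_gen Ha)|].
pose proof (skeletal_isgen (sk_skeletal (C n)) Ha); lia.
Qed.

Lemma skeleton_isigen k m (j : Invn m ((skeleton C k : icomp) m)) : isigen j -> m < k.
Proof.
destruct k as [|n]; intros Hj; [destruct (sk_0_no_igen Hj)|].
pose proof (skeletal_isigen (sk_skeletal (C n)) Hj); lia.
Qed.

Lemma skeleton_incl_lvid k m : m < k -> is_lvid (skeleton_incl C k m).
Proof.
destruct k as [|n]; [lia|]; intros H; apply skel_ext_lvid; lia.
Qed.

(** By [skeletal_hom_eq] it suffices to compare at level [n], where both sides are transports
    between the same levels. *)
Lemma skeleton_step_incl k :
  (skeleton_incl C (S k) : hom (skeleton C (S k)) (C : iComp)) @@ skeleton_step C k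
  = skeleton_incl C k.
Proof.
destruct k as [|n]; [apply sk_m1_hom_eq|].
apply (skeletal_hom_eq (sk_skeletal (C n))).
change ((skeleton_incl C (S (S n)) n : hom (sk (C (S n)) n) (C n)) @@ skeleton_step C (S n) n
  = skeleton_incl C (S n) n).
apply lvid_eq.
- apply lvid_cmp; [exact (skel_ext_lvid _ _ (le_n n))|].
  apply (skeleton_incl_lvid (k := S (S n))); lia.
- apply (skeleton_incl_lvid (k := S n)); lia.
Qed.

(** [inv_family_inj] for a family with a single member. *)
Lemma skeleton_inv_inj k m (j j' : Invn m ((skeleton C k : icomp) m)) :
  fmap (Invn m) (skeleton_incl C k m) j = fmap (Invn m) (skeleton_incl C k m) j' -> j = j'.
Proof.
intros e.
pose proof (@inv_family_inj Datatypes.unit C (fun _ => skeleton C k)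
  (fun _ => skeleton_incl C k)) as H.
assert (E : existT (fun _ : Datatypes.unit => fob (Invn m) ((skeleton C k : icomp) m)) tt j
  = existT _ tt j').
{ revert e; apply H; clear.
  - intros m _ j Hj; apply lvid_isigen; [|exact Hj].
    exact (skeleton_incl_lvid (skeleton_isigen Hj)).
  - intros m [] [] j j' Hj _ e; f_equal; revert e; apply lvid_inv_inj.
    exact (skeleton_incl_lvid (skeleton_isigen Hj)). }
exact (f_equal (fun s : {_ : Datatypes.unit & fob (Invn m) ((skeleton C k : icomp) m)} =>
  projT2 s) E).
Qed.

Lemma skeleton_inv_surj m (j : Invn m (C m)) :
  exists k (j' : Invn m ((skeleton C k : icomp) m)), fmap (Invn m) (skeleton_incl C k m) j' = j.
Proof.
revert m j; apply (@inv_family_surj nat C (skeleton C) (skeleton_incl C)).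
(* Index [S m] is the m-skeleton, which shares its level [m] with [C]. *)
intros m j _; exists (S m).
apply lvid_inv_surj, skeleton_incl_lvid; lia.
Qed.

Section Cocone.
Variables (X : wCat) (f : forall k, hom (K (skeleton C k)) X).
Hypothesis Hf : forall k, f (S k) @@ fmap K (skeleton_step C k) = f k.

(** The composite of steps stays abstract; later arguments use only its two equations. *)
Lemma skeleton_chain k k' : k <= k' -> exists s : hom (skeleton C k) (skeleton C k'),
  skeleton_incl C k' @@ s = skeleton_incl C k /\ f k' @@ fmap K s = f k.
Proof.
induction 1 as [|k' _ (s & Es & Ef)].
- exists (idc _); split; [apply cmp_idr | rewrite fmap_id; apply cmp_idr].
- exists (skeleton_step C k' @@ s); split.
  + now rewrite cmp_assoc, skeleton_step_incl.
  + now rewrite fmap_cmp, cmp_assoc, Hf.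
Qed.

Local Notation val := (glue_val f).
Local Notation h := (skeleton_incl C).

(** For [k <= k'], [a] is moved along the chain to the later skeleton. As [a'] is a generator,
    [m < k'], so the inclusion is a transport at level [m] and the moved cell equals [a']. *)
Lemma skeleton_gen_compat k k' m (a : top ((skeleton C k : icomp) m))
    (a' : top ((skeleton C k' : icomp) m)) : isgen a -> isgen a' ->
  top_map (h k m) a = top_map (h k' m) a' -> val a = val a'.
Proof.
assert (Hle : forall k k' (a : top ((skeleton C k : icomp) m))
    (a' : top ((skeleton C k' : icomp) m)), k <= k' -> isgen a' ->
  top_map (h k m) a = top_map (h k' m) a' -> val a = val a').
{ clear - Hf; intros k k' a a' Hk Ha' e; destruct (skeleton_chain Hk) as (s & Es & Ef).
  transitivity (val (top_map (s m) a)).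
  - exact (f_equal (fun z : hom (K (skeleton C k)) X => amap z m a) (eq_sym Ef)).
  - apply f_equal; apply (lvid_top_inj (skeleton_incl_lvid (skeleton_isgen Ha'))).
    rewrite <- e, <- Es; symmetry.
    apply (top_map_cmp (h k' m) (s m)). }
intros Ha Ha' e; destruct (PeanoNat.Nat.le_ge_cases k k') as [H|H].
- now apply Hle.
- symmetry; now apply Hle.
Qed.

(** As for generators, except that invertibility elements also occur above the dimension of the
    skeleton; there injectivity of the inclusion comes from [skeleton_inv_inj]. *)
Lemma skeleton_inv_compat k k' m (j : Invn m ((skeleton C k : icomp) m))
    (j' : Invn m ((skeleton C k' : icomp) m)) :
  fmap (Invn m) (h k m) j = fmap (Invn m) (h k' m) j' ->
  val (fwdn j) = val (fwdn j') /\ val (linvn j) = val (linvn j') /\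
  val (rinvn j) = val (rinvn j').
Proof.
assert (Hle : forall k k' (j : Invn m ((skeleton C k : icomp) m))
    (j' : Invn m ((skeleton C k' : icomp) m)), k <= k' ->
  fmap (Invn m) (h k m) j = fmap (Invn m) (h k' m) j' ->
  val (fwdn j) = val (fwdn j') /\ val (linvn j) = val (linvn j') /\
  val (rinvn j) = val (rinvn j')).
{ clear - Hf; intros k k' j j' Hk e; destruct (skeleton_chain Hk) as (s & Es & Ef).
  assert (Ev : forall a, val a = val (top_map (s m) a)).
  { intros a; exact (f_equal (fun z : hom (K (skeleton C k)) X => amap z m a) (eq_sym Ef)). }
  assert (Ej : fmap (Invn m) (s m) j = j').
  { apply skeleton_inv_inj; rewrite <- e, <- Es; symmetry.
    exact (f_equal (fun g => g j) (fmap_cmp (Invn m) (h k' m) (s m))). }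
  rewrite !Ev, <- Ej; repeat split; apply f_equal.
  - exact (lev_fwd_nat (s m) j).
  - exact (lev_linv_nat (s m) j).
  - exact (lev_rinv_nat (s m) j). }
intros e; destruct (PeanoNat.Nat.le_ge_cases k k') as [H|H]; [now apply Hle|].
destruct (Hle k' k j' j H (eq_sym e)) as (E1 & E2 & E3); auto.
Qed.

End Cocone.

Lemma skeleton_gen_surj m (w : top (C m)) : isgen w -> exists k (a : top ((skeleton C k : icomp) m)),
  isgen a /\ top_map (skeleton_incl C k m) a = w.
Proof.
intros Hw; exists (S m).
assert (Hid : is_lvid (skeleton_incl C (S m) m)) by (apply skeleton_incl_lvid; lia).
destruct (lvid_top_surj Hid w) as [a <-]; exists a; split; [|reflexivity].
exact (proj1 (lvid_isgen Hid a) Hw).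
Qed.

Lemma K_skeleta_colimit :
  is_seq_colimit (X := fun k => K (skeleton C k)) (Z := K C)
    (fun k => fmap K (skeleton_step C k)) (fun k => fmap K (skeleton_incl C k)).
Proof.
split.
- intros k; rewrite <- fmap_cmp; apply (f_equal (fmap K)), skeleton_step_incl.
- intros X f Hf.
  destruct (@glue_exists nat C (skeleton C) (skeleton_incl C) X f (fun k m a => isgen a))
    as [z Hz].
  + exact skeleton_gen_surj.
  + intros m k k' a a' Ha Ha'; now apply skeleton_gen_compat.
  + intros m k a Ha; left; split; [exact Ha|].
    apply lvid_isgen; [exact (skeleton_incl_lvid (skeleton_isgen Ha)) | exact Ha].
  + exact skeleton_inv_surj.
  + intros m k k' j j'; now apply skeleton_inv_compat.
  + exists z; split; [exact Hz|]; intros z' Hz'.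
    apply (@glue_uniq nat C (skeleton C) (skeleton_incl C)).
    * intros m w Hw; destruct (skeleton_gen_surj Hw) as (k & a & _ & e); now exists k, a.
    * exact skeleton_inv_surj.
    * intros k; now rewrite Hz, Hz'.
Qed.

End Skeleta.

Theorem theorem4p15 :
  (forall C : iComp_m1, is_initial (K (sk_m1 C))) /\
  (forall C : iCompn 0,
     is_coproduct (X := fun _ : (C : SetC) => F (disk 0)) (Z := K (sk C))
       (fun v => sk_cell_cls (gen0 v))) /\
  (forall (n : nat) (C : iCompn (S n)),
     inhabited (Cellular C) /\
     forall P : Cellular C,
       is_pushout (sq_top P) (sq_left P) (sq_right C) (sq_bottom P)) /\
  (forall C : iComp,
     is_seq_colimit (X := fun k => K (skeleton C k)) (Z := K C)
       (fun k => fmap K (skeleton_step C k)) (fun k => fmap K (skeleton_incl C k))).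
Proof.
split; [exact K_sk_m1_initial|].
split; [exact K_sk_0_copower|].
split; [|exact K_skeleta_colimit].
intros n C; split; [apply Cellular_inhabited | apply K_cellular_pushout].
Qed.
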